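(* Let $A$ be a unital $C^*$-algebra, $G$ a discrete group, $(\rho,\sigma)$ a twisting pair for $A$ and $G$, and $(\mathcal{A},H,D)$ an (odd or even) spectral triple on $A$ with faithful representation $\pi:A\to\mathbb{B}(H)$. Assume that $(\rho,\sigma)$ is smooth, that $$\sup_{x\in G}\big\|[D,\pi(\rho_x(a)\sigma_{x,y})]\big\|<\infty\qquad\text{for all } a\in\mathcal{A},\ y\in G,$$ and let $\ell:G\to\mathbb{B}_h(V)$ be a proper translation bounded function, where $V$ is a nonzero finite dimensional Hilbert space. Then: (1a) [Odd to even] If $(\mathcal{A},H,D)$ is odd, then $(C_c(G,\mathcal{A}),\widetilde H,\widetilde D)$ is an even spectral triple on the reduced twisted crossed product $A\rtimes_r^{\rho,\sigma}G$, where $\widetilde H=(H\otimes\ell^2(G)\otimes V)\oplus(H\otimes\ell^2(G)\otimes V)$ with the standard grading, the representation is $\Pi\oplus\Pi$, and $$\widetilde D=\begin{pmatrix}0& D\otimes 1_{\ell^2(G)}\otimes 1_V-i\,1_H\otimes M_\ell\\ D\otimes 1_{\ell^2(G)}\otimes 1_V+i\,1_H\otimes M_\ell&0\end{pmatrix}.$$ This spectral triple is non-degenerate provided $(\mathcal{A},H,D)$ is non-degenerate. (1b) [Even to odd] If $(\mathcal{A},H,D)$ is even, with $H=H^+\oplus H^-$, $\pi=\pi^+\oplus\pi^-$ and $D=\begin{pmatrix}0&D^-\\ D^+&0\end{pmatrix}$, then $(C_c(G,\mathcal{A}),\widetilde H,\widetilde D)$ is an odd spectral triple on $A\rtimes_r^{\rho,\sigma}G$,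 where $\widetilde H=(H^+\otimes\ell^2(G)\otimes V)\oplus(H^-\otimes\ell^2(G)\otimes V)$, the representation $\Pi$ is the one induced by $\pi$ (it is diagonal, with components induced by $\pi^{\pm}$), and $$\widetilde D=\begin{pmatrix}1_{H^+}\otimes M_\ell& D^-\otimes 1_{\ell^2(G)}\otimes 1_V\\ D^+\otimes 1_{\ell^2(G)}\otimes 1_V&-1_{H^-}\otimes M_\ell\end{pmatrix}.$$ This spectral triple is non-degenerate if $(\mathcal{A},H,D)$ is non-degenerate. (2) [Finite summability] If $(\mathcal{A},H,D)$ is finitely summable and $G$ has polynomial growth with respect to $\ell$, then the spectral triple $(C_c(G,\mathcal{A}),\widetilde H,\widetilde D)$ on $A\rtimes_r^{\rho,\sigma}G$ (with $\widetilde H$, $\widetilde D$ and the representation given by the odd-to-even formulas if $(\mathcal{A},H,D)$ is odd, and by the even-to-odd formulas if $(\mathcal{A},H,D)$ is even) is finitely summable and $$\mathrm{abs}(\zeta_{\widetilde D})\le \mathrm{abs}(\zeta_D)+d_G .$$ If $\lim_n \frac{\log(\#B_n)}{\log n}$ exists, then equality holds.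
   Context: All Hilbert spaces and $C^*$-algebras are separable; all algebras are complex and unital. Twisting pair: maps $\rho:G\to\mathrm{Aut}(A)$, $\sigma:G\times G\to U(A)$ (unitary group) with $\rho_x(\sigma_{y,z})=\sigma_{x,y}\sigma_{xy,z}\sigma_{x,yz}^*$, $\rho_x\circ\rho_y=\mathrm{Ad}(\sigma_{x,y})\circ\rho_{xy}$, $\sigma_{x,e}=\sigma_{e,x}=1$, $\rho_e=\mathrm{id}_A$ for all $x,y,z\in G$. It is smooth (with respect to the dense $*$-subalgebra $\mathcal{A}$) if it restricts to a twisted action on $\mathcal{A}$: $\rho_x\in\mathrm{Aut}(\mathcal{A})$ and $\sigma_{x,y}\in U(\mathcal{A})$ for all $x,y$. Spectral triple $(\mathcal{A},H,D)$ (odd) on a unital $C^*$-algebra $A$: a dense $*$-subalgebra $\mathcal{A}\subseteq A$, a representation $\pi:A\to\mathbb{B}(H)$ and a densely defined self-adjoint operator $D$ on $H$ such that $(1+D^2)^{-1/2}$ is compact and, for every $a\in\mathcal{A}$, $\pi(a)\mathrm{Dom}(D)\subseteq\mathrm{Dom}(D)$ and $[D,\pi(a)]$ extends to a bounded operator. Even: in addition a self-adjoint $\chi$ on $H$ with $\chi^2=1$, $\chi\pi(a)=\pi(a)\chi$ for $a\in A$, $\chi\mathrm{Dom}(D)\subseteq\mathrm{Dom}(D)$, $D\chi=-\chi D$; this splits $H=H^+\oplus H^-$ with $\chi=\mathrm{diag}(1,-1)$. Non-degenerate: $\pi$ is faithful and, for $a\in\mathcal{A}$, $[D,\pi(a)]=0$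 iff $a\in\mathbb{C}1_A$. Put $\zeta_D(t)=\mathrm{tr}((I+D^2)^{-t/2})$; the triple is finitely summable if $\zeta_D(t)$ is finite for some $t$, and then $\mathrm{abs}(\zeta_D)=\inf\{t>0:\zeta_D(t)<\infty\}$. Length functions: $\mathbb{B}_h(V)$ is the space of self-adjoint operators on $V$. A function $\ell:G\to\mathbb{B}_h(V)$ is translation bounded if for each $y\in G$ the function $x\mapsto\ell(x)-\ell(y^{-1}x)$ is bounded; it is proper if (i) $\ell(g)=0$ iff $g=e$ (the neutral element), (ii) $\mathcal{S}=\bigcup_{x\in G}\mathrm{Sp}\,\ell(x)$ is a discrete subset of $\mathbb{R}$, meaning it has finite intersection with every bounded interval, (iii) for each $t\in\mathcal{S}$ the set $\{x\in G: t\in\mathrm{Sp}\,\ell(x)\}$ is finite. $M_\ell$ is the self-adjoint multiplication operator on $\ell^2(G)\otimes V$, $M_\ell(\delta_x\otimes v)=\delta_x\otimes\ell(x)v$. Let $B_n=\{g\in G:\min\mathrm{Sp}(|\ell(g)|)\le n\}$. $G$ has polynomial growth w.r.t. $\ell$ if $\#B_n$ grows at most polynomially as $n\to\infty$; then $d_G=\limsup_n\frac{\log(\#B_n)}{\log n}$. Crossed product: $C_c(G,A)$ (finitely supported functions) is a $*$-algebra via $(a\delta_x)\star(b\delta_y)=a\rho_x(b)\sigma_{x,y}\delta_{xy}$, $(a\delta_x)^*=\sigma_{x^{-1},x}^*\rho_{x^{-1}}(a^* )\delta_{x^{-1}}$. For a representation $\pi:A\to\mathbb{B}(H)$ its induced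 representation on $H\otimes\ell^2(G)$ is $a\delta_x:\xi\otimes\delta_y\mapsto\pi(\rho_{y^{-1}x^{-1}}(a)\sigma_{y^{-1}x^{-1},x})\xi\otimes\delta_{xy}$. $A\rtimes_r^{\rho,\sigma}G$ is the norm closure of the image of $C_c(G,A)$ under the representation induced by a faithful $\pi$ (independent of the choice of $\pi$). $C_c(G,\mathcal{A})$ is the dense $*$-subalgebra of finitely supported $\mathcal{A}$-valued functions. On $H\otimes\ell^2(G)\otimes V$, $\Pi$ denotes this induced representation acting trivially on $V$: $\Pi(a\delta_x)(\xi\otimes\delta_y\otimes v)=\pi(\rho_{y^{-1}x^{-1}}(a)\sigma_{y^{-1}x^{-1},x})\xi\otimes\delta_{xy}\otimes v$. The operators $\widetilde D$ are the closures of the displayed matrices on the natural domain spanned by $\xi\otimes\delta_g\otimes v$ with $\xi\in\mathrm{Dom}(D)$ (resp. $\mathrm{Dom}(D^\pm)$), $g\in G$, $v\in V$. *)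

(* Defs.v *)
From HB Require Import structures.
From mathcomp Require Export all_boot all_order all_algebra finmap.
From mathcomp Require Export all_classical all_reals all_analysis.
From mathcomp Require Export complex.
From mathcomp Require Import ring.

Set Implicit Arguments.
Unset Strict Implicit.
Unset Printing Implicit Defensive.

Import Order.TTheory GRing.Theory Num.Theory.
Export numFieldNormedType.Exports.

Local Open Scope classical_set_scope.
Local Open Scope ring_scope.

(* The inner product is linear in its first argument.                         *)
HB.mixin Record CompleteNormedModule_isHilbert (R : realType) H
    & CompleteNormedModule R[i] H := {
  inner : H -> H -> R[i];
  innerDl : forall x y z, inner (x + y) z = inner x z + inner y z;
  innerZl : forall c x y, inner (c *: x) y = c * inner x y;
  inner_conj : forall x y, inner y x = conjc (inner x y);
  normr_inner : forall x, `|x| ^+ 2 = inner x x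
}.

#[short(type="hilbertType")]
HB.structure Definition Hilbert (R : realType) :=
  {H of CompleteNormedModule_isHilbert R H & CompleteNormedModule R[i] H}.

(* Nonzero unital C*-algebras.  HB does not allow a structure joining normed  *)
(* modules with the ring hierarchy outside numDomainType, so the product and  *)
(* the unit are fields of the mixin.                                          *)
HB.mixin Record CompleteNormedModule_isCStar (R : realType) A
    & CompleteNormedModule R[i] A := {
  cone : A;
  cmul : A -> A -> A;
  star : A -> A;
  cmulA : associative cmul;
  cmul1x : left_id cone cmul;
  cmulx1 : right_id cone cmul;
  cmulDl : left_distributive cmul +%R;
  cmulDr : right_distributive cmul +%R;
  cmulZl : forall (k : R[i]) a b, cmul (k *: a) b = k *: cmul a b;
  cmulZr : forall (k : R[i]) a b, cmul a (k *: b) = k *: cmul a b;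
  cone_neq0 : cone != 0;
  starK : involutive star;
  starD : {morph star : a b / a + b};
  starZ : forall (k : R[i]) a, star (k *: a) = conjc k *: star a;
  starM : forall a b, star (cmul a b) = cmul (star b) (star a);
  normr_cmul : forall a b, `|cmul a b| <= `|a| * `|b|;
  cstar_identity : forall a, `|cmul (star a) a| = `|a| ^+ 2
}.

#[short(type="cstarType")]
HB.structure Definition CStarAlgebra (R : realType) :=
  {A of CompleteNormedModule_isCStar R A & CompleteNormedModule R[i] A}.

Notation "a ** b" := (cmul a b) (at level 40, left associativity) : ring_scope.

Section DirectSum.
Variables (R : realType) (U V : hilbertType R).

(* U * V already carries the sup norm, hence the alias for the Hilbert sum.   *)
Definition dsum : Type := (U * V)%type.

HB.instance Definition _ := GRing.Lmodule.copy dsum (U * V)%type.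

Let sqn (x : dsum) : R[i] := `|x.1| ^+ 2 + `|x.2| ^+ 2.
Definition dsum_norm (x : dsum) : R[i] := sqrtC (`|x.1| ^+ 2 + `|x.2| ^+ 2).

Let sqn_ge0 x : 0 <= sqn x.
Proof. by rewrite addr_ge0// exprn_ge0. Qed.

Lemma dsum_normD (x y : dsum) : dsum_norm (x + y) <= dsum_norm x + dsum_norm y.
Proof.
have Hge0 z : 0 <= dsum_norm z by rewrite sqrtC_ge0 sqn_ge0.
rewrite -(@ler_pXn2r _ 2)// ?nnegrE ?addr_ge0 ?Hge0//.
rewrite sqrrD !sqrtCK -sqrtCM ?nnegrE ?sqn_ge0//.
set a := `|x.1|; set b := `|y.1|; set c := `|x.2|; set d := `|y.2|.
have [a0 b0 c0 d0] : [/\ 0 <= a, 0 <= b, 0 <= c & 0 <= d] by split; exact: normr_ge0.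
have le1 : `|(x + y).1| ^+ 2 + `|(x + y).2| ^+ 2 <= (a + b) ^+ 2 + (c + d) ^+ 2.
  by rewrite lerD// lerXn2r ?nnegrE ?addr_ge0// ler_normD.
apply: (le_trans le1).
have key : a * b + c * d <= sqrtC ((a ^+ 2 + c ^+ 2) * (b ^+ 2 + d ^+ 2)).
  have p0 : 0 <= a * b + c * d by rewrite addr_ge0// mulr_ge0.
  rewrite -(@ler_pXn2r _ 2)// ?nnegrE ?sqrtC_ge0 ?mulr_ge0 ?addr_ge0 ?exprn_ge0//.
  rewrite sqrtCK -subr_ge0.
  have -> : (a ^+ 2 + c ^+ 2) * (b ^+ 2 + d ^+ 2) - (a * b + c * d) ^+ 2
    = (a * d - c * b) ^+ 2 by ring.
  by rewrite real_exprn_even_ge0// rpredB// ger0_real// mulr_ge0.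
have -> : (a + b) ^+ 2 + (c + d) ^+ 2
  = (a ^+ 2 + c ^+ 2) + (a * b + c * d) *+ 2 + (b ^+ 2 + d ^+ 2) by ring.
by rewrite lerD2r lerD2l lerMn2r.
Qed.

Lemma dsum_normZ (k : R[i]) (x : dsum) : dsum_norm (k *: x) = `|k| * dsum_norm x.
Proof.
rewrite /dsum_norm.
have -> : `|(k *: x).1| = `|k| * `|x.1| by rewrite -normrZ.
have -> : `|(k *: x).2| = `|k| * `|x.2| by rewrite -normrZ.
rewrite !exprMn -mulrDr sqrtCM ?nnegrE ?exprn_ge0 ?sqn_ge0//.
by rewrite sqrCK.
Qed.

Lemma dsum_norm_eq0 (x : dsum) : dsum_norm x = 0 -> x = 0.
Proof.
move/eqP; rewrite sqrtC_eq0 paddr_eq0 ?exprn_ge0// !expf_eq0/= !normr_eq0.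
by case: x => x1 x2 /= /andP[/eqP-> /eqP->].
Qed.

HB.instance Definition _ :=
  Lmodule_isNormed.Build R[i] dsum dsum_normD dsum_normZ dsum_norm_eq0.

Lemma dsum_normE (x : dsum) : `|x| = sqrtC (`|x.1| ^+ 2 + `|x.2| ^+ 2).
Proof. by []. Qed.

Lemma dsum_norm_fst (x : dsum) : `|x.1| <= `|x|.
Proof.
by rewrite dsum_normE -[leLHS]sqrCK// ler_sqrtC ?nnegrE ?exprn_ge0 ?sqn_ge0// lerDl exprn_ge0.
Qed.

Lemma dsum_norm_snd (x : dsum) : `|x.2| <= `|x|.
Proof.
by rewrite dsum_normE -[leLHS]sqrCK// ler_sqrtC ?nnegrE ?exprn_ge0 ?sqn_ge0// lerDr exprn_ge0.
Qed.

Lemma dsum_norm_le (x : dsum) : `|x| <= `|x.1| + `|x.2|.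
Proof.
rewrite dsum_normE -[leRHS]sqrCK ?addr_ge0//.
rewrite ler_sqrtC ?nnegrE ?exprn_ge0 ?addr_ge0 ?exprn_ge0//.
by rewrite sqrrD addrAC lerDl mulrn_wge0 ?mulr_ge0.
Qed.

Let cauchy_proj (W : completeNormedModType R[i]) (p : dsum -> W)
    (F : set_system dsum) :
  (forall x y, `|p x - p y| <= `|x - y|) ->
  ProperFilter F -> cauchy F -> cvg (p @ F).
Proof.
move=> pN FF /cauchyP Fc; apply: cauchy_cvg; apply/cauchyP => e e0.
have [x Fx] := Fc e e0; exists (p x).
rewrite /fmap /=; apply: (filterS _ Fx) => y; rewrite -!ball_normE /=.
by apply: le_lt_trans; apply: pN.
Qed.

Lemma dsum_complete (F : set_system dsum) : ProperFilter F -> cauchy F -> cvg F.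
Proof.
move=> FF Fc.
have /cvg_ex[/= l1 F1] : cvg ((fst : dsum -> U) @ F).
  by apply: cauchy_proj => // x y; exact: (dsum_norm_fst (x - y)).
have /cvg_ex[/= l2 F2] : cvg ((snd : dsum -> V) @ F).
  by apply: cauchy_proj => // x y; exact: (dsum_norm_snd (x - y)).
apply/cvg_ex; exists ((l1, l2) : dsum); apply/cvgrPdist_lt => e e0.
have e2 : 0 < e / 2 by rewrite divr_gt0.
move/cvgrPdist_lt : F1 => /(_ _ e2) F1; move/cvgrPdist_lt : F2 => /(_ _ e2) F2.
near=> x; apply: (le_lt_trans (dsum_norm_le _)); rewrite [e]splitr ltrD//.
  by near: x; exact: F1.
by near: x; exact: F2.
Unshelve. all: by end_near. Qed.

HB.instance Definition _ := Uniform_isComplete.Build dsum dsum_complete.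

Definition dsum_inner (x y : dsum) : R[i] := inner x.1 y.1 + inner x.2 y.2.

Lemma dsum_innerDl x y z : dsum_inner (x + y) z = dsum_inner x z + dsum_inner y z.
Proof. by rewrite /dsum_inner !innerDl addrACA. Qed.

Lemma dsum_innerZl k x y : dsum_inner (k *: x) y = k * dsum_inner x y.
Proof. by rewrite /dsum_inner !innerZl mulrDr. Qed.

Lemma dsum_inner_conj x y : dsum_inner y x = conjc (dsum_inner x y).
Proof. by rewrite /dsum_inner rmorphD/= -!inner_conj. Qed.

Lemma dsum_normr_inner x : `|x| ^+ 2 = dsum_inner x x.
Proof. by rewrite sqrtCK !normr_inner. Qed.

HB.instance Definition _ := CompleteNormedModule_isHilbert.Build R dsum
  dsum_innerDl dsum_innerZl dsum_inner_conj dsum_normr_inner.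

End DirectSum.

Definition separable_space (T : topologicalType) : Prop :=
  exists S : set T, countable S /\ dense S.

Definition lin_span (R : realType) (E : lmodType R[i]) (S : set E) : set E :=
  [set v | exists (n : nat) (c : 'I_n -> R[i]) (s : 'I_n -> E),
     (forall i, S (s i)) /\ v = \sum_(i < n) c i *: s i].

Definition total_set (R : realType) (H : hilbertType R) (S : set H) : Prop :=
  closure (lin_span S) = [set: H].

Section BoundedOperators.
Variables (R : realType) (H : hilbertType R).
Implicit Types T : H -> H.

Definition bounded_operator T : Prop :=
  linear T /\ exists M : R, forall x, `|T x| <= M%:C%C * `|x|.

Definition opnorm T : R :=
  inf [set M : R | 0 <= M /\ forall x, `|T x| <= M%:C%C * `|x|].

Definition compact_operator T : Prop :=
  linear T /\ compact (closure (T @` [set x | `|x| <= 1])).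

Definition self_adjoint_operator T : Prop :=
  bounded_operator T /\ forall x y, inner (T x) y = inner x (T y).

Definition positive_operator T : Prop :=
  self_adjoint_operator T /\ forall x, 0 <= inner (T x) x.

Definition orthogonal_projection T : Prop :=
  self_adjoint_operator T /\ forall x, T (T x) = T x.

(* The real points of the spectrum, which are all of it if T is self-adjoint. *)
Definition Sp T : set R :=
  [set t | ~ exists S : H -> H, [/\ bounded_operator S,
     cancel S (fun x => T x - t%:C%C *: x) &
     cancel (fun x => T x - t%:C%C *: x) S]].

(* P = |T| = (T^* T)^(1/2), for a self-adjoint T. *)
Definition is_absolute_value T (P : H -> H) : Prop :=
  positive_operator P /\ forall x, P (P x) = T (T x).

Definition orthonormal_basis (B : set H) : Prop :=
  [/\ forall e, B e -> inner e e = 1,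
      forall e f, B e -> B f -> e <> f -> inner e f = 0 &
      total_set B].

(* For T positive, independent of the orthonormal basis. *)
Definition trace T : \bar R :=
  (\esum_(e in xget set0 orthonormal_basis) (complex.Re (inner (T e) e))%:E)%E.

End BoundedOperators.

(* An unbounded operator on H is given by its graph. *)
Section UnboundedOperators.
Variables (R : realType) (H : hilbertType R).
Implicit Types D : set (H * H).

Definition is_operator D : Prop :=
  [/\ D (0, 0),
      forall (c : R[i]) p q, D p -> D q -> D (c *: p + q) &
      forall x y z, D (x, y) -> D (x, z) -> y = z].

Definition Dom D : set H := [set x | exists y, D (x, y)].

Definition adjoint D : set (H * H) :=
  [set p | forall x y, D (x, y) -> inner y p.1 = inner x p.2].

Definition self_adjoint D : Prop :=
  [/\ is_operator D, dense (Dom D) & adjoint D = D].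

(* C is the bounded extension of the commutator [D, T] from Dom D to H. *)
Definition commutator_extension D (T C : H -> H) : Prop :=
  bounded_operator C /\
  forall x y z, D (x, y) -> D (T x, z) -> C x = z - T y.

(* The resolution of the identity of D: E is a projection-valued measure,     *)
(* mu x = < E(.) x, x >, and D is the integral of t dE(t).                    *)
Record spectral_resolution D (E : set (measurableTypeR R) -> H -> H)
    (mu : H -> {measure set (measurableTypeR R) -> \bar R}) : Prop := {
  spectral_projection : forall B, measurable B -> orthogonal_projection (E B);
  spectral_setT : forall x, E setT x = x;
  spectral_setI : forall B B', measurable B -> measurable B' ->
    forall x, E (B `&` B') x = E B (E B' x);
  spectral_measureE : forall x B, measurable B ->
    mu x B = (complex.Re (inner (E B x) x))%:E;
  spectral_dom : forall x,
    Dom D x <-> (\int[mu x]_t (t ^+ 2)%:E < +oo)%E;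
  spectral_integral : forall x y, D (x, y) ->
    inner y x = ((\int[mu x]_t t)%R)%:C%C
}.

(* T = f(D), for f a bounded Borel function. *)
Definition is_functional_calculus D (f : R -> R) (T : H -> H) : Prop :=
  bounded_operator T /\
  exists E mu, @spectral_resolution D E mu /\
    forall x, inner (T x) x = ((\int[mu x]_t f t)%R)%:C%C.

Definition functional_calculus D (f : R -> R) : H -> H :=
  xget (fun=> 0) [set T | is_functional_calculus D f T].

Definition resolvent_power (t x : R) : R := (1 + x ^+ 2) `^ (- (t / 2)).

(* (1 + D^2)^(-1/2) is compact. *)
Definition has_compact_resolvent D : Prop :=
  exists T, is_functional_calculus D (resolvent_power 1) T /\
            compact_operator T.

(* tr((1 + D^2)^(-t/2)); only meaningful for t > 0. *)
Definition zeta D (t : R) : \bar R :=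
  trace (functional_calculus D (resolvent_power t)).

Definition finitely_summable D : Prop :=
  exists t : R, 0 < t /\ (zeta D t < +oo)%E.

Definition abs_zeta D : \bar R :=
  ereal_inf [set t%:E | t in [set t : R | 0 < t /\ (zeta D t < +oo)%E]].

End UnboundedOperators.

Section SpectralTriples.
Variables (R : realType) (A : cstarType R) (H : hilbertType R).

Record star_subalgebra (A0 : set A) : Prop := {
  subalgebra1 : A0 (cone : A);
  subalgebraD : forall a b, A0 a -> A0 b -> A0 (a + b);
  subalgebraZ : forall (k : R[i]) a, A0 a -> A0 (k *: a);
  subalgebraM : forall a b, A0 a -> A0 b -> A0 (a ** b);
  subalgebra_star : forall a, A0 a -> A0 (star a)
}.

Record representation (pi : A -> H -> H) : Prop := {
  representation_bounded : forall a, bounded_operator (pi a);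
  representationD : forall a b x, pi (a + b) x = pi a x + pi b x;
  representationZ : forall (k : R[i]) a x, pi (k *: a) x = k *: pi a x;
  representationM : forall a b x, pi (a ** b) x = pi a (pi b x);
  representation1 : forall x, pi cone x = x;
  representation_star : forall a x y,
    inner (pi (star a) x) y = inner x (pi a y)
}.

Record spectral_triple (A0 : set A) (pi : A -> H -> H) (D : set (H * H)) :
    Prop := {
  triple_separable_algebra : separable_space A;
  triple_separable_space : separable_space H;
  triple_subalgebra : star_subalgebra A0;
  triple_dense : dense A0;
  triple_representation : representation pi;
  triple_self_adjoint : self_adjoint D;
  triple_compact : has_compact_resolvent D;
  triple_dom : forall a, A0 a -> forall x, Dom D x -> Dom D (pi a x);
  triple_commutator : forall a, A0 a ->
    exists C, commutator_extension D (pi a) C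
}.

Record grading (pi : A -> H -> H) (D : set (H * H)) (chi : H -> H) : Prop := {
  grading_self_adjoint : self_adjoint_operator chi;
  grading_involutive : forall x, chi (chi x) = x;
  grading_even : forall a x, chi (pi a x) = pi a (chi x);
  grading_odd : forall x y, D (x, y) -> D (chi x, - chi y)
}.

Definition even_spectral_triple A0 pi D chi : Prop :=
  spectral_triple A0 pi D /\ grading pi D chi.

Definition faithful (pi : A -> H -> H) : Prop := injective pi.

Definition nondegenerate (A0 : set A) (pi : A -> H -> H) (D : set (H * H)) :
    Prop :=
  faithful pi /\
  forall a, A0 a ->
    (commutator_extension D (pi a) (fun=> 0) <->
     exists k : R[i], a = k *: (cone : A)).

End SpectralTriples.

Section TwistingPairs.
Variables (R : realType) (A : cstarType R) (G : groupType).

Record star_automorphism (f : A -> A) : Prop := {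
  automorphism_bijective : bijective f;
  automorphism_linear : linear f;
  automorphismM : forall a b, f (a ** b) = f a ** f b;
  automorphism_star : forall a, f (star a) = star (f a)
}.

Definition unitary (u : A) : Prop :=
  star u ** u = cone /\ u ** star u = cone.

Record twisting_pair (rho : G -> A -> A) (sigma : G -> G -> A) : Prop := {
  twisting_automorphism : forall x, star_automorphism (rho x);
  twisting_unitary : forall x y, unitary (sigma x y);
  twisting_cocycle : forall x y z,
    rho x (sigma y z) =
    sigma x y ** sigma (x * y)%g z ** star (sigma x (y * z)%g);
  twisting_action : forall x y a,
    rho x (rho y a) = sigma x y ** rho (x * y)%g a ** star (sigma x y);
  twisting_1r : forall x, sigma x 1%g = cone;
  twisting_1l : forall x, sigma 1%g x = cone;
  twisting_1 : forall a, rho 1%g a = a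
}.

Definition smooth (A0 : set A) (rho : G -> A -> A) (sigma : G -> G -> A) :
    Prop :=
  (forall x, rho x @` A0 = A0) /\ (forall x y, A0 (sigma x y)).

End TwistingPairs.

Section LengthFunctions.
Variables (R : realType) (G : groupType) (V : hilbertType R).
Implicit Types l : G -> V -> V.

Definition finite_dimensional : Prop :=
  exists (n : nat) (e : 'I_n -> V), lin_span (range e) = [set: V].

Definition translation_bounded l : Prop :=
  forall y, exists M : R, forall x,
    opnorm (fun v => l x v - l (y^-1 * x)%g v) <= M.

Definition length_spectrum l : set R := \bigcup_x Sp (l x).

Definition proper_length l : Prop :=
  [/\ forall g, (forall v, l g v = 0) <-> g = 1%g,
      forall a b : R, finite_set (length_spectrum l `&` `[a, b]) &
      forall t, length_spectrum l t -> finite_set [set x | Sp (l x) t]].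

(* The condition reads min Sp |l g| <= n. *)
Definition length_ball l (n : nat) : set G :=
  [set g | exists P t, [/\ is_absolute_value (l g) P, Sp P t,
     lbound (Sp P) t & t <= n%:R]].

Definition card_ball l (n : nat) : nat := #|` fset_set (length_ball l n)|%fset.

Definition polynomial_growth l : Prop :=
  (forall n, finite_set (length_ball l n)) /\
  exists (C : R) (k : nat), forall n, (0 < n)%N ->
    (card_ball l n)%:R <= C * n%:R ^+ k.

Definition growth_ratio l : R^nat :=
  fun n => ln (card_ball l n)%:R / ln n%:R.

Definition growth_dim l : \bar R := limn_esup (fun n => (growth_ratio l n)%:E).

End LengthFunctions.

(* t exhibits W as the Hilbert tensor product of H1 and H2. *)
Record hilbert_tensor (R : realType) (H1 H2 W : hilbertType R)
    (t : H1 -> H2 -> W) : Prop := {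
  tensor_linearl : forall y, linear (t^~ y);
  tensor_linearr : forall x, linear (t x);
  tensor_inner : forall x y x' y',
    inner (t x y) (t x' y') = inner x x' * inner y y';
  tensor_total : total_set [set t x y | x in setT & y in setT]
}.

(* delta exhibits L as l^2(G), with canonical basis delta. *)
Record ell2 (R : realType) (G : groupType) (L : hilbertType R) (delta : G -> L) :
    Prop := {
  ell2_inner : forall x y, inner (delta x) (delta y) = (x == y)%:R;
  ell2_total : total_set (range delta)
}.

Section CrossedProducts.
Variables (R : realType) (A : cstarType R) (G : groupType) (H : hilbertType R).
Variables (rho : G -> A -> A) (sigma : G -> G -> A) (pi : A -> H -> H).

(* C_c(G, S) inside a C*-algebra B, where u a x is the element a delta_x. *)
Definition Cc (B : cstarType R) (u : A -> G -> B) (S : set A) : set B :=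
  [set b | exists f : G -> A,
     [/\ finite_set [set x | f x != 0], forall x, S (f x) &
         b = \sum_(x \in [set x | f x != 0]) u (f x) x]].

Definition induced_entry (x y : G) (a : A) : H -> H :=
  pi (rho (y^-1 * x^-1)%g a ** sigma (y^-1 * x^-1)%g x).

(* (B, j) realizes the reduced twisted crossed product: j identifies B        *)
(* isometrically with the norm closure of the image of C_c(G, A) under the    *)
(* representation induced by pi on W = H (x) l^2(G).  The convolution and the *)
(* involution of C_c(G, A) are the ones it inherits from B through u.         *)
Record reduced_crossed_product (L W : hilbertType R) (delta : G -> L)
    (t : H -> L -> W) (B : cstarType R) (j : B -> W -> W) (u : A -> G -> B) :
    Prop := {
  crossed_representation : representation j;
  crossed_isometric : forall b, `|b| = (opnorm (j b))%:C%C;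
  crossed_induced : forall a x xi y,
    j (u a x) (t xi (delta y)) = t (induced_entry x y a xi) (delta (x * y)%g);
  crossed_dense : closure (Cc u setT) = [set: B]
}.

End CrossedProducts.

Section DiracOperators.
Variables (R : realType) (G : groupType) (H V K : hilbertType R).
(* e xi g v = xi (x) delta_g (x) v *)
Variables (e : H -> G -> V -> K) (l : G -> V -> V) (D : set (H * H)).

(* D (x) 1 (x) 1 + c (1 (x) M_l) on the span of the xi (x) delta_g (x) v with *)
(* xi in Dom D.                                                               *)
Definition dirac_entry (c : R[i]) : set (K * K) :=
  lin_span [set p | exists xi eta g v, D (xi, eta) /\
    p = (e xi g v, e eta g v + c *: e xi g (l g v))].

Definition odd_to_even : set (dsum K K * dsum K K) :=
  closure [set p | dirac_entry (- 'i%C) (p.1.2, p.2.1) /\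
                   dirac_entry 'i%C (p.1.1, p.2.2)].

Definition standard_grading (x : dsum K K) : dsum K K := (x.1, - x.2).

Definition dsum_diag (T : K -> K) (x : dsum K K) : dsum K K := (T x.1, T x.2).

(* K is the internal direct sum of the closed spans of the xi (x) delta_g     *)
(* (x) v with xi in H^+, resp. H^-, where H^+ and H^- are the eigenspaces of  *)
(* chi.  On the first one the matrix acts by its first column, (M_l, D^+),    *)
(* on the second one by its second column, (D^-, - M_l).                      *)
Definition even_to_odd (chi : H -> H) : set (K * K) :=
  closure (lin_span
    ([set p | exists xi eta g v, [/\ D (xi, eta), chi xi = xi &
        p = (e xi g v, e xi g (l g v) + e eta g v)]] `|`
     [set p | exists xi eta g v, [/\ D (xi, eta), chi xi = - xi &
        p = (e xi g v, e eta g v - e xi g (l g v))]])).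

End DiracOperators.

(* Main.v *)
(* Diagonalize D e_n = lam_n e_n and l(g) w_gk = m_gk w_gk.  Both operators D~ square to
   lam_n^2 + m_gk^2 on the total family e_n (x) delta_g (x) w_gk, and a symmetric operator
   whose square is diagonal on a total family has a closure with an orthonormal eigenbasis.
   So D~ is self-adjoint with compact resolvent, and its zeta function is, up to a factor 2 in
   the odd to even case, the sum of the (1 + lam_n^2 + m_gk^2)^(-s/2).

   The commutator of D~ with a delta_x is the sum of a block operator with entries
   [D, pi(rho(a) sigma)], bounded by hypothesis, and one with entries l(xy) - l(y), bounded
   because l is translation bounded.  If it vanishes on sum_x a_x delta_x, then the component
   at x gives [D, a] = - m theta a for every eigenvalue m of l(x), with a the entry of a_x.
   Here theta is both i and -i (odd to even), or chi (even to odd), where conjugation by chi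
   flips the sign of [D, a]; hence m a = 0, so a_x = 0 unless x = 1.

   For zeta, (1 + lam^2 + m^2)^(-(p+q)/2) <= (1 + lam^2)^(-p/2) (1 + m^2)^(-q/2), and a dyadic
   decomposition sums the last factor over g and k when q exceeds the growth exponent of the
   balls.  Conversely, keeping for each n only the g in the ball of radius
   (1 + lam_n^2)^(1/2), of cardinality at least a constant times (1 + lam_n^2)^(a/2), bounds
   zeta_D~(s) below by a multiple of zeta_D(s - a). *)
Require Import Defs.
From mathcomp Require Import ring lra measurable_realfun spectral.

Set Implicit Arguments.
Unset Strict Implicit.
Unset Printing Implicit Defensive.

Import Order.TTheory GRing.Theory Num.Theory.

Local Open Scope classical_set_scope.
Local Open Scope ring_scope.

(** * Hilbert space geometry *)

(** The compact resolvent supplies only some projection-valued measure, known through the quadratic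
    forms of D and of (1 + D^2)^(-1/2); commutation with D and uniqueness are not part of it. The
    eigenvectors of D are therefore extracted by polarizing these forms: projections of single
    points give eigenvectors, and compactness excludes continuous spectrum. Likewise
    [functional_calculus] and [trace] are choices. They are pinned down because every resolution
    acts in the same way on eigenvectors, and because the sums involved are non-negative and can be
    evaluated in any orthonormal basis.

    The tensor products, l^2(G) and the crossed product are known only through their defining
    properties. Identities between operators are checked on elementary tensors and extended by
    density; identities in the crossed product are checked on operators, its norm being an operator
    norm. Orthonormal systems may contain zero vectors, whence the weights ||e_n||^2, equal to 0 or
    1, in the sums. *)

Section RealNorm.
Variables (R : realType) (E : normedModType R[i]).
Implicit Types x y : E.

(* The norm of E takes its values in R[i], where the order is partial. *)
Definition nr (x : E) : R := complex.Re `|x|.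

Lemma nrE x : `|x| = (nr x)%:C%C.
Proof. by rewrite /nr RRe_real// ger0_real. Qed.

Lemma nr_ge0 x : 0 <= nr x.
Proof. by rewrite -lecR -nrE normr_ge0. Qed.

Lemma nr0 : nr 0 = 0.
Proof. by rewrite /nr normr0. Qed.

Lemma nr_eq0 x : nr x = 0 -> x = 0.
Proof. by move=> h; apply/normr0_eq0; rewrite nrE h. Qed.

Lemma nrN x : nr (- x) = nr x.
Proof. by rewrite /nr normrN. Qed.

Lemma nrBC x y : nr (x - y) = nr (y - x).
Proof. by rewrite -nrN opprB. Qed.

Lemma nrD x y : nr (x + y) <= nr x + nr y.
Proof. by rewrite -lecR rmorphD/= -!nrE ler_normD. Qed.

Lemma nrB x y : nr (x - y) <= nr x + nr y.
Proof. by rewrite -(nrN y) nrD. Qed.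

Lemma nr_tri z x y : nr (x - y) <= nr (x - z) + nr (z - y).
Proof. by apply: le_trans (nrD _ _); rewrite addrA subrK. Qed.

Lemma nrZ (c : R[i]) x : nr (c *: x) = complex.Re `|c| * nr x.
Proof.
apply: complexI; rewrite rmorphM/= -nrE normrZ nrE.
by rewrite [X in X * _ = _](_ : _ = (complex.Re `|c|)%:C%C)// RRe_real// ger0_real.
Qed.

Lemma nr_sum (I : Type) (s : seq I) (P : pred I) (F : I -> E) :
  nr (\sum_(i <- s | P i) F i) <= \sum_(i <- s | P i) nr (F i).
Proof.
elim/big_ind2 : _ => //; first by rewrite nr0.
by move=> x1 x2 y1 y2 h1 h2; apply: le_trans (nrD _ _) _; rewrite lerD.
Qed.

Lemma small_eq0 x : (forall e : R, 0 < e -> nr x <= e) -> x = 0.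
Proof.
move=> h; apply: nr_eq0; apply/eqP; rewrite eq_le nr_ge0 andbT.
by apply/ler_addgt0Pr => e /h; rewrite add0r.
Qed.

Lemma nbhs_nrP (x : E) (P : set E) :
  nbhs x P <-> exists2 e : R, 0 < e & forall y, nr (x - y) < e -> P y.
Proof.
rewrite -nbhs_ballE; split=> [[e /= e0 eP]|[e e0 eP]].
  have er : e = (complex.Re e)%:C%C by rewrite RRe_real// gtr0_real.
  exists (complex.Re e); first by rewrite -ltcR -er.
  by move=> y xy; apply: eP; rewrite -ball_normE /= nrE er ltcR.
exists e%:C%C; first by rewrite /= (ltcR 0 e).
by move=> y; rewrite -ball_normE /= nrE ltcR; exact: eP.
Qed.

Lemma closure_nrP (S : set E) x :
  closure S x <-> forall e : R, 0 < e -> exists2 y, S y & nr (x - y) < e.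
Proof.
split=> [cS e e0|h B /nbhs_nrP[e /h[y Sy xy] eB]]; last by exists y; split => //; exact: eB.
have [|y [Sy xy]] := cS [set y | nr (x - y) < e]; last by exists y.
by apply/nbhs_nrP; exists e.
Qed.

Lemma dense_closureP (S : set E) : dense S <-> closure S = [set: E].
Proof.
split=> [dS|cS].
  rewrite -subTset => x _; apply/closure_nrP => e e0.
  have ne : ball x e%:C%C !=set0.
    by exists x; apply: ballxx; rewrite (ltcR 0 e).
  have [y [By Sy]] := dS _ ne (@ball_open R[i] E x e%:C%C).
  by exists y => //; move: By; rewrite -ball_normE /= nrE ltcR.
move=> O [x Ox] oO.
have : closure S x by rewrite cS.
move=> /(_ O) []; first exact: open_nbhs_nbhs.
by move=> y [Sy Oy]; exists y.
Qed.

End RealNorm.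

Lemma seq_complete (R : realType) (E : completeNormedModType R[i]) (u : nat -> E) :
  (forall e : R, 0 < e -> exists N, forall m n, (N <= m)%N -> (N <= n)%N ->
    nr (u m - u n) < e) ->
  exists l, forall e : R, 0 < e -> exists N, forall n, (N <= n)%N -> nr (u n - l) < e.
Proof.
move=> cu.
have : cauchy (u @ \oo).
  apply/cauchyP => e e0.
  have er : e = (complex.Re e)%:C%C by rewrite RRe_real// gtr0_real.
  have [|N hN] := cu (complex.Re e); first by rewrite -ltcR -er.
  exists (u N), N => // n /= Nn.
  by rewrite -ball_normE /= nrE er ltcR hN.
move/cauchy_cvg/cvg_ex => -[l /cvgrPdist_lt ul]; exists l => e e0.
have e0' : (0 : R[i]) < e%:C%C by rewrite (ltcR 0 e).
have [N _ hN] := ul _ e0'; exists N => n Nn.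
by have := hN n Nn; rewrite /= nrE ltcR nrBC.
Qed.

Lemma closure_prodP (R : realType) (E F : normedModType R[i]) (S : set (E * F)) x y :
  closure S (x, y) <-> forall e : R, 0 < e ->
    exists a b, [/\ S (a, b), nr (x - a) < e & nr (y - b) < e].
Proof.
split=> [cS e e0|h B].
  have e0' : (0 : R[i]) < e%:C%C by rewrite (ltcR 0 e).
  have [|[a b] [Sab /= [ha hb]]] := cS (ball x e%:C%C `*` ball y e%:C%C).
    by exists (ball x e%:C%C, ball y e%:C%C) => //; split; exact: nbhsx_ballx.
  by exists a, b; move: ha hb; rewrite -!ball_normE /= !nrE !ltcR.
move=> [[P Q] /= []]; rewrite -!nbhs_ballE => -[e1 /= e10 eP] [e2 /= e20 eQ] PQB.
have er1 : e1 = (complex.Re e1)%:C%C by rewrite RRe_real// gtr0_real.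
have er2 : e2 = (complex.Re e2)%:C%C by rewrite RRe_real// gtr0_real.
have [|a [b [Sab ha hb]]] := h (Num.min (complex.Re e1) (complex.Re e2)).
  by rewrite lt_min -!ltcR -er1 -er2 e10.
move: ha hb; rewrite !lt_min => /andP[ha _] /andP[_ hb].
exists (a, b); split => //; apply: PQB; split => /=.
  by apply: eP; rewrite -ball_normE /= nrE er1 ltcR.
by apply: eQ; rewrite -ball_normE /= nrE er2 ltcR.
Qed.

Section Inner.
Variables (R : realType) (H : hilbertType R).
Implicit Types (x y z : H) (c : R[i]).

Definition cab (c : R[i]) : R := complex.Re `|c|.

Lemma cabE c : `|c| = (cab c)%:C%C.
Proof. by rewrite /cab RRe_real// ger0_real. Qed.

Lemma cab_ge0 c : 0 <= cab c.
Proof. by rewrite -lecR -cabE normr_ge0. Qed.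

Lemma cabM c d : cab (c * d) = cab c * cab d.
Proof. by apply: complexI; rewrite rmorphM/= -!cabE normrM. Qed.

Lemma cabD c d : cab (c + d) <= cab c + cab d.
Proof. by rewrite -lecR rmorphD/= -!cabE ler_normD. Qed.

Lemma cabN c : cab (- c) = cab c.
Proof. by rewrite /cab normrN. Qed.

Lemma cab0 : cab 0 = 0.
Proof. by rewrite /cab normr0. Qed.

Lemma cab_eq0 c : cab c = 0 -> c = 0.
Proof. by move=> h; apply: normr0_eq0; rewrite cabE h. Qed.

Lemma cab_real (a : R) : cab a%:C%C = `|a|.
Proof. by rewrite /cab normc_def/= expr0n/= addr0 sqrtr_sqr. Qed.

Lemma cab_conj c : cab (conjc c) = cab c.
Proof. by rewrite /cab normcJ. Qed.

Lemma mul_conjc c : c * conjc c = (cab c ^+ 2)%:C%C.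
Proof. by rewrite -sqr_normc cabE rmorphXn. Qed.

Lemma conjcM c d : conjc (c * d) = conjc c * conjc d.
Proof. exact: rmorphM. Qed.

Lemma innerDr x y z : inner x (y + z) = inner x y + inner x z.
Proof. by rewrite inner_conj innerDl rmorphD/= -!inner_conj. Qed.

Lemma innerZr c x y : inner x (c *: y) = conjc c * inner x y.
Proof. by rewrite inner_conj innerZl rmorphM/= -inner_conj. Qed.

Lemma inner0l x : inner 0 x = 0.
Proof. by rewrite -(scale0r 0) innerZl mul0r. Qed.

Lemma inner0r x : inner x 0 = 0.
Proof. by rewrite inner_conj inner0l conjc0. Qed.

Lemma innerNl x y : inner (- x) y = - inner x y.
Proof. by rewrite -scaleN1r innerZl mulN1r. Qed.

Lemma innerNr x y : inner x (- y) = - inner x y.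
Proof. by rewrite inner_conj innerNl rmorphN/= -inner_conj. Qed.

Lemma innerBl x y z : inner (x - y) z = inner x z - inner y z.
Proof. by rewrite innerDl innerNl. Qed.

Lemma innerBr x y z : inner x (y - z) = inner x y - inner x z.
Proof. by rewrite innerDr innerNr. Qed.

Lemma inner_suml (I : Type) (s : seq I) (P : pred I) (F : I -> H) y :
  inner (\sum_(i <- s | P i) F i) y = \sum_(i <- s | P i) inner (F i) y.
Proof.
by elim/big_rec2 : _ => [|i a b _ <-]; rewrite ?inner0l// innerDl.
Qed.

Lemma inner_sumr (I : Type) (s : seq I) (P : pred I) (F : I -> H) y :
  inner y (\sum_(i <- s | P i) F i) = \sum_(i <- s | P i) inner y (F i).
Proof.
by elim/big_rec2 : _ => [|i a b _ <-]; rewrite ?inner0r// innerDr.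
Qed.

Lemma inner_nr x : inner x x = (nr x ^+ 2)%:C%C.
Proof. by rewrite -normr_inner nrE rmorphXn. Qed.

Lemma inner_eq0 x : inner x x = 0 -> x = 0.
Proof.
rewrite inner_nr => /complexI/eqP; rewrite sqrf_eq0 => /eqP; exact: nr_eq0.
Qed.

Lemma nrZc c x : nr (c *: x) = cab c * nr x.
Proof. exact: nrZ. Qed.

Lemma cauchy_schwarz x y : cab (inner x y) <= nr x * nr y.
Proof.
have [->|y0] := eqVneq y 0; first by rewrite inner0r cab0 nr0 mulr0.
have ny : 0 < nr y.
  by rewrite lt_neqAle nr_ge0 andbT; apply: contra_neq y0 => h; apply: nr_eq0.
rewrite -(@ler_pXn2r _ 2)// ?nnegrE ?mulr_ge0 ?nr_ge0 ?cab_ge0//.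
(* [b *: x - c *: y] is ||y||^2 times the component of x orthogonal to y; its square norm divided by
   ||y||^2 is the difference of the two squared sides. *)
set c := inner x y; pose b := (nr y ^+ 2)%:C%C : R[i].
have : 0 <= inner (b *: x - c *: y) (b *: x - c *: y).
  by rewrite inner_nr (ler0c (nr _ ^+ 2)) sqr_ge0.
have -> : inner (b *: x - c *: y) (b *: x - c *: y) =
    b * (b * inner x x - c * conjc c).
  have bE : conjc b = b by rewrite conjc_real.
  have yx : inner y x = conjc c by rewrite inner_conj.
  have yy : inner y y = b by rewrite inner_nr.
  rewrite !(innerBl, innerBr, innerZl, innerZr) bE yx yy -/c; ring.
rewrite mul_conjc inner_nr -!rmorphM/= -rmorphB/= -rmorphM/= ler0c.
rewrite pmulr_rge0 ?exprn_gt0// subr_ge0 exprMn mulrC => h.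
by rewrite [X in _ <= X]mulrC mulrC.
Qed.

Lemma inner_ext x y : (forall z, inner x z = inner y z) -> x = y.
Proof.
by move=> h; apply/eqP; rewrite -subr_eq0; apply/eqP/inner_eq0; rewrite innerBl h subrr.
Qed.

Lemma pythagoras x y : inner x y = 0 -> nr (x + y) ^+ 2 = nr x ^+ 2 + nr y ^+ 2.
Proof.
move=> xy; apply: complexI; rewrite rmorphD/= -!inner_nr innerDl !innerDr xy.
by rewrite (inner_conj x y) xy conjc0 addr0 add0r.
Qed.

End Inner.

(** * Orthonormal systems, Bessel's inequality and expansions *)

Section Systems.
Variables (R : realType) (H : hilbertType R) (I : eqType).
Implicit Types (f : I -> H) (x : H).

(* Zero vectors are allowed, so that a separable space of any dimension has a basis indexed by nat. *)
Definition osys f := (forall i j, i != j -> inner (f i) (f j) = 0) /\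
  forall i, f i = 0 \/ inner (f i) (f i) = 1.

Definition coef f x i := inner x (f i).

Definition psum f x (s : seq I) : H := \sum_(i <- s) coef f x i *: f i.

Variables (f : I -> H) (fo : osys f).

(** A zero vector has coefficient 0 and a unit vector has square norm 1, so the formulas for
    orthonormal systems survive the presence of zero vectors. *)
Lemma coef_idem x i : coef f x i * inner (f i) (f i) = coef f x i.
Proof. by case: (fo.2 i) => h; rewrite /coef h ?inner0r ?mul0r// mulr1. Qed.

Lemma inner_comb (c : I -> R[i]) (s : seq I) j : uniq s ->
  inner (\sum_(i <- s) c i *: f i) (f j) =
  if j \in s then c j * inner (f j) (f j) else 0.
Proof.
move=> us; rewrite inner_suml; case: ifPn => js.
  rewrite (bigD1_seq j)//= innerZl big1 ?addr0// => i ij.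
  by rewrite innerZl fo.1// mulr0.
rewrite big_seq big1// => i is_; rewrite innerZl fo.1 ?mulr0//.
by apply: contraNneq js => <-.
Qed.

Lemma inner_psum x (s : seq I) j : uniq s ->
  inner (psum f x s) (f j) = if j \in s then coef f x j else 0.
Proof. by move=> us; rewrite inner_comb//; case: ifP => // _; exact: coef_idem. Qed.

Lemma nr_comb (c : I -> R[i]) (s : seq I) : uniq s ->
  nr (\sum_(i <- s) c i *: f i) ^+ 2 = \sum_(i <- s) cab (c i) ^+ 2 * nr (f i) ^+ 2.
Proof.
move=> us; apply: complexI; rewrite -inner_nr inner_sumr.
rewrite [RHS]rmorph_sum/= big_seq [RHS]big_seq; apply: eq_bigr => i is_.
by rewrite innerZr inner_comb// is_ mulrA [conjc _ * _]mulrC mul_conjc inner_nr -rmorphM.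
Qed.

Lemma nr_coef x i : cab (coef f x i) ^+ 2 * nr (f i) ^+ 2 = cab (coef f x i) ^+ 2.
Proof.
apply: complexI; rewrite rmorphM/= -inner_nr -mul_conjc mulrAC.
by rewrite coef_idem.
Qed.

Lemma nr_psum x (s : seq I) : uniq s ->
  nr (psum f x s) ^+ 2 = \sum_(i <- s) cab (coef f x i) ^+ 2.
Proof.
by move=> us; rewrite nr_comb//; apply: eq_bigr => i _; exact: nr_coef.
Qed.

Lemma psum_orth x (c : I -> R[i]) (s : seq I) : uniq s ->
  inner (x - psum f x s) (\sum_(i <- s) c i *: f i) = 0.
Proof.
move=> us; rewrite inner_sumr big_seq big1// => i is_.
by rewrite innerZr innerBl inner_psum// is_ subrr mulr0.
Qed.

Lemma bessel_eq x (s : seq I) : uniq s ->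
  nr x ^+ 2 = nr (x - psum f x s) ^+ 2 + \sum_(i <- s) cab (coef f x i) ^+ 2.
Proof.
by move=> us; rewrite -nr_psum// -pythagoras ?subrK// psum_orth.
Qed.

Lemma bessel x (s : seq I) : uniq s ->
  \sum_(i <- s) cab (coef f x i) ^+ 2 <= nr x ^+ 2.
Proof. by move=> us; rewrite (bessel_eq x us) lerDr sqr_ge0. Qed.

(** The two combinations differ by an element of the span, which is orthogonal to [x - psum f x s];
    then Pythagoras applies. *)
Lemma psum_best x (c : I -> R[i]) (s : seq I) : uniq s ->
  nr (x - psum f x s) <= nr (x - \sum_(i <- s) c i *: f i).
Proof.
move=> us; rewrite -(@ler_pXn2r _ 2)// ?nnegrE ?nr_ge0//.
have -> : x - \sum_(i <- s) c i *: f i =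
    (x - psum f x s) + \sum_(i <- s) (coef f x i - c i) *: f i.
  under [X in _ = _ + X]eq_bigr do rewrite scalerBl.
  by rewrite sumrB addrA subrK.
by rewrite [X in _ <= X]pythagoras ?psum_orth// lerDl sqr_ge0.
Qed.

(* A repeated index is harmless: the coefficients of the span are summed. *)
Lemma span_uniq (v : H) : lin_span (range f) v ->
  exists (s : seq I) (c : I -> R[i]), uniq s /\ v = \sum_(i <- s) c i *: f i.
Proof.
move=> [n [c [g [fg ->]]]].
have {fg} [k kE] : exists k : 'I_n -> I, forall i, g i = f (k i).
  have /choice[k kE] : forall i, exists j, g i = f j.
    by move=> i; case: (fg i) => j _ <-; exists j.
  by exists k.
exists (undup [seq k i | i : 'I_n]), (fun j => \sum_(i < n | k i == j) c i).
split; first exact: undup_uniq.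
under [RHS]eq_bigr do rewrite scaler_suml.
rewrite (exchange_big_dep predT)//=; apply: eq_bigr => i _.
under eq_bigl do rewrite eq_sym.
rewrite kE -big_filter filter_pred1_uniq ?undup_uniq ?big_seq1//.
by rewrite mem_undup; apply/mapP; exists i; rewrite ?mem_enum.
Qed.

Lemma psum_approx x (e : R) : total_set (range f) -> 0 < e ->
  exists2 s, uniq s & nr (x - psum f x s) < e.
Proof.
move=> tf e0; have : closure (lin_span (range f)) x by rewrite tf.
move=> /closure_nrP /(_ _ e0) [y /span_uniq[s [c [us ->]]] lt].
by exists s => //; apply: le_lt_trans lt; exact: psum_best.
Qed.

End Systems.

Section NatSystems.
Variables (R : realType) (H : hilbertType R) (e : nat -> H).
Hypothesis eo : osys e.
Implicit Types (x : H) (c : nat -> R[i]).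

Lemma sum_ord_iota (V : nmodType) (F : nat -> V) n :
  \sum_(i < n) F i = \sum_(i <- index_iota 0 n) F i.
Proof. by rewrite (big_mkord predT F). Qed.

Definition bounded_coef c (M : R) :=
  forall N, \sum_(n < N) cab (c n) ^+ 2 * nr (e n) ^+ 2 <= M.

Lemma comb_diff c m n : (m <= n)%N ->
  nr (\sum_(i < n) c i *: e i - \sum_(i < m) c i *: e i) ^+ 2 =
  \sum_(i < n) cab (c i) ^+ 2 * nr (e i) ^+ 2 -
  \sum_(i < m) cab (c i) ^+ 2 * nr (e i) ^+ 2.
Proof.
move=> mn; rewrite (sum_ord_iota (fun i => c i *: e i)) (sum_ord_iota (fun i => c i *: e i) m).
rewrite (sum_ord_iota (fun i => cab (c i) ^+ 2 * nr (e i) ^+ 2)).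
rewrite (sum_ord_iota (fun i => cab (c i) ^+ 2 * nr (e i) ^+ 2) m).
rewrite (big_cat_nat (leq0n m) mn)/= addrAC subrr add0r.
rewrite (big_cat_nat (leq0n m) mn)/= [RHS]addrAC subrr add0r.
by rewrite (nr_comb eo)// /index_iota iota_uniq.
Qed.

Lemma monotone_cauchy (u : nat -> R) (M : R) :
  (forall m n, (m <= n)%N -> u m <= u n) -> (forall n, u n <= M) ->
  forall eps, 0 < eps -> exists N, forall n, (N <= n)%N -> u n - u N < eps.
Proof.
move=> um uM eps e0.
have hs : has_sup (range u).
  by split; [exists (u 0%N), 0%N|exists M => _ [n _ <-]].
have [_ [N _ <-] uN] := sup_adherent e0 hs; exists N => n _.
rewrite ltrBlDr addrC -ltrBlDr; apply: le_lt_trans uN.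
by rewrite lerB//; apply: ub_le_sup; [exact: hs.2|exists n].
Qed.

(** The partial sums are Cauchy because their square norms increase to a finite limit. Where
    [e n = 0] the number [c n] is lost, hence the factor [inner (e n) (e n)]. *)
Lemma riesz_fischer c (M : R) : bounded_coef c M ->
  exists y, (forall n, inner y (e n) = c n * inner (e n) (e n)) /\
    forall eps : R, 0 < eps -> exists N, forall n, (N <= n)%N ->
      nr (\sum_(i < n) c i *: e i - y) < eps.
Proof.
move=> bc; pose s n := \sum_(i < n) c i *: e i.
pose q n := \sum_(i < n) cab (c i) ^+ 2 * nr (e i) ^+ 2.
have qm m n : (m <= n)%N -> q m <= q n.
  by move=> mn; rewrite -subr_ge0 /q -comb_diff// sqr_ge0.
have [|y ys] := @seq_complete R H s.
  move=> eps e0; have e20 : 0 < eps / 2 by rewrite divr_gt0.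
  have [N hN] := monotone_cauchy qm bc (exprn_gt0 2 e20).
  have sN n : (N <= n)%N -> nr (s n - s N) < eps / 2.
    move=> Nn; rewrite -(@ltr_pXn2r _ 2)// ?nnegrE ?nr_ge0 ?(ltW e20)//.
    by rewrite comb_diff// hN.
  exists N => m n Nm Nn; apply: le_lt_trans (nr_tri (s N) _ _) _.
  by rewrite [ltRHS]splitr (nrBC (s N)) ltrD// sN.
exists y; split => // n.
apply/eqP; rewrite -subr_eq0; apply/eqP/cab_eq0/eqP.
rewrite eq_le cab_ge0 andbT; apply/ler_addgt0Pr => eps e0; rewrite add0r.
have d0 : 0 < eps / (nr (e n) + 1).
  by rewrite divr_gt0// ltr_wpDl ?nr_ge0.
have [N hN] := ys _ d0.
(* The index must exceed n as well as N, so that the partial sum contains the n-th term. *)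
have -> : inner y (e n) - c n * inner (e n) (e n) =
    - inner (s (maxn N n.+1) - y) (e n).
  rewrite innerBl opprB /s -(big_mkord predT (fun i => c i *: e i)) (inner_comb eo)//.
    by rewrite mem_index_iota leq_max ltnSn orbT.
  exact: iota_uniq.
rewrite cabN; apply: le_trans (cauchy_schwarz _ _) _.
have {hN} := hN _ (leq_maxl N n.+1).
rewrite ltr_pdivlMr ?ltr_wpDl ?nr_ge0// => /ltW; apply: le_trans.
by rewrite ler_wpM2l ?nr_ge0// lerDl.
Qed.

Definition complete_sys := forall x, (forall n, inner x (e n) = 0) -> x = 0.

(** The series converges by Bessel's inequality and [riesz_fischer]; its sum has the coefficients of
    x, and completeness identifies the two. *)
Lemma psum_cvg x : complete_sys -> forall eps : R, 0 < eps ->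
  exists N, forall n, (N <= n)%N -> nr (x - \sum_(i < n) coef e x i *: e i) < eps.
Proof.
move=> ce eps e0.
have [|y [yc ys]] := @riesz_fischer (coef e x) (nr x ^+ 2).
  move=> N; under eq_bigr do rewrite (nr_coef eo).
  rewrite -(big_mkord predT (fun i => cab (coef e x i) ^+ 2)).
  by apply: (bessel eo); exact: iota_uniq.
have xy : x = y; last by have [N hN] := ys _ e0; exists N => n /hN; rewrite nrBC -xy.
apply/eqP; rewrite -subr_eq0; apply/eqP/ce => n.
by rewrite innerBl yc (coef_idem eo) subrr.
Qed.

Lemma complete_total : complete_sys -> total_set (range e).
Proof.
move=> ce; rewrite /total_set -subTset => x _; apply/closure_nrP => eps e0.
have [N hN] := psum_cvg x ce e0; exists (\sum_(i < N) coef e x i *: e i); last exact: hN.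
by exists N, (fun i : 'I_N => coef e x i), (fun i : 'I_N => e i); split => // i; exists (val i).
Qed.

Lemma coef_inj x y : complete_sys -> (forall n, inner x (e n) = inner y (e n)) -> x = y.
Proof.
move=> ce h; apply/eqP; rewrite -subr_eq0; apply/eqP/ce => n.
by rewrite innerBl h subrr.
Qed.

End NatSystems.

(** * Linear spans and extension by density *)

Section LinearSpan.
Variables (R : realType).

Lemma linear_scale (E F : lmodType R[i]) (T : E -> F) k x : linear T -> T (k *: x) = k *: T x.
Proof.
move=> lT; have T0 : T 0 = 0.
  by have := lT (-1) 0 0; rewrite scaler0 addr0 scaleN1r addNr.
by rewrite -[k *: x]addr0 lT T0 addr0.
Qed.

Lemma linear_add (E F : lmodType R[i]) (T : E -> F) x y : linear T -> T (x + y) = T x + T y.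
Proof. by move=> lT; rewrite -[x in LHS]scale1r lT scale1r. Qed.

Lemma linear_0 (E F : lmodType R[i]) (T : E -> F) : linear T -> T 0 = 0.
Proof. by move=> lT; rewrite -(scale0r 0) linear_scale// scale0r. Qed.

Lemma linear_sub (E F : lmodType R[i]) (T : E -> F) x y : linear T -> T (x - y) = T x - T y.
Proof. by move=> lT; rewrite linear_add// -scaleN1r linear_scale// scaleN1r. Qed.

Lemma linear_bigsum (E F : lmodType R[i]) (T : E -> F) (I : Type) (s : seq I)
    (P : pred I) (f : I -> E) :
  linear T -> T (\sum_(i <- s | P i) f i) = \sum_(i <- s | P i) T (f i).
Proof.
move=> lT; elim/big_rec2 : _ => [|i a b _ <-]; first exact: linear_0.
exact: linear_add.
Qed.

Lemma lin_span_sub (E : lmodType R[i]) (S : set E) : S `<=` lin_span S.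
Proof.
move=> x Sx; exists 1%N, (fun=> 1), (fun=> x); split => //.
by rewrite big_ord1 scale1r.
Qed.

Lemma lin_spanP (E : lmodType R[i]) (S : set E) c x y :
  lin_span S x -> lin_span S y -> lin_span S (c *: x + y).
Proof.
move=> [n [a [s [Ss ->]]]] [m [b [t [St ->]]]].
exists (n + m)%N, (fun i => match fintype.split i with inl i => c * a i | inr i => b i end),
  (fun i => match fintype.split i with inl i => s i | inr i => t i end); split.
  by move=> i; case: (fintype.split i).
rewrite big_split_ord/= scaler_sumr; congr (_ + _); apply: eq_bigr => i _.
  by rewrite (unsplitK (inl _ i)) scalerA.
by rewrite (unsplitK (inr _ i)).
Qed.

Lemma lin_span0 (E : lmodType R[i]) (S : set E) : lin_span S 0.
Proof.
by exists 0%N, (fun=> 0), (fun=> 0); split; [case|rewrite big_ord0].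
Qed.

Lemma lin_span_ind (E : lmodType R[i]) (S P : set E) :
  P 0 -> (forall c x y, P x -> P y -> P (c *: x + y)) -> S `<=` P -> lin_span S `<=` P.
Proof.
move=> P0 PD SP _ [n [a [s [Ss ->]]]].
elim/big_rec : _ => [//|i x _ Px]; exact: PD (SP _ (Ss i)) Px.
Qed.

End LinearSpan.

Section Bounded.
Variables (R : realType) (E F : normedModType R[i]).

Definition nbounded (T : E -> F) (M : R) := forall x, nr (T x) <= M * nr x.

Definition closed_subspace (N : set F) :=
  [/\ N 0, forall c x y, N x -> N y -> N (c *: x + y) & closure N `<=` N].

Lemma closed_subspace_span (S : set F) : closed_subspace (closure (lin_span S)).
Proof.
split.
- exact/subset_closure/lin_span0.
- move=> c x y /closure_nrP cx /closure_nrP cy; apply/closure_nrP => eps e0.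
  have e20 : 0 < eps / 2 by rewrite divr_gt0.
  have c0 : 0 < complex.Re `|c| + 1.
    by have := cab_ge0 c; rewrite /cab => c0; rewrite ltr_wpDl.
  have [x' Sx' hx] := cx _ (divr_gt0 e20 c0); have [y' Sy' hy] := cy _ e20.
  exists (c *: x' + y'); first exact: lin_spanP.
  rewrite opprD addrACA -scalerBr; apply: le_lt_trans (nrD _ _) _.
  rewrite [ltRHS]splitr ltr_leD ?(ltW hy)// nrZ.
  move: hx; rewrite ltr_pdivlMr// mulrC; apply: le_lt_trans.
  by rewrite ler_wpM2r ?nr_ge0// lerDl.
- exact: closed_closure.
Qed.

(** The preimage of N under T is a closed subspace, so it is everything as soon as it contains a
    total set. This is the density argument behind the identities on tensor products below. *)
Lemma total_transfer (T : E -> F) (M : R) (S : set E) (N : set F) :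
  linear T -> nbounded T M -> closure (lin_span S) = [set: E] -> closed_subspace N ->
  (forall s, S s -> N (T s)) -> forall x, N (T x).
Proof.
move=> lT bT tS [N0 ND Ncl] SN x; apply: Ncl; apply/closure_nrP => eps e0.
have spanN y : lin_span S y -> N (T y).
  have : lin_span S `<=` [set y | N (T y)].
    apply: lin_span_ind => /=; first by rewrite linear_0.
    by move=> c a b Na Nb; rewrite lT; exact: ND.
    exact: SN.
  exact.
have : closure (lin_span S) x by rewrite tS.
(* M may vanish or be negative, so the tolerance is divided by [|M| + 1]. *)
have m0 : 0 < `|M| + 1 by rewrite ltr_wpDl.
move=> /closure_nrP /(_ _ (divr_gt0 e0 m0)) [y Sy].
rewrite ltr_pdivlMr// mulrC => h; exists (T y); first exact: spanN.
rewrite -linear_sub//; apply: le_lt_trans (bT _) _; apply: le_lt_trans h.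
by rewrite ler_wpM2r ?nr_ge0// (le_trans (ler_norm _))// lerDl.
Qed.

Lemma closed_subspace0 : closed_subspace [set (0 : F)].
Proof.
split => //= [c x y -> ->|x /closure_nrP h /=]; first by rewrite scaler0 addr0.
by apply: small_eq0 => eps /h [_ /= -> /ltW]; rewrite subr0.
Qed.

Lemma total_ext (T T' : E -> F) (M M' : R) (S : set E) :
  linear T -> nbounded T M -> linear T' -> nbounded T' M' ->
  closure (lin_span S) = [set: E] ->
  (forall s, S s -> T s = T' s) -> forall x, T x = T' x.
Proof.
move=> lT bT lT' bT' tS SN x; apply/eqP; rewrite -subr_eq0; apply/eqP.
apply: (@total_transfer (fun x => T x - T' x) (M + M') S [set 0]) => //.
- by move=> c a b /=; rewrite lT lT' scalerBr opprD addrACA.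
- by move=> a; apply: le_trans (nrB _ _) _; rewrite mulrDl lerD.
- exact: closed_subspace0.
- by move=> s Ss /=; rewrite SN// subrr.
Qed.

End Bounded.

Lemma total_trans (R : realType) (E : normedModType R[i]) (S S' : set E) :
  closure (lin_span S) = [set: E] -> (forall s, S s -> closure (lin_span S') s) ->
  closure (lin_span S') = [set: E].
Proof.
move=> tS SS'; rewrite -subTset => x _.
apply: (@total_transfer R E E id 1 S (closure (lin_span S'))) => //.
- by move=> y; rewrite mul1r.
- exact: closed_subspace_span.
Qed.

(** The operator is given by a linear relation instead of a function on a subspace: the bound alone
    makes the closure of the relation single-valued, and completeness makes it everywhere
    defined. *)
Lemma bounded_extension (R : realType) (E : normedModType R[i])
    (F : completeNormedModType R[i]) (Gm : set (E * F)) (M : R) : 0 <= M ->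
  Gm (0, 0) -> (forall c p q, Gm p -> Gm q -> Gm (c *: p + q)) ->
  (forall x y, Gm (x, y) -> nr y <= M * nr x) ->
  closure [set x | exists y, Gm (x, y)] = [set: E] ->
  exists T : E -> F, [/\ linear T, nbounded T M & forall x y, Gm (x, y) -> T x = y].
Proof.
move=> M0 G0 GD Gb Gd.
pose lim_graph x y := forall eps : R, 0 < eps ->
  exists a b, [/\ Gm (a, b), nr (x - a) < eps & nr (y - b) < eps].
have lgD c x y x' y' : lim_graph x y -> lim_graph x' y' ->
    lim_graph (c *: x + x') (c *: y + y').
  move=> h h' eps e0; have e20 : 0 < eps / 2 by rewrite divr_gt0.
  have c0 : 1 <= cab c + 1 by rewrite lerDr cab_ge0.
  have c0' := lt_le_trans ltr01 c0.
  have [a [b [Gab ha hb]]] := h _ (divr_gt0 e20 c0').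
  have [a' [b' [Gab' ha' hb']]] := h' _ e20.
  have aux (W : normedModType R[i]) (u v u' v' : W) : nr (u - v) < eps / 2 / (cab c + 1) ->
      nr (u' - v') < eps / 2 -> nr (c *: u + u' - (c *: v + v')) < eps.
    move=> k k'; rewrite opprD addrACA -scalerBr; apply: le_lt_trans (nrD _ _) _.
    rewrite [ltRHS]splitr ler_ltD// nrZ -/(cab c).
    move: k; rewrite ltr_pdivlMr// mulrC => /ltW; apply: le_trans.
    by rewrite ler_wpM2r ?nr_ge0// lerDl.
  by exists (c *: a + a'), (c *: b + b'); split; [exact: (GD c (a, b) (a', b'))|exact: aux|exact: aux].
have lgb x y : lim_graph x y -> nr y <= M * nr x.
  move=> h; apply/ler_addgt0Pr => eps e0.
  have m0 : 0 < M + 1 by rewrite ltr_wpDl.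
  have [a [b [Gab ha hb]]] := h _ (divr_gt0 e0 m0).
  have -> : y = (y - b) + b by rewrite subrK.
  apply: le_trans (nrD _ _) _.
  have h1 : nr a <= nr x + eps / (M + 1).
    have -> : a = (a - x) + x by rewrite subrK.
    by apply: le_trans (nrD _ _) _; rewrite addrC nrBC lerD2l ltW.
  have h2 := Gb _ _ Gab.
  have h3 : M * nr a <= M * (nr x + eps / (M + 1)) by rewrite ler_wpM2l.
  have h4 : (M + 1) * (eps / (M + 1)) = eps by rewrite mulrC divfK// gt_eqF.
  by move: (ltW hb) h2 h3; lra.
have lgu x y y' : lim_graph x y -> lim_graph x y' -> y = y'.
  move=> h h'; apply/eqP; rewrite -subr_eq0; apply/eqP/nr_eq0/eqP.
  rewrite eq_le nr_ge0 andbT.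
  have /lgb := lgD (-1) _ _ _ _ h' h.
  by rewrite !scaleN1r addNr nr0 mulr0 addrC.
have sub x y : Gm (x, y) -> lim_graph x y.
  by move=> Gxy eps e0; exists x, y; rewrite !subrr !nr0.
have ex x : exists y, lim_graph x y.
  have /choice[a /choice[b hab]] : forall n : nat, exists a b, Gm (a, b) /\ nr (x - a) < n.+1%:R^-1.
    move=> n; have : closure [set x | exists y, Gm (x, y)] x by rewrite Gd.
    move=> /closure_nrP /(_ n.+1%:R^-1); rewrite invr_gt0 ltr0n => /(_ isT) [a [b Gab] h].
    by exists a, b.
  have small eps : 0 < eps -> exists N : nat, forall n, (N <= n)%N -> n.+1%:R^-1 < eps :> R.
    move=> e0; exists (Num.truncn eps^-1) => n Nn.
    rewrite invf_plt ?posrE ?ltr0n//; apply: lt_le_trans (truncnS_gt _) _.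
    by rewrite ler_nat ltnS.
  have [|y yb] := @seq_complete R F b.
    move=> eps e0; have m0 : 0 < 2 * (M + 1) by rewrite mulr_gt0// ltr_wpDl.
    have [N hN] := small _ (divr_gt0 e0 m0); exists N => m n Nm Nn.
    have /Gb : Gm ((-1) *: (a n, b n) + (a m, b m)) by apply: GD; [exact: (hab n).1|exact: (hab m).1].
    rewrite /= -[(-1) *: b n]/(-1 *: b n) !scaleN1r => h.
    rewrite addrC; apply: le_lt_trans h _.
    have h1 : nr (- a n + a m) <= nr (x - a n) + nr (x - a m).
      by rewrite (_ : - a n + a m = x - a n - (x - a m)) ?nrB// opprB [RHS]addrC addrA subrK addrC.
    have h2 := lt_trans (hab n).2 (hN n Nn); have h3 := lt_trans (hab m).2 (hN m Nm).
    apply: (@le_lt_trans _ _ (M * (2 * (eps / (2 * (M + 1)))))).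
      by rewrite ler_wpM2l//; move: h1 h2 h3; lra.
    have -> : M * (2 * (eps / (2 * (M + 1)))) = M / (M + 1) * eps.
      by field; rewrite gt_eqF// ltr_wpDl.
    by rewrite -[ltRHS]mul1r ltr_pM2r// ltr_pdivrMr ?ltr_wpDl// mul1r ltrDl.
  exists y => eps e0; have [N hN] := small _ e0; have [N' hN'] := yb _ e0.
  exists (a (maxn N N')), (b (maxn N N')); split; first exact: (hab _).1.
    by apply: lt_trans (hab _).2 (hN _ (leq_maxl _ _)).
  by rewrite nrBC hN'// leq_maxr.
have [T hT] := choice ex; exists T; split.
- by move=> c x y; apply: lgu (hT _) _; exact: lgD.
- by move=> x; exact: lgb.
- by move=> x y /sub; exact: lgu.
Qed.

(** The index set is arbitrary: Bessel's inequality bounds the finite partial sums, and totality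
    gives one of them within eps of the square norm. *)
Lemma parseval (R : realType) (H : hilbertType R) (I : choiceType) (f : I -> H) x :
  osys f -> total_set (range f) ->
  ((nr x ^+ 2)%:E = \esum_(i in [set: I]) (cab (coef f x i) ^+ 2)%:E)%E.
Proof.
move=> fo tf; apply/eqP; rewrite eq_le; apply/andP; split; last first.
  apply: ge_ereal_sup => _ [X [finX _] <-].
  by rewrite fsbig_finite//= sumEFin lee_fin; apply: (bessel fo); exact: fset_uniq.
apply/lee_addgt0Pr => eps e0.
have se0 : 0 < Num.sqrt eps by rewrite sqrtr_gt0.
have [s us hs] := psum_approx fo x tf se0.
rewrite (bessel_eq fo x us) addrC EFinD leeD//.
  apply: esum_ge; exists [set` s]; first by split.
  by rewrite -fsbig_seq// sumEFin.
rewrite lee_fin -[leRHS]sqr_sqrtr ?(ltW e0)// lerXn2r ?nnegrE ?nr_ge0 ?sqrtr_ge0//.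
exact: ltW.
Qed.

Lemma countable_enum (T : choiceType) (x0 : T) (A : set T) : countable A ->
  exists s : nat -> T, A `<=` range s.
Proof.
move=> /countable_injP[f finj]; exists (fun n => xget x0 [set x | A x /\ f x = n]).
move=> x Ax; exists (f x) => //; case: xgetP => [y _ [Ay fy]|/(_ x)[]//].
by apply: finj; rewrite ?inE.
Qed.

(** Distinct orthonormal vectors are at distance sqrt 2, so points of a countable dense set within
    1/2 of them are distinct. *)
Lemma countable_orthonormal (R : realType) (H : hilbertType R) (B : set H) :
  separable_space H -> (forall b, B b -> inner b b = 1) ->
  (forall b c, B b -> B c -> b <> c -> inner b c = 0) -> countable B.
Proof.
move=> [S [cS /dense_closureP dS]] B1 B0.
have /choice[g hg] : forall b : H, exists s, S s /\ nr (b - s) < 2^-1.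
  move=> b; have : closure S b by rewrite dS.
  by move=> /closure_nrP/(_ 2^-1) []; rewrite ?invr_gt0// => s Ss h; exists s.
apply: (@sub_countable _ _ _ S) => //.
apply/pcard_leP/injfunPex; exists g; first by move=> b _; exact: (hg b).1.
move=> b c; rewrite !inE => Bb Bc gbc; apply: contrapT => bc.
have : nr (b - c) < 1.
  apply: le_lt_trans (nr_tri (g b) _ _) _.
  have := (hg b).2; have := (hg c).2; rewrite -gbc (nrBC c); lra.
apply/negP; rewrite -leNgt -(@ler_pXn2r _ 2)// ?nnegrE ?nr_ge0//.
rewrite expr1n -lecR -inner_nr innerBl !innerBr (B0 b c)// (B0 c b)//; last by move/esym.
rewrite !B1// sub0r subr0 opprK -[X in X <= _]/((1 : R)%:C%C) -rmorphD/= lecR; lra.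
Qed.

(** Finite lists of pairs of a Gaussian rational and an index form a countable type, and the
    combinations they encode approximate every element of the span. *)
Lemma separable_of_total (R : realType) (E : normedModType R[i]) (S : set E) :
  countable S -> closure (lin_span S) = [set: E] -> separable_space E.
Proof.
move=> cS tS; have [s Ss] := countable_enum 0 cS.
pose q (p : rat * rat) : R[i] := (ratr p.1 +i* ratr p.2)%C.
pose h (l : seq ((rat * rat) * nat)) : E := \sum_(p <- l) q p.1 *: s p.2.
exists (range h); split.
  exact: sub_countable (card_image_le _ _) (countableP _).
have rat_approx (a eps : R) : 0 < eps -> exists r : rat, `|a - ratr r| < eps.
  move=> e0; have [|r] := @rat_in_itvoo R (a - eps) (a + eps); first by lra.
  rewrite in_itv/= => /andP[h1 h2]; exists r.
  by rewrite ltr_norml; apply/andP; split; lra.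
have q_approx (c : R[i]) (eps : R) : 0 < eps -> exists p, cab (c - q p) < eps.
  case: c => a b e0; have e20 : 0 < eps / 2 by rewrite divr_gt0.
  have [r1 h1] := rat_approx a _ e20; have [r2 h2] := rat_approx b _ e20.
  exists (r1, r2); rewrite /q/=.
  have -> : ((a +i* b) - (ratr r1 +i* ratr r2))%C =
      (a - ratr r1)%:C%C + 'i%C * (b - ratr r2)%:C%C :> R[i] by simpc.
  apply: le_lt_trans (cabD _ _) _; rewrite cabM !cab_real.
  have -> : cab ('i%C : R[i]) = 1 by rewrite /cab normc_def/= expr0n expr1n add0r sqrtr1.
  lra.
apply/dense_closureP; rewrite -subTset => x _.
have hcat l l' : h (l ++ l') = h l + h l' by rewrite /h big_cat.
have span_in y : lin_span S y -> closure (range h) y.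
  move=> [n [c [t [St ->]]]]; apply/closure_nrP; elim/big_rec : _ => [eps e0|i {}y _ IH eps e0].
    by exists (h [::]); [exists [::]|rewrite /h big_nil subrr nr0].
  have e20 : 0 < eps / 2 by rewrite divr_gt0.
  have [_ [l _ <-] hl] := IH _ e20.
  have [m _ sm] := Ss _ (St i).
  have n0 : 0 < nr (t i) + 1 by rewrite ltr_wpDl ?nr_ge0.
  have [p hp] := q_approx (c i) _ (divr_gt0 e20 n0).
  exists (h ((p, m) :: l)); first by exists ((p, m) :: l).
  rewrite /h big_cons -/(h l) /= sm opprD addrACA -scalerBl.
  apply: le_lt_trans (nrD _ _) _; rewrite [ltRHS]splitr ler_ltD// nrZ -/(cab _).
  move: hp; rewrite ltr_pdivlMr// => /ltW; apply: le_trans.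
  by rewrite ler_wpM2l ?cab_ge0// lerDl.
have : closure (lin_span S) x by rewrite tS.
move=> /closure_nrP hx; apply/closure_nrP => eps e0.
have e20 : 0 < eps / 2 by rewrite divr_gt0.
have [y Sy xy] := hx _ e20; have /closure_nrP/(_ _ e20)[z zr yz] := span_in _ Sy.
exists z => //; apply: le_lt_trans (nr_tri y _ _) _; lra.
Qed.

Definition nr_cvg (R : realType) (E : normedModType R[i]) (u : nat -> E) (l : E) :=
  forall eps : R, 0 < eps -> exists N, forall n, (N <= n)%N -> nr (u n - l) < eps.

Lemma nr_cvg_inner0 (R : realType) (H : hilbertType R) (u : nat -> H) (l x : H) :
  nr_cvg u l -> (forall n, inner (u n) x = 0) -> inner l x = 0.
Proof.
move=> ul u0; apply: cab_eq0; apply/eqP; rewrite eq_le cab_ge0 andbT.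
apply/ler_addgt0Pr => eps e0; rewrite add0r.
have x0 : 0 < nr x + 1 by rewrite ltr_wpDl ?nr_ge0.
have [N /(_ N (leqnn N))] := ul _ (divr_gt0 e0 x0).
have -> : inner l x = - inner (u N - l) x by rewrite innerBl u0 sub0r opprK.
rewrite ltr_pdivlMr// cabN => /ltW h; apply: le_trans (cauchy_schwarz _ _) (le_trans _ h).
by rewrite ler_wpM2l ?nr_ge0// lerDl.
Qed.

(* A maximal orthonormal subset of [P] spans: the component of p in P orthogonal to it lies in P. *)
Lemma onb_of_cone (R : realType) (H : hilbertType R) (P : set H) :
  separable_space H ->
  (forall x, (forall p, P p -> inner x p = 0) -> x = 0) ->
  P 0 -> (forall (c : R[i]) p, P p -> P (c *: p)) ->
  (forall (e : nat -> H) p q, osys e -> (forall n, P (e n)) -> P p ->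
    nr_cvg (fun n => p - \sum_(i < n) coef e p i *: e i) q -> P q) ->
  exists e : nat -> H, [/\ osys e, complete_sys e & forall n, P (e n)].
Proof.
move=> sH sepP P0 PZ Pcl.
pose Q (B : set H) := (forall b, B b -> P b /\ inner b b = 1) /\
  (forall b c, B b -> B c -> b <> c -> inner b c = 0).
have [|B [[B1 B0] Bmax]] := @Zorn_bigcup H Q.
  move=> F FQ Ftot; split => [b [X FX Xb]|b c [X FX Xb] [Y FY Yc]].
    exact: (FQ _ FX).1.
  by case: (Ftot _ _ FX FY) => XY; [apply: (FQ _ FY).2 => //; exact: XY|
    apply: (FQ _ FX).2 => //; exact: XY].
have cB : countable B.
  by apply: countable_orthonormal => // b Bb; exact: (B1 b Bb).2.
have /countable_injP[f finj] := cB.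
(* Indices outside the range of the injection f get the zero vector, which [osys] allows. *)
pose e n := xget 0 [set x | B x /\ f x = n].
have eP n : (B (e n) /\ f (e n) = n) \/ e n = 0.
  by rewrite /e; case: xgetP => [y -> ?|_]; [left|right].
have Be b : B b -> e (f b) = b.
  move=> Bb; rewrite /e; case: xgetP => [y _ [By fy]|/(_ b)[]//].
  by apply: finj; rewrite ?inE.
have eo : osys e.
  split=> [i j ij|i]; last by case: (eP i) => [[Bi _]|]; [right; exact: (B1 _ Bi).2|left].
  case: (eP i) => [[Bi fi]|->]; last by rewrite inner0l.
  case: (eP j) => [[Bj fj]|->]; last by rewrite inner0r.
  by apply: B0 => // eij; move: ij; rewrite -fi -fj eij eqxx.
have ePP n : P (e n) by case: (eP n) => [[Bn _]|->//]; exact: (B1 _ Bn).1.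
exists e; split => // x xe; apply: sepP => p Pp.
have [|y [yc ys]] := @riesz_fischer R H e eo (coef e p) (nr p ^+ 2).
  move=> N; under eq_bigr do rewrite (nr_coef eo).
  rewrite (sum_ord_iota (fun i => cab (coef e p i) ^+ 2)).
  by apply: (bessel eo); exact: iota_uniq.
pose q := p - y.
have qc : nr_cvg (fun n => p - \sum_(i < n) coef e p i *: e i) q.
  move=> eps /ys[N hN]; exists N => n /hN.
  by rewrite /q opprB [X in _ -> is_true (nr X < _)]addrC addrA subrK nrBC.
have Pq : P q by apply: Pcl qc.
have qe n : inner q (e n) = 0 by rewrite innerBl yc (coef_idem eo) subrr.
have [q0|q0] := eqVneq q 0; last first.
  have nq : 0 < nr q by rewrite lt_neqAle nr_ge0 andbT eq_sym; apply: contra_neq q0 => /nr_eq0.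
  pose q' := ((nr q)^-1)%:C%C *: q.
  have q'1 : inner q' q' = 1.
    rewrite inner_nr nrZ -/(cab _) cab_real ger0_norm ?invr_ge0 ?nr_ge0//.
    by rewrite mulVf ?gt_eqF// expr1n.
  have q'B b : B b -> inner q' b = 0.
    by move=> Bb; rewrite innerZl -(Be b Bb) qe mulr0.
  exfalso; apply: (Bmax (B `|` [set q'])).
    split; first by move=> b Bb; left.
    move=> /(_ q' (or_intror erefl)) Bq; have := q'B _ Bq.
    by rewrite q'1 => /eqP; rewrite oner_eq0.
  split=> [b [Bb|->]|b c [Bb|->] [Bc|->]]; first exact: B1.
  - by split => //; exact: PZ.
  - exact: B0.
  - by move=> _; rewrite inner_conj q'B// conjc0.
  - by move=> _; exact: q'B.
  - by [].
have -> : p = y by apply/eqP; rewrite -subr_eq0; apply/eqP.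
rewrite inner_conj (nr_cvg_inner0 ys) ?conjc0// => n.
rewrite inner_suml big1// => i _; rewrite innerZl inner_conj xe conjc0 mulr0//.
Qed.

(** * Diagonal operators *)

Definition rlim (R : realType) (a : nat -> R) (l : R) :=
  forall eps : R, 0 < eps -> exists N, forall n, (N <= n)%N -> `|a n - l| < eps.

Section RealSeries.
Variable (R : realType).
Implicit Types (a b : nat -> R) (l : R).

Lemma rlimP a l : rlim a l <-> (a @ \oo --> (l : R)).
Proof.
split=> [h|/cvgrPdist_lt h eps e0].
  apply/cvgrPdist_lt => eps e0; have [N hN] := h _ e0.
  by exists N => // n /= /hN; rewrite distrC.
by have [N _ hN] := h _ e0; exists N => n /hN; rewrite distrC.
Qed.

Lemma rlim_unique a l l' : rlim a l -> rlim a l' -> l = l'.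
Proof. by move=> /rlimP h /rlimP h'; exact: (cvg_unique _ h h'). Qed.

Lemma rlim_ext a b l : (forall n, a n = b n) -> rlim a l -> rlim b l.
Proof. by move=> ab h eps /h[N hN]; exists N => n; rewrite -ab; exact: hN. Qed.

Lemma rlimB a b l l' : rlim a l -> rlim b l' -> rlim (fun n => a n - b n) (l - l').
Proof. by move=> /rlimP h /rlimP h'; apply/rlimP; exact: cvgB. Qed.

Lemma eseries_rlim a l : (forall n, 0 <= a n) ->
  (\sum_(0 <= i <oo) (a i)%:E = l%:E)%E <-> rlim (fun n => \sum_(i < n) a i) l.
Proof.
move=> a0; have cv := @is_cvg_nneseries R (fun i => (a i)%:E) predT 0%N
    (fun n _ _ => (a0 n : (0 <= (a n)%:E)%E)).
have aE n : (\sum_(0 <= i < n) (a i)%:E)%E = (\sum_(i < n) a i)%:E.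
  by rewrite sumEFin big_mkord.
split=> [h|/rlimP h].
  apply/rlimP; move: cv => /cvg_toP/(_ h)/fine_cvg; apply: cvg_trans; apply: near_eq_cvg.
  by exists 0%N => // n _ /=; rewrite aE.
apply/cvg_lim => //; apply: cvg_EFin.
  by exists 0%N => // n _; rewrite aE.
apply: cvg_trans h; apply: near_eq_cvg; exists 0%N => // n _ /=.
by rewrite aE.
Qed.

Lemma eseries_fin a (M : R) : (forall n, 0 <= a n) ->
  (forall n, \sum_(i < n) a i <= M) -> exists l, (\sum_(0 <= i <oo) (a i)%:E = l%:E)%E.
Proof.
move=> a0 aM; have : (\sum_(0 <= i <oo) (a i)%:E \is a fin_num)%E.
  rewrite ge0_fin_numE; last by apply: nneseries_ge0 => n _ _; rewrite lee_fin.
  apply: le_lt_trans (ltry M); apply: lime_le.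
    by apply: is_cvg_nneseries => n _ _; rewrite lee_fin.
  by apply: nearW => n; rewrite sumEFin lee_fin big_mkord.
by move=> /fineK <-; eexists.
Qed.

Lemma eseries_bound a : (forall n, 0 <= a n) ->
  (\sum_(0 <= i <oo) (a i)%:E < +oo)%E -> exists M, forall n, \sum_(i < n) a i <= M.
Proof.
move=> a0; rewrite -ge0_fin_numE; last by apply: nneseries_ge0 => n _ _; rewrite lee_fin.
move=> fs; exists (fine (\sum_(0 <= i <oo) (a i)%:E)%E) => n.
rewrite -lee_fin fineK// -(big_mkord predT) -sumEFin.
by apply: nneseries_lim_ge => k _ _; rewrite lee_fin.
Qed.

End RealSeries.

(* For an orthonormal basis e, the diagonal operator on its maximal domain. *)
Definition diag_rel (R : realType) (H : hilbertType R) (e : nat -> H) (lam : nat -> R) :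
  set (H * H) := [set p | forall n, inner p.2 (e n) = (lam n)%:C%C * inner p.1 (e n)].

Section Diagonal.
Variables (R : realType) (H : hilbertType R) (e : nat -> H).
Hypotheses (eo : osys e) (ce : complete_sys e).

Lemma inner_series (y x : H) (eps : R) : 0 < eps -> exists N, forall n, (N <= n)%N ->
  cab (\sum_(i < n) inner y (e i) * conjc (inner x (e i)) - inner y x) < eps.
Proof.
move=> e0; have y0 : 0 < nr y + 1 by rewrite ltr_wpDl ?nr_ge0.
have [N hN] := psum_cvg eo x ce (divr_gt0 e0 y0); exists N => n /hN.
have -> : \sum_(i < n) inner y (e i) * conjc (inner x (e i)) - inner y x =
    inner y (\sum_(i < n) coef e x i *: e i - x).
  rewrite innerBr inner_sumr; congr (_ - _); apply: eq_bigr => i _.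
  by rewrite innerZr mulrC.
rewrite ltr_pdivlMr// nrBC => h; apply: le_lt_trans (cauchy_schwarz _ _) (le_lt_trans _ h).
by rewrite mulrC ler_wpM2l ?nr_ge0// lerDl.
Qed.

Lemma inner_series_Re (y x : H) :
  rlim (fun n => \sum_(i < n) complex.Re (inner y (e i) * conjc (inner x (e i))))
    (complex.Re (inner y x)).
Proof.
move=> eps /(inner_series y x)[N hN]; exists N => n /hN; apply: le_lt_trans.
rewrite -[X in `|X|](_ : complex.Re (\sum_(i < n) inner y (e i) * conjc (inner x (e i)) - inner y x) = _).
  by rewrite /cab -lecR RRe_real ?ger0_real// normc_ge_Re.
have ReB (z w : R[i]) : complex.Re (z - w) = complex.Re z - complex.Re w by case: z w => [? ?] [? ?].
have ReD (z w : R[i]) : complex.Re (z + w) = complex.Re z + complex.Re w by case: z w => [? ?] [? ?].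
by rewrite ReB (big_morph (@complex.Re R) ReD (erefl _)).
Qed.

Definition wt (x : H) n : R := cab (coef e x n) ^+ 2.

Lemma wt_ge0 x n : 0 <= wt x n. Proof. exact: sqr_ge0. Qed.

Lemma Re_mul_real (a : R) (z : R[i]) : complex.Re (a%:C%C * z) = a * complex.Re z.
Proof. by case: z => u v /=; rewrite mul0r subr0. Qed.

Lemma diag_form_series (phi : nat -> R) x y :
  (forall n, inner y (e n) = (phi n)%:C%C * inner x (e n)) ->
  rlim (fun n => \sum_(i < n) phi i * wt x i) (complex.Re (inner y x)).
Proof.
move=> h; apply: rlim_ext (inner_series_Re y x) => n; apply: eq_bigr => i _.
by rewrite h -mulrA mul_conjc Re_mul_real.
Qed.

Lemma diag_nr_series (phi : nat -> R) x y :
  (forall n, inner y (e n) = (phi n)%:C%C * inner x (e n)) ->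
  rlim (fun n => \sum_(i < n) phi i ^+ 2 * wt x i) (nr y ^+ 2).
Proof.
move=> h; have := inner_series_Re y y; rewrite inner_nr.
apply: rlim_ext => n; apply: eq_bigr => i _.
by rewrite mul_conjc h cabM exprMn cab_real -normrX ger0_norm ?sqr_ge0.
Qed.

(** [riesz_fischer] provides the image of each x through its coefficients; linearity and the bound
    are then read off the coefficients. *)
Lemma diag_ex (phi : nat -> R) (M : R) : (forall n, `|phi n| <= M) ->
  exists T : H -> H, [/\ linear T, nbounded T M &
    forall x n, inner (T x) (e n) = (phi n)%:C%C * inner x (e n)].
Proof.
move=> bM; have M0 : 0 <= M := le_trans (normr_ge0 _) (bM 0%N).
have /choice[T hT] : forall x, exists y, forall n, inner y (e n) = (phi n)%:C%C * inner x (e n).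
  move=> x; have [|y [yc _]] := @riesz_fischer R H e eo (fun n => (phi n)%:C%C * coef e x n) (M ^+ 2 * nr x ^+ 2).
    move=> N; apply: (@le_trans _ _ (M ^+ 2 * \sum_(n < N) cab (coef e x n) ^+ 2)).
      rewrite mulr_sumr; apply: ler_sum => n _; rewrite cabM exprMn -mulrA (nr_coef eo).
      by rewrite ler_wpM2r ?sqr_ge0// cab_real lerXn2r ?nnegrE.
    rewrite ler_wpM2l ?sqr_ge0// (sum_ord_iota (fun i => cab (coef e x i) ^+ 2)).
    by apply: (bessel eo); exact: iota_uniq.
  by exists y => n; rewrite yc -mulrA (coef_idem eo).
exists T; split => //.
  move=> c x y; apply: (coef_inj ce) => n.
  by rewrite hT !innerDl !innerZl !hT; ring.
move=> x; rewrite -(@ler_pXn2r _ 2)// ?nnegrE ?mulr_ge0 ?nr_ge0// exprMn.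
rewrite leNgt; apply/negP => lt.
have lt' : 0 < nr (T x) ^+ 2 - M ^+ 2 * nr x ^+ 2 by rewrite subr_gt0.
have [N /(_ N (leqnn N))] := diag_nr_series (hT x) lt'.
have : \sum_(i < N) phi i ^+ 2 * wt x i <= M ^+ 2 * nr x ^+ 2.
  apply: (@le_trans _ _ (M ^+ 2 * \sum_(n < N) cab (coef e x n) ^+ 2)).
    rewrite mulr_sumr; apply: ler_sum => n _; rewrite ler_wpM2r ?sqr_ge0//.
    by rewrite -[phi n ^+ 2]ger0_norm ?sqr_ge0// normrX lerXn2r ?nnegrE.
  rewrite ler_wpM2l ?sqr_ge0// (sum_ord_iota (fun i => cab (coef e x i) ^+ 2)).
  by apply: (bessel eo); exact: iota_uniq.
by rewrite ltr_norml => h /andP[+ _]; move: h lt; lra.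
Qed.

Lemma inner_coef_ext (x y : H) (a : R[i]) :
  (forall eps : R, 0 < eps -> exists N, forall n, (N <= n)%N ->
    cab (\sum_(i < n) inner y (e i) * conjc (inner x (e i)) - a) < eps) -> inner y x = a.
Proof.
move=> h; apply/eqP; rewrite -subr_eq0; apply/eqP/cab_eq0/eqP.
rewrite eq_le cab_ge0 andbT; apply/ler_addgt0Pr => eps e0; rewrite add0r.
have e20 : 0 < eps / 2 by rewrite divr_gt0.
have [N hN] := h _ e20; have [N' hN'] := inner_series y x e20.
have h1 := hN _ (leq_maxl N N'); have h2 := hN' _ (leq_maxr N N').
set S := \sum_(i < _) _ in h1 h2.
have -> : inner y x - a = (S - a) - (S - inner y x) by ring.
by apply: le_trans (cabD _ _) _; rewrite cabN; move: h1 h2; lra.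
Qed.

Lemma diag_sym (phi : nat -> R) x y x' y' :
  (forall n, inner y (e n) = (phi n)%:C%C * inner x (e n)) ->
  (forall n, inner y' (e n) = (phi n)%:C%C * inner x' (e n)) ->
  inner y x' = inner x y'.
Proof.
move=> h h'; apply: inner_coef_ext => eps /(inner_series x y')[N hN].
exists N => n /hN; congr (_ < _); congr (cab (_ - _)); apply: eq_bigr => i _.
by rewrite h h' conjcM conjc_real; ring.
Qed.

Variable lam : nat -> R.
Local Notation D := (diag_rel e lam).

Lemma diag_rel_e n : D (e n, (lam n)%:C%C *: e n).
Proof.
move=> m /=; rewrite innerZl; have [->//|nm] := eqVneq n m.
by rewrite eo.1// !mulr0.
Qed.

Lemma diag_rel_psum x N : D (\sum_(i < N) coef e x i *: e i,
   \sum_(i < N) ((lam i)%:C%C * coef e x i) *: e i).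
Proof.
move=> n /=; rewrite !inner_suml mulr_sumr; apply: eq_bigr => i _.
rewrite !innerZl; have [->|nm] := eqVneq (val i) n; first by rewrite mulrA.
by rewrite eo.1// !mulr0.
Qed.

(** Testing an element of the adjoint on the vectors [e n] gives the coefficient condition; the
    converse is the symmetry of real diagonal forms. *)
Lemma diag_self_adjoint : self_adjoint D.
Proof.
split.
- split.
  + by move=> n /=; rewrite !inner0l mulr0.
  + move=> c [x y] [x' y'] h h' n /=; rewrite !innerDl !innerZl.
    by rewrite (h n) (h' n)/=; ring.
  + by move=> x y z h h'; apply: (coef_inj ce) => n; rewrite (h n) (h' n).
- apply/dense_closureP; rewrite -subTset => x _; apply/closure_nrP => eps e0.
  have [N hN] := psum_cvg eo x ce e0; exists (\sum_(i < N) coef e x i *: e i); last exact: hN.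
  by eexists; exact: diag_rel_psum.
- apply/seteqP; split => -[p1 p2] /=.
    move=> h n /=; have := h _ _ (diag_rel_e n); rewrite /= innerZl => /(congr1 conjc).
    by rewrite conjcM conjc_real -!inner_conj.
  by move=> h x y xy; apply: (diag_sym xy h).
Qed.

Definition diag_measure (x : H) : {measure set (measurableTypeR R) -> \bar R} :=
  mseries (fun n => mscale (NngNum (wt_ge0 x n)) (\d_(lam n : measurableTypeR R))) 0.

Lemma diag_integral x (f : R -> R) : measurable_fun setT f -> (forall t, 0 <= f t) ->
  (\int[diag_measure x]_t (f t)%:E = \sum_(0 <= n <oo) (f (lam n) * wt x n)%:E)%E.
Proof.
move=> mf f0; rewrite ge0_integral_measure_series//; last 2 first.
- by move=> t _; rewrite lee_fin.
- exact/measurable_EFinP.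
apply: eq_eseriesr => n _; rewrite ge0_integral_mscale//; last 2 first.
- exact/measurable_EFinP.
- by move=> t _; rewrite lee_fin.
rewrite integral_dirac//; last exact/measurable_EFinP.
by rewrite diracT mul1e/= EFinM muleC.
Qed.

Definition indR (B : set R) (t : R) : R := (t \in B)%:R.

Lemma indR_norm (B : set R) n : `|indR B (lam n)| <= 1.
Proof. by rewrite /indR; case: (_ \in _); rewrite ?normr1 ?normr0. Qed.

Lemma indR_sqr (B : set R) t : indR B t ^+ 2 = indR B t.
Proof. by rewrite /indR; case: (_ \in _); rewrite ?expr1n ?expr0n. Qed.

Definition diag_proj (B : set (measurableTypeR R)) : H -> H :=
  projT1 (cid (diag_ex (indR_norm B))).

Lemma diag_projP B : [/\ linear (diag_proj B), nbounded (diag_proj B) 1 &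
    forall x n, inner (diag_proj B x) (e n) = (indR B (lam n))%:C%C * inner x (e n)].
Proof. by rewrite /diag_proj; case: cid. Qed.

Lemma nbounded_operator (T : H -> H) (M : R) : linear T -> nbounded T M -> bounded_operator T.
Proof. by move=> lT bT; split=> //; exists M => x; rewrite !nrE -rmorphM/= lecR. Qed.

Lemma diag_bounded_self_adjoint (phi : nat -> R) (M : R) T : linear T -> nbounded T M ->
  (forall x n, inner (T x) (e n) = (phi n)%:C%C * inner x (e n)) -> self_adjoint_operator T.
Proof.
move=> lT bT hT; split; first exact: nbounded_operator bT.
by move=> x y; apply: (diag_sym (hT x) (hT y)).
Qed.

Lemma self_adjoint_real T (x : H) : (forall x y, inner (T x) y = inner x (T y)) ->
  inner (T x) x = (complex.Re (inner (T x) x))%:C%C.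
Proof.
move=> sT; have := inner_conj (T x) x; rewrite -sT; case: (inner _ _) => a b /= [] h.
congr (_ +i* _)%C; lra.
Qed.

(** For the given D a resolution is part of the hypotheses; for D~ it has to be produced, and a
    diagonal operator has this explicit one with pure point measures. *)
Lemma diag_spectral_resolution : spectral_resolution D diag_proj diag_measure.
Proof.
split.
- move=> B mB; have [l b h] := diag_projP B; split.
    exact: diag_bounded_self_adjoint b h.
  move=> x; apply: (coef_inj ce) => n; rewrite !h mulrA -rmorphM/= -expr2.
  by rewrite indR_sqr.
- move=> x; have [l b h] := diag_projP setT; apply: (coef_inj ce) => n; rewrite h /indR.
  by rewrite in_setT mul1r.
- move=> B B' mB mB' x; have [_ _ h] := diag_projP B; have [_ _ h'] := diag_projP B'.
  have [_ _ h''] := diag_projP (B `&` B'); apply: (coef_inj ce) => n.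
  by rewrite h h' h'' mulrA -rmorphM/= /indR in_setI -natrM mulnb.
- move=> x B mB; have [_ _ h] := diag_projP B.
  have w0 n : 0 <= indR B (lam n) * wt x n by rewrite mulr_ge0 ?wt_ge0 ?ler0n.
  rewrite -((eseries_rlim _ w0).2 (diag_form_series (h x))).
  by apply: eq_eseriesr => n _; rewrite /= /mscale/= diracE muleC -EFinM.
- move=> x.
  have w0 n : 0 <= lam n ^+ 2 * wt x n by rewrite mulr_ge0 ?wt_ge0 ?sqr_ge0.
  rewrite diag_integral//; last by move=> t; exact: sqr_ge0.
    split=> [[y xy]|/(eseries_bound w0)[M hM]].
      by rewrite ((eseries_rlim _ w0).2 (diag_nr_series xy)) ltry.
    have [|y [yc _]] := @riesz_fischer R H e eo (fun n => (lam n)%:C%C * coef e x n) M.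
      move=> N; apply: le_trans (hM N); apply: ler_sum => n _.
      by rewrite cabM exprMn -mulrA (nr_coef eo) cab_real -normrX ger0_norm ?sqr_ge0.
    by exists y => n; rewrite /= yc -mulrA (coef_idem eo).
- move=> x y xy; have sy := diag_sym xy xy.
  have -> : inner y x = (complex.Re (inner y x))%:C%C.
    have := inner_conj x y; rewrite sy; case: (inner _ _) => a b /= [] h.
    congr (_ +i* _)%C; lra.
  congr (_%:C%C); apply: (rlim_unique (diag_form_series xy)).
  rewrite /Rintegral integralE.
  (* The positive and negative parts of t are treated together, as max(s t, 0) with s = 1 or -1.
     Each is dominated by 1 + t^2, which is integrable because x lies in the domain. *)
  have sgn (s : R) : s = 1 \/ s = -1 ->
     exists l, (\int[diag_measure x]_t (Num.max (s * t) 0)%:E = l%:E)%E /\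
       rlim (fun n => \sum_(i < n) Num.max (s * lam i) 0 * wt x i) l.
    move=> s1; have w0 n : 0 <= Num.max (s * lam n) 0 * wt x n.
      by rewrite mulr_ge0 ?wt_ge0// le_max lexx orbT.
    have w1 n : 0 <= lam n ^+ 2 * wt x n by rewrite mulr_ge0 ?wt_ge0 ?sqr_ge0.
    have w2 n : 0 <= 1 ^+ 2 * wt x n by rewrite mulr_ge0 ?wt_ge0 ?sqr_ge0.
    have [|M1 hM1] := eseries_bound w1.
      by rewrite ((eseries_rlim _ w1).2 (diag_nr_series xy)) ltry.
    have xx n : inner x (e n) = (1 : R)%:C%C * inner x (e n) by rewrite mul1r.
    have [|M2 hM2] := eseries_bound w2.
      by rewrite ((eseries_rlim _ w2).2 (diag_nr_series xx)) ltry.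
    have [|l hl] := @eseries_fin _ (fun n => Num.max (s * lam n) 0 * wt x n) (M1 + M2) w0.
      move=> n; apply: le_trans (lerD (hM1 n) (hM2 n)); rewrite -big_split/=.
      apply: ler_sum => i _; rewrite -mulrDl ler_wpM2r ?wt_ge0// ge_max.
      by case: s1 => ->; apply/andP; split; nra.
    exists l; split; last exact/(eseries_rlim _ w0).
    rewrite diag_integral//; last by move=> t; rewrite le_max lexx orbT.
    by apply: measurable_maxr => //; exact: measurable_funM.
  have [l1 [i1 r1]] := sgn 1 (or_introl erefl).
  have [l2 [i2 r2]] := sgn (-1) (or_intror erefl).
  have -> : (\int[diag_measure x]_t ((fun t => t%:E)^\+ t) = l1%:E)%E.
    by rewrite -i1; apply: eq_integral => t _; rewrite funeposE mul1r EFin_max.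
  have -> : (\int[diag_measure x]_t ((fun t => t%:E)^\- t) = l2%:E)%E.
    by rewrite -i2; apply: eq_integral => t _; rewrite funenegE mulN1r EFin_max EFinN.
  rewrite -EFinB/=; apply: rlim_ext (rlimB r1 r2) => n; rewrite -sumrB.
  apply: eq_bigr => i _; rewrite -mulrBl; congr (_ * _).
  rewrite mul1r mulN1r; case: (leP (lam i) 0) => h; case: (leP (- lam i) 0) => h'; lra.
Qed.

Lemma diag_functional_calculus (f : R -> R) T : measurable_fun setT f ->
  (forall t, 0 <= f t <= 1) -> linear T -> nbounded T 1 ->
  (forall x n, inner (T x) (e n) = (f (lam n))%:C%C * inner x (e n)) ->
  is_functional_calculus D f T.
Proof.
move=> mf f01 lT bT hT; split; first exact: nbounded_operator bT.
exists diag_proj, diag_measure; split; first exact: diag_spectral_resolution.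
have f0 t : 0 <= f t by case/andP: (f01 t).
move=> x; have [_ sT] := diag_bounded_self_adjoint lT bT hT.
have w0 n : 0 <= f (lam n) * wt x n by rewrite mulr_ge0 ?wt_ge0.
rewrite self_adjoint_real//; congr (_%:C%C); rewrite /Rintegral diag_integral//.
by rewrite ((eseries_rlim _ w0).2 (diag_form_series (hT x))).
Qed.

End Diagonal.

(** * Compact resolvents *)

(** The first equation gives a + b = 0, the second a = b. In the applications a and b are the two
    cross terms of a polarized quadratic form, taken with the phases 1 and i. *)
Lemma polarization0 (R : realType) (a b : R[i]) :
  a + b = - (a + b) -> - 'i%C * a + 'i%C * b = - (- 'i%C * a + 'i%C * b) -> a = 0.
Proof.
case: a b => [a1 a2] [b1 b2] [h1 h2] /= []; rewrite !mul0r => h3 h4.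
by apply/eqP; rewrite eq_complex /=; apply/andP; split; apply/eqP; lra.
Qed.

Lemma conjc_i (R : realType) : conjc ('i%C : R[i]) = - 'i%C.
Proof. by apply/eqP; rewrite eq_complex /= oppr0 !eqxx. Qed.

Lemma cab_i (R : realType) : cab ('i%C : R[i]) = 1.
Proof. by rewrite /cab normc_def/= expr0n expr1n add0r sqrtr1. Qed.

Lemma cab1 (R : realType) : cab (1 : R[i]) = 1.
Proof. by rewrite (cab_real 1) normr1. Qed.

Lemma self_adjoint_sym (R : realType) (H : hilbertType R) (D : set (H * H)) x y x' y' :
  self_adjoint D -> D (x, y) -> D (x', y') -> inner y x' = inner x y'.
Proof. by move=> [_ _ aD] xy; rewrite -{1}aD => /(_ _ _ xy). Qed.

Lemma dense_orth0 (R : realType) (H : hilbertType R) (S : set H) z :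
  dense S -> (forall w, S w -> inner z w = 0) -> z = 0.
Proof.
move=> /dense_closureP dS h; apply: small_eq0 => eps e0.
have /closure_nrP/(_ _ e0)[w Sw zw] : closure S z by rewrite dS.
have : nr z ^+ 2 <= nr z * eps.
  have : cab (inner z (z - w)) <= nr z * eps.
    by apply: le_trans (cauchy_schwarz _ _) _; rewrite ler_wpM2l ?nr_ge0// ltW.
  have -> : inner z (z - w) = (nr z ^+ 2)%:C%C by rewrite innerBr (h _ Sw) subr0 inner_nr.
  by rewrite cab_real ger0_norm ?sqr_ge0.
have [->|z0] := eqVneq (nr z) 0; first by move=> _; exact: ltW.
by rewrite expr2 ler_pM2l// lt_neqAle eq_sym z0 nr_ge0.
Qed.

(** * Consequences of an arbitrary spectral resolution *)

Section Resolution.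
Variables (R : realType) (H : hilbertType R) (D : set (H * H)).
Variables (E : set (measurableTypeR R) -> H -> H).
Variables (mu : H -> {measure set (measurableTypeR R) -> \bar R}).
Hypotheses (SA : self_adjoint D) (SR : spectral_resolution D E mu).

Lemma res_lin B : measurable B -> linear (E B).
Proof. by move=> mB; have [[[]]] := spectral_projection SR mB. Qed.

Lemma res_sym B x y : measurable B -> inner (E B x) y = inner x (E B y).
Proof. by move=> mB; have [[_ h] _] := spectral_projection SR mB; exact: h. Qed.

Lemma res_idem B x : measurable B -> E B (E B x) = E B x.
Proof. by move=> mB; have [_] := spectral_projection SR mB; apply. Qed.

Lemma res_comm B C x : measurable B -> measurable C -> E B (E C x) = E C (E B x).
Proof. by move=> mB mC; rewrite -!(spectral_setI SR)// setIC. Qed.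

Lemma res_form B x : measurable B -> inner (E B x) x = (nr (E B x) ^+ 2)%:C%C.
Proof. by move=> mB; rewrite -inner_nr [RHS]res_sym// res_idem// res_sym. Qed.

Lemma res_mu B x : measurable B -> mu x B = (nr (E B x) ^+ 2)%:E.
Proof. by move=> mB; rewrite (spectral_measureE SR)// res_form. Qed.

Lemma res_muT x : mu x setT = (nr x ^+ 2)%:E.
Proof. by rewrite res_mu// (spectral_setT SR). Qed.

Lemma res_fin x B : measurable B -> (mu x B < +oo)%E.
Proof. by move=> mB; rewrite res_mu// ltry. Qed.

Lemma res_set0 x : E set0 x = 0.
Proof.
have := res_mu x measurable0; rewrite measure0 => -[] /esym/eqP.
by rewrite sqrf_eq0 => /eqP/nr_eq0.
Qed.

Lemma res_disjoint B C x : measurable B -> measurable C -> B `&` C = set0 ->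
  E B (E C x) = 0.
Proof. by move=> mB mC BC; rewrite -(spectral_setI SR)// BC res_set0. Qed.

Lemma res_mono B C x : measurable B -> measurable C -> B `<=` C ->
  E C (E B x) = E B x.
Proof. by move=> mB mC BC; rewrite -(spectral_setI SR)// setIidr. Qed.

(** E(C) keeps x and w orthogonal, so the measure of [x + c *: w] depends on c through |c| only;
    this is what makes polarization work. *)
Lemma res_mu_split B x w (c : R[i]) C : measurable B -> measurable C ->
  E B x = x -> E B w = 0 ->
  mu (x + c *: w) C = (nr (E C x) ^+ 2 + cab c ^+ 2 * nr (E C w) ^+ 2)%:E.
Proof.
move=> mB mC Bx Bw; have lC := res_lin mC.
rewrite res_mu// (linear_add _ _ lC) (linear_scale _ _ lC) pythagoras; first by rewrite nrZ exprMn.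
by rewrite innerZr -Bx res_comm// res_sym// res_comm// Bw (linear_0 lC) inner0r mulr0.
Qed.

(** The measure of x + c w does not change when c becomes -c, so neither does the quadratic form;
    the cross terms therefore vanish for c = 1 and c = i. [Gm] stands for the graph of D or of a
    function of D. *)
Lemma form_orth (Gm : set (H * H)) (g : R -> R) B x y w v : measurable B ->
  (forall c p q, Gm p -> Gm q -> Gm (c *: p + q)) ->
  (forall x y, Gm (x, y) -> inner y x = ((\int[mu x]_t g t)%R)%:C%C) ->
  Gm (x, y) -> Gm (w, v) -> E B x = x -> E B w = 0 -> inner y w = 0.
Proof.
move=> mB GD Gq xy wv Bx Bw.
have key c : cab c = 1 ->
    conjc c * inner y w + c * inner v x = - (conjc c * inner y w + c * inner v x).
  move=> c1.
  have Gc d : Gm (x + d *: w, y + d *: v) by rewrite addrC [_ + d *: v]addrC; exact: (GD d (w, v) (x, y)).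
  have e1 : inner (y + c *: v) (x + c *: w) = inner (y + (- c) *: v) (x + (- c) *: w).
    rewrite (Gq _ _ (Gc c)) (Gq _ _ (Gc (- c))); congr (_%:C%C); congr fine.
    apply: eq_measure_integral => A mA _.
    by rewrite !(@res_mu_split B)// cabN.
  move: e1; rewrite !(innerDl, innerDr, innerZl, innerZr) rmorphN/= => e1.
  apply/eqP; rewrite -subr_eq0 opprK; apply/eqP.
  by move/eqP: e1; rewrite -subr_eq0 => /eqP e1; rewrite -[RHS]e1; ring.
have k1 := key 1 (cab1 R); rewrite conjc1 !mul1r in k1.
have ki := key 'i%C (cab_i R); rewrite conjc_i in ki.
exact: polarization0 k1 ki.
Qed.

(** On the range of E({t}) the measure of x is the point mass ||x||^2 at t. *)
Lemma form_atom (g : R -> R) t x : measurable_fun setT g -> E [set t] x = x ->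
  (\int[mu x]_s g s)%R = g t * nr x ^+ 2.
Proof.
move=> mg tx; rewrite /Rintegral.
have mt : measurable ([set t] : set (measurableTypeR R)) by exact: measurable_set1.
have cE A : measurable A -> A `<=` [set: measurableTypeR R] ->
    mu x A = mscale (NngNum (sqr_ge0 (nr x))) (\d_(t : measurableTypeR R)) A.
  move=> mA _; rewrite /mscale/= res_mu// diracE -tx -(spectral_setI SR)//.
  case: (boolP (t \in A)) => tA.
    rewrite setIidr; first by rewrite mule1 tx.
    by move=> _ ->; exact: set_mem.
  rewrite (_ : A `&` [set t] = set0); first by rewrite res_set0 nr0 expr0n mule0.
  by apply/seteqP; split => // s [sA st]; move: tA; rewrite -st notin_setE.
rewrite (eq_measure_integral _ cE).
have mgE (h : R -> R) : measurable_fun setT h ->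
  measurable_fun [set: measurableTypeR R] (fun s => (h s)%:E) by move=> /measurable_EFinP.
have mp : measurable_fun [set: measurableTypeR R] (fun s => (g s)%:E)^\+%E.
  by apply/measurable_funepos; exact: mgE.
have mn : measurable_fun [set: measurableTypeR R] (fun s => (g s)%:E)^\-%E.
  by apply/measurable_funeneg; exact: mgE.
rewrite integralE !ge0_integral_mscale// !integral_dirac//.
rewrite !diracT !mul1e funeposE funenegE -EFinN -!EFin_max -!EFinM -EFinB/=.
rewrite -mulrBr mulrC; congr (_ * _); case: (leP (g t) 0) => h; case: (leP (- g t) 0) => h'; lra.
Qed.

(** The sums x + c w stay in the range of E({t}), where the quadratic form is g(t) ||.||^2;
    polarization gives the sesquilinear form. *)
Lemma form_diag (Gm : set (H * H)) (g : R -> R) t x y w v :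
  measurable_fun setT g ->
  (forall c p q, Gm p -> Gm q -> Gm (c *: p + q)) ->
  (forall x y, Gm (x, y) -> inner y x = ((\int[mu x]_t g t)%R)%:C%C) ->
  Gm (x, y) -> Gm (w, v) -> E [set t] x = x -> E [set t] w = w ->
  inner y w = (g t)%:C%C * inner x w.
Proof.
move=> mg GD Gq xy wv tx tw.
have mt : measurable ([set t] : set (measurableTypeR R)) by exact: measurable_set1.
have q z u : Gm (z, u) -> E [set t] z = z -> inner u z = (g t)%:C%C * inner z z.
  by move=> zu tz; rewrite (Gq _ _ zu) (form_atom mg tz) rmorphM/= inner_nr.
have key c : conjc c * (inner y w - (g t)%:C%C * inner x w) +
    c * (inner v x - (g t)%:C%C * inner w x) = 0.
  have Gc : Gm (x + c *: w, y + c *: v) by rewrite addrC [_ + c *: v]addrC; exact: (GD c (w, v) (x, y)).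
  have lt := res_lin mt; have := q _ _ Gc; rewrite (linear_add _ _ lt) (linear_scale _ _ lt).
  rewrite tx tw => /(_ erefl); rewrite !(innerDl, innerDr, innerZl, innerZr).
  rewrite (q _ _ xy tx) (q _ _ wv tw) => /eqP; rewrite -subr_eq0 => /eqP h.
  by rewrite -[RHS]h; ring.
apply/eqP; rewrite -subr_eq0; apply/eqP; apply: (@polarization0 R _ (inner v x - (g t)%:C%C * inner w x)).
  by have := key 1; rewrite conjc1 !mul1r => ->; rewrite oppr0.
by have := key 'i%C; rewrite conjc_i => ->; rewrite oppr0.
Qed.

Lemma D_lin c p q : D p -> D q -> D (c *: p + q).
Proof. by case: SA => [[_ h _] _ _]; exact: h. Qed.

Lemma D_fun x y z : D (x, y) -> D (x, z) -> y = z.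
Proof. by case: SA => [[_ _ h] _ _]; exact: h. Qed.

(** The measure of x is the sum of those of E(B) x and x - E(B) x, so E(B) can only decrease the
    second moment. *)
Lemma res_dom B x : measurable B -> Dom D x -> Dom D (E B x).
Proof.
move=> mB /(spectral_dom SR) hx; apply/(spectral_dom SR); apply: le_lt_trans hx.
have Bx2 : E B (x - E B x) = 0 by rewrite linear_sub ?res_idem ?subrr//; exact: res_lin.
have cE A : measurable A -> A `<=` [set: measurableTypeR R] ->
    mu x A = measure_add (mu (E B x)) (mu (x - E B x)) A.
  move=> mA _; have := @res_mu_split B (E B x) (x - E B x) 1 A mB mA (res_idem _ mB) Bx2.
  by rewrite scale1r addrC subrK => ->; rewrite measure_addE !res_mu// cab1 expr1n mul1r.
have mf : measurable_fun [set: measurableTypeR R] (fun t => (t ^+ 2)%:E).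
  by apply/measurable_EFinP; exact: measurable_funX.
rewrite [leRHS](eq_measure_integral _ cE) ge0_integral_measure_add//; last first.
  by move=> t _; rewrite lee_fin sqr_ge0.
by rewrite leeDl// integral_ge0// => t _; rewrite lee_fin sqr_ge0.
Qed.

(** Let y1 be the value of D at E(B) x. By [form_orth], y1 is orthogonal to w - E(B) w for every w
    in the domain, and E(B) (y - y1) is orthogonal to the domain; density gives y1 = E(B) y1 = E(B)
    y. *)
Lemma res_commutes B x y : measurable B -> D (x, y) -> D (E B x, E B y).
Proof.
move=> mB xy; have [y1 xy1] := res_dom mB (ex_intro _ _ xy).
have sub u v u1 v1 : D (u, v) -> D (u1, v1) -> D (u - u1, v - v1).
  move=> h h1; rewrite -scaleN1r addrC -(scaleN1r v1) [v + _]addrC.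
  exact: (D_lin (-1) (p := (u1, v1)) (q := (u, v))).
have ker u : E B (u - E B u) = 0 by rewrite linear_sub ?res_idem ?subrr//; exact: res_lin.
have orth u v w z : D (u, v) -> D (w, z) -> E B u = u -> E B w = 0 -> inner v w = 0.
  by move=> uv wz; apply: (form_orth mB D_lin (spectral_integral SR) uv wz).
have dD : dense (Dom D) by case: SA.
have h1 : y1 = E B y1.
  apply/eqP; rewrite -subr_eq0; apply/eqP/(dense_orth0 dD) => w [v wv].
  have [v1 wv1] := res_dom mB (ex_intro _ _ wv).
  rewrite innerBl res_sym// -innerBr.
  exact: orth xy1 (sub _ _ _ _ wv wv1) (res_idem _ mB) (ker _).
have h2 : E B (y - y1) = 0.
  apply: (dense_orth0 dD) => w [v wv].
  have [v1 wv1] := res_dom mB (ex_intro _ _ wv).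
  have xs := sub _ _ _ _ xy xy1.
  rewrite res_sym// (self_adjoint_sym SA xs wv1) inner_conj.
  by rewrite (orth _ _ _ _ wv1 xs (res_idem _ mB) (ker _)) conjc0.
move: h2; rewrite linear_sub; last exact: res_lin.
by rewrite -h1 => /eqP; rewrite subr_eq0 => /eqP ->.
Qed.

(** x lies in the domain since its measure lives on {t}. The defect z = y - t x stays in the range
    of E({t}), where [form_diag] gives <y, z> = t <x, z>, that is <z, z> = 0. *)
Lemma res_atom t x : E [set t] x = x -> D (x, t%:C%C *: x).
Proof.
move=> tx; have mt : measurable ([set t] : set (measurableTypeR R)) by exact: measurable_set1.
have dom u : E [set t] u = u -> Dom D u.
  move=> tu; apply/(spectral_dom SR).
  have mf : measurable_fun [set: measurableTypeR R] (fun t => (t ^+ 2)%:E).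
    by apply/measurable_EFinP; exact: measurable_funX.
  rewrite (ge0_negligible_integral (N := ~` [set t]))//; last 3 first.
  - exact: measurableC.
  - by move=> s _; rewrite lee_fin sqr_ge0.
  - by rewrite (res_mu _ (measurableC mt)) -tu (res_disjoint _ (measurableC mt) mt) ?setICl// nr0 expr0n.
  rewrite setDE setTI setCK (eq_integral (cst ((t ^+ 2)%:E))).
    by rewrite integral_cst// lte_mul_pinfty ?res_fin// ?lee_fin ?sqr_ge0.
  by move=> s; rewrite inE => ->.
have [y xy] := dom _ tx; suff <- : y = t%:C%C *: x by [].
have ty : E [set t] y = y.
  by have := res_commutes mt xy; rewrite tx => h; exact: D_fun h xy.
apply/eqP; rewrite -subr_eq0; apply/eqP/inner_eq0; set z := y - _.
have lt := res_lin mt.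
have tz : E [set t] z = z by rewrite (linear_sub _ _ lt) (linear_scale _ _ lt) tx ty.
have [v zv] := dom _ tz.
have := form_diag (@measurable_id _ _ setT) D_lin (spectral_integral SR) xy zv tx tz.
by rewrite {1}/z innerBl innerZl => ->; rewrite subrr.
Qed.

Lemma res_integrable x : Dom D x -> (mu x).-integrable setT (fun t => t%:E).
Proof.
move=> /(spectral_dom SR) hx; apply/integrableP; split; first exact/measurable_EFinP.
have mf : measurable_fun [set: measurableTypeR R] (fun t => (t ^+ 2)%:E).
  by apply/measurable_EFinP; exact: measurable_funX.
apply: (@le_lt_trans _ _ (\int[mu x]_t (1 + (t ^+ 2)%:E))%E).
  apply: ge0_le_integral => //.
  - by apply: measurableT_comp => //; exact/measurable_EFinP.
  - exact: emeasurable_funD.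
  - move=> t _; rewrite -EFinD lee_fin; case: (ler0P t) => h; nra.
rewrite ge0_integralD//; last by move=> t _; rewrite lee_fin sqr_ge0.
by rewrite integral_cst// mul1e res_muT lte_add_pinfty// ltry.
Qed.

(** For x1 = E(B) x the integral of s (t - la) over B vanishes by the eigenvalue equation, while the
    integrand is positive; so B is null for the measure of x1, which has all its mass there. *)
Lemma res_eigen_half (la s : R) (B : set (measurableTypeR R)) x : measurable B ->
  (forall t : R, B t -> 0 < s * (t - la)) -> D (x, la%:C%C *: x) -> E B x = 0.
Proof.
move=> mB sB xD; pose x1 := E B x.
have x1D : D (x1, la%:C%C *: x1).
  by have := res_commutes mB xD; rewrite linear_scale//; exact: res_lin.
have Bx1 : E B x1 = x1 by exact: res_idem.
have ix : (mu x1).-integrable setT (fun t => t%:E) by apply: res_integrable; eexists; exact: x1D.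
have cB : mu x1 (~` B) = 0.
  by rewrite /x1 (res_mu _ (measurableC mB)) (res_disjoint _ (measurableC mB) mB) ?setICl// nr0 expr0n.
have ixB : (mu x1).-integrable B (fun t => t%:E) by exact: integrableS ix.
have muB : mu x1 B = (nr x1 ^+ 2)%:E by rewrite res_mu// Bx1.
have iT : (\int[mu x1]_(t in B) t%:E = (la * nr x1 ^+ 2)%:E)%E.
  have := spectral_integral SR x1D; rewrite innerZl inner_nr -rmorphM => /complexI ->.
  rewrite fineK; last exact: integrable_fin_num.
  rewrite (negligible_integral (N := ~` B) _ _ ix cB)//; last exact: measurableC.
  by rewrite setDE setTI setCK.
have icst : (mu x1).-integrable B (cst la%:E).
  apply/integrableP; split; first exact: measurable_cst.
  by rewrite integral_cst// muB -EFinM ltry.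
have i0 : (\int[mu x1]_(t in B) (s%:E * (t%:E - la%:E)) = 0)%E.
  rewrite integralZl//; last exact: (integrableB _ ixB icst).
  have ic : (\int[mu x1]_(t in B) (cst la%:E) t = (la * nr x1 ^+ 2)%:E)%E.
    by rewrite integral_cst// muB.
  by rewrite (integralB _ ixB icst)// iT ic -EFinB subrr mule0.
have : (\int[mu x1]_(t in B) `|(s * (t - la))%:E| = 0)%E.
  rewrite -[RHS]i0; apply: eq_integral => t; rewrite inE => /sB h.
  by rewrite gee0_abs ?lee_fin ?ltW// EFinM EFinB.
move/ae_eq_integral_abs => /(_ mB) []; first by apply/measurable_EFinP/measurable_funM => //; exact: measurable_funB.
move=> N [mN muN NB]; apply: nr_eq0; apply/eqP; rewrite -sqrf_eq0; apply/eqP.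
suff : mu x1 B = 0 by rewrite muB => -[].
apply/eqP; rewrite -measure_le0 -muN le_measure ?inE// => t Bt; apply: NB => /=.
move=> /(_ Bt) -[] /eqP; apply/negP.
by rewrite gt_eqF// sB.
Qed.

(** Converse of [res_atom]: the two open half-lines carry no mass by [res_eigen_half], with s = 1
    and s = -1. *)
Lemma res_eigen la x : D (x, la%:C%C *: x) -> E [set la] x = x.
Proof.
move=> xD; have mt : measurable ([set la] : set (measurableTypeR R)) by exact: measurable_set1.
have m1 : measurable (`]la, +oo[%classic : set (measurableTypeR R)) by exact: measurable_itv.
have m2 : measurable (`]-oo, la[%classic : set (measurableTypeR R)) by exact: measurable_itv.
have h1 : E `]la, +oo[%classic x = 0.
  apply: (res_eigen_half (s := 1) m1 _ xD) => t /=.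
  by rewrite in_itv/= andbT mul1r subr_gt0.
have h2 : E `]-oo, la[%classic x = 0.
  apply: (res_eigen_half (s := -1) m2 _ xD) => t /=.
  by rewrite in_itv/= mulN1r oppr_gt0 subr_lt0.
have Tset : [set: measurableTypeR R] = [set la] `|` (`]la, +oo[%classic `|` `]-oo, la[%classic).
  apply/seteqP; split => // t _; rewrite /= !in_itv/= andbT.
  by case: (ltgtP t la) => [|| ->]; [right; right|right; left|left].
have e1 : nr x ^+ 2 <= nr (E [set la] x) ^+ 2.
  have hU : (mu x setT <= mu x [set la] + (mu x `]la, +oo[%classic + mu x `]-oo, la[%classic))%E.
    rewrite Tset; apply: le_trans (measureU2 _ _ _) _ => //; first exact: measurableU.
    by apply: leeD => //; exact: measureU2.
  by move: hU; rewrite res_muT !res_mu// h1 h2 nr0 expr0n !adde0 lee_fin.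
have e2 : nr x ^+ 2 = nr (E [set la] x) ^+ 2 + nr (x - E [set la] x) ^+ 2.
  rewrite -pythagoras; first by rewrite addrC subrK.
  by rewrite innerBr res_sym// -[inner (E _ _) (E _ _)]res_sym// res_idem// res_sym// subrr.
have : nr (x - E [set la] x) ^+ 2 <= 0 by lra.
move=> h; have /eqP : nr (x - E [set la] x) ^+ 2 = 0.
  by apply/eqP; rewrite eq_le h sqr_ge0.
by rewrite sqrf_eq0 => /eqP/nr_eq0/eqP; rewrite subr_eq0 => /eqP.
Qed.

(** Whatever resolution defines f(D), its value on eigenvectors is forced: paired with w, the part
    of w outside the range of E({la}) is killed by [form_orth], the rest is given by [form_diag]. *)
Lemma res_calculus (f : R -> R) (T : H -> H) la x : measurable_fun setT f -> linear T ->
  (forall x, inner (T x) x = ((\int[mu x]_t f t)%R)%:C%C) ->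
  D (x, la%:C%C *: x) -> T x = (f la)%:C%C *: x.
Proof.
move=> mf lT qT /res_eigen lx; apply: inner_ext => w; rewrite innerZl.
have mt : measurable ([set la] : set (measurableTypeR R)) by exact: measurable_set1.
pose Gm := [set p : H * H | p.2 = T p.1].
have GD c p q : Gm p -> Gm q -> Gm (c *: p + q).
  by move: p q => [p1 p2] [q1 q2]; rewrite /Gm /= => -> ->; rewrite lT.
have Gq u v : Gm (u, v) -> inner v u = ((\int[mu u]_t f t)%R)%:C%C by rewrite /Gm /= => ->.
have wE : w = E [set la] w + (w - E [set la] w) by rewrite addrC subrK.
have kw : E [set la] (w - E [set la] w) = 0.
  by rewrite linear_sub ?res_idem ?subrr//; exact: res_lin.
have G u : Gm (u, T u) by [].
rewrite {1}wE innerDr (form_orth mt GD Gq (G x) (G _) lx kw) addr0.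
rewrite (form_diag mf GD Gq (G x) (G _) lx (res_idem _ mt)).
by rewrite -res_sym// lx.
Qed.

End Resolution.

(** The tails of the image sequence along P generate a filter; two of its members near a cluster
    point would be less than c apart. *)
Lemma compact_separated (R : realType) (H : hilbertType R) (T : H -> H) (v : nat -> H)
    (P : set nat) (c : R) : compact_operator T -> 0 < c ->
  (forall n0, exists2 n, (n0 <= n)%N & P n) ->
  (forall n, P n -> nr (v n) <= 1) ->
  (forall n m, P n -> P m -> n <> m -> c <= nr (T (v n) - T (v m))) -> False.
Proof.
move=> [lT cT] c0 Pinf v1 vc.
pose F := [set A : set H | exists n0, forall n, (n0 <= n)%N -> P n -> A (T (v n))].
have FF : ProperFilter F.
  apply: Build_ProperFilter.
    by move=> [n0 h]; have [n n0n Pn] := Pinf n0; exact: (h n).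
  split; first by exists 0%N.
    move=> A B [n h] [m h']; exists (maxn n m) => k.
    by rewrite geq_max => /andP[nk mk] Pk; split; [exact: h|exact: h'].
  by move=> A B AB [n h]; exists n => k nk Pk; apply/AB/h.
have [|p [_ clp]] := cT F FF.
  exists 0%N => n _ Pn; apply: subset_closure; exists (v n) => //=.
  by rewrite nrE (lecR _ 1) v1.
have c20 : 0 < c / 2 by rewrite divr_gt0.
have fr n0 : exists n, [/\ (n0 <= n)%N, P n & nr (p - T (v n)) < c / 2].
  have Fn : F [set y | exists n, [/\ (n0 <= n)%N, P n & y = T (v n)]].
    by exists n0 => n n0n Pn; exists n.
  have Bp : nbhs p (ball p (c / 2)%:C%C) by apply: nbhsx_ballx; rewrite (ltcR 0).
  have [_ [[n [n0n Pn ->]] Bn]] := clp _ _ Fn Bp.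
  by exists n; split => //; move: Bn; rewrite -ball_normE /= nrE ltcR.
have [n [_ Pn hn]] := fr 0%N; have [m [nm Pm hm]] := fr n.+1.
have nm' : n <> m by move=> e; move: nm; rewrite e ltnn.
have := vc _ _ Pn Pm nm'; apply/negP; rewrite -ltNge.
apply: le_lt_trans (nr_tri p _ _) _.
by rewrite nrBC; move: hn hm; lra.
Qed.

Section ResolventPower.
Variable R : realType.
Implicit Types (t x y : R).

Lemma resolvent_power_gt0 t x : 0 < resolvent_power t x.
Proof. by rewrite powR_gt0// ltr_pwDl// sqr_ge0. Qed.

Lemma resolvent_power_le1 t x : 0 <= t -> resolvent_power t x <= 1.
Proof.
move=> t0; rewrite /resolvent_power powRN invf_le1 ?powR_gt0 ?ltr_pwDl ?sqr_ge0//.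
have p1 : 1 `^ (t / 2) = 1 :> R by rewrite powR1.
rewrite -[leLHS]p1 ge0_ler_powR ?nnegrE ?divr_ge0 ?addr_ge0 ?sqr_ge0//.
by rewrite lerDl sqr_ge0.
Qed.

Lemma resolvent_power_mono t x y : 0 <= t -> x ^+ 2 <= y ^+ 2 ->
  resolvent_power t y <= resolvent_power t x.
Proof.
move=> t0 xy; rewrite /resolvent_power !powRN lef_pV2 ?posrE ?powR_gt0 ?ltr_pwDl ?sqr_ge0//.
by rewrite ge0_ler_powR ?nnegrE ?divr_ge0 ?addr_ge0 ?sqr_ge0// lerD2l.
Qed.

Lemma measurable_resolvent_power t : measurable_fun setT (resolvent_power t).
Proof.
apply: (measurableT_comp (measurable_powR (- (t / 2)))).
by apply: measurable_funD => //; exact: measurable_funX.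
Qed.

End ResolventPower.

(** An adjoint is closed, and D is its own adjoint. *)
Lemma nr_cvg_closed (R : realType) (H : hilbertType R) (D : set (H * H)) (u v : nat -> H) x y :
  self_adjoint D -> (forall n, D (u n, v n)) -> nr_cvg u x -> nr_cvg v y -> D (x, y).
Proof.
move=> SA uv ux vy; have [_ _ aD] := SA; rewrite -aD => a b ab /=.
apply/eqP; rewrite -subr_eq0; apply/eqP/cab_eq0/eqP.
rewrite eq_le cab_ge0 andbT; apply/ler_addgt0Pr => eps e0; rewrite add0r.
have d0 : 0 < nr a + nr b + 1 by rewrite ltr_wpDl ?addr_ge0 ?nr_ge0.
have [N hN] := ux _ (divr_gt0 e0 d0); have [N' hN'] := vy _ (divr_gt0 e0 d0).
set n := maxn N N'; have := hN n (leq_maxl _ _); have := hN' n (leq_maxr _ _).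
have -> : inner b x - inner a y = inner a (v n - y) - inner b (u n - x).
  have := self_adjoint_sym SA ab (uv n); rewrite !innerBr => ->; ring.
move=> h1 h2; apply: le_trans (cabD _ _) _; rewrite cabN.
have h3 : cab (inner a (v n - y)) <= nr a * (eps / (nr a + nr b + 1)).
  by apply: le_trans (cauchy_schwarz _ _) _; rewrite ler_wpM2l ?nr_ge0// ltW.
have h4 : cab (inner b (u n - x)) <= nr b * (eps / (nr a + nr b + 1)).
  by apply: le_trans (cauchy_schwarz _ _) _; rewrite ler_wpM2l ?nr_ge0// ltW.
apply: le_trans (lerD h3 h4) _; rewrite -mulrDl mulrCA ler_piMr ?ltW//.
by rewrite ltr_pdivrMr// mul1r ltrDl.
Qed.

(** * Eigenbases of closed symmetric operators *)

Section ClosedSymmetric.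
Variables (R : realType) (H : hilbertType R) (D : set (H * H)).
Hypotheses (D0 : D (0, 0)) (Dlin : forall c p q, D p -> D q -> D (c *: p + q)).
Hypothesis Dsym : forall x y x' y', D (x, y) -> D (x', y') -> inner y x' = inner x y'.
Hypothesis Dcl : forall (u v : nat -> H) x y, (forall n, D (u n, v n)) ->
  nr_cvg u x -> nr_cvg v y -> D (x, y).

Lemma eigen_orth x y (s t : R) : D (x, s%:C%C *: x) -> D (y, t%:C%C *: y) -> s <> t ->
  inner x y = 0.
Proof.
move=> Dx Dy st; have := Dsym Dx Dy.
rewrite innerZl innerZr conjc_real => /eqP; rewrite -subr_eq0 -mulrBl mulf_eq0.
rewrite -rmorphB/= => /orP[/eqP h|/eqP//]; exfalso; apply: st.
by apply/eqP; rewrite -subr_eq0; apply/eqP; apply: complexI.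
Qed.

(** Symmetry against [e n] puts D inside the diagonal operator; conversely the partial sums of the
    expansion lie in D, which is closed. *)
Lemma diag_rel_of_eigen (e : nat -> H) (lam : nat -> R) : osys e -> complete_sys e ->
  (forall n, D (e n, (lam n)%:C%C *: e n)) -> D = diag_rel e lam.
Proof.
move=> eo ce De; apply/seteqP; split => [[x y] xy n /=|[x y] xy].
  by rewrite (Dsym xy (De n)) innerZr conjc_real.
apply: (@Dcl (fun n => \sum_(i < n) coef e x i *: e i)
    (fun n => \sum_(i < n) coef e y i *: e i)).
- move=> n; elim: n => [|n IH].
    by rewrite !big_ord0.
  rewrite !big_ord_recr/= addrC [_ + coef e y n *: _]addrC.
  have -> : coef e y n *: e n = coef e x n *: ((lam n)%:C%C *: e n).
    by rewrite scalerA /coef (xy n)/= mulrC.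
  exact: (Dlin (coef e x n) (De n) IH).
- by move=> eps /(psum_cvg eo x ce)[N h]; exists N => n /h; rewrite nrBC.
- by move=> eps /(psum_cvg eo y ce)[N h]; exists N => n /h; rewrite nrBC.
Qed.

Hypothesis sH : separable_space H.

(** The eigenvectors form a cone and not a subspace. It is still stable under removing components
    along other eigenvectors: those with another eigenvalue are orthogonal, so that nothing is
    removed along them. *)
Lemma eigenbasis_of (Q : forall x, (forall p (t : R), D (p, t%:C%C *: p) -> inner x p = 0) -> x = 0) :
  exists (e : nat -> H) (lam : nat -> R), [/\ osys e, complete_sys e & D = diag_rel e lam].
Proof.
pose P := [set p | exists t : R, D (p, t%:C%C *: p)].
have [||||e [eo ce Pe]] := @onb_of_cone R H P sH.
- by move=> x h; apply: Q => p t pt; apply: h; exists t.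
- by exists 0; rewrite scaler0.
- move=> c p [t pt]; exists t; rewrite scalerA mulrC -scalerA.
    by have := Dlin c pt D0; rewrite /= addr0.
- move=> e p q eo Pe [t pt] cq; exists t.
  apply: (Dcl (v := fun n => t%:C%C *: (p - \sum_(i < n) coef e p i *: e i)) _ cq).
    move=> n; elim: n => [|n IH]; first by rewrite big_ord0 subr0.
    rewrite big_ord_recr/= opprD addrA; set s := p - _ in IH *.
    have [c0|c0] := eqVneq (coef e p n) 0; first by rewrite c0 scale0r subr0.
    have [r er] := Pe n.
    have rt : r = t.
      by apply: contrapT => /(eigen_orth er pt) h; move/eqP: c0; apply; rewrite /coef inner_conj h conjc0.
    rewrite rt in er; have := Dlin (- coef e p n) er IH.
    rewrite -[_ *: _ + _]/(- coef e p n *: e n + s, - coef e p n *: (t%:C%C *: e n) + t%:C%C *: s).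
    by rewrite scaleNr addrC scalerA mulrC -scalerA -scalerDr scaleNr addrC.
  move=> eps e0; have t0 : 0 < `|t| + 1 by rewrite ltr_wpDl.
  have [N hN] := cq _ (divr_gt0 e0 t0); exists N => n /hN.
  rewrite -scalerBr nrZc cab_real ltr_pdivlMr// mulrC; apply: le_lt_trans.
  by rewrite ler_wpM2r ?nr_ge0// lerDl.
- have /choice[lam hl] := Pe; exists e, lam; split => //.
  exact: diag_rel_of_eigen.
Qed.

End ClosedSymmetric.

(** * From a compact resolvent to an eigenbasis *)

Section CompactResolvent.
Variables (R : realType) (H : hilbertType R) (D : set (H * H)).
Variables (E : set (measurableTypeR R) -> H -> H).
Variables (mu : H -> {measure set (measurableTypeR R) -> \bar R}).
Variable T : H -> H.
Hypotheses (SA : self_adjoint D) (SR : spectral_resolution D E mu).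
Hypothesis (cT : compact_operator T).
Hypothesis (qT : forall x, inner (T x) x = ((\int[mu x]_t resolvent_power 1 t)%R)%:C%C).

Let K (N : R) : set (measurableTypeR R) := `[- N, N]%classic.

Let mK N : measurable (K N). Proof. exact: measurable_itv. Qed.

(** On [-N, N] the function (1 + t^2)^(-1/2) is at least its value at N, which bounds <T z, z>
    below; Cauchy-Schwarz turns this into a bound on T z. *)
Lemma resolvent_below N z : 0 <= N -> E (K N) z = z ->
  resolvent_power 1 N * nr z <= nr (T z).
Proof.
move=> N0 Kz; have mf : measurable_fun [set: measurableTypeR R] (fun t => (resolvent_power 1 t)%:E).
  by apply/measurable_EFinP; exact: measurable_resolvent_power.
have f0 (t : R) : (0 <= (resolvent_power 1 t)%:E)%E by rewrite lee_fin ltW ?resolvent_power_gt0.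
have ub : (\int[mu z]_t (resolvent_power 1 t)%:E < +oo)%E.
  apply: (@le_lt_trans _ _ (\int[mu z]_t (cst 1%:E t))%E); last by rewrite integral_cst// mul1e (res_muT SR) ltry.
  by apply: ge0_le_integral => // t _; rewrite lee_fin resolvent_power_le1.
have lb : ((resolvent_power 1 N * nr z ^+ 2)%:E <= \int[mu z]_t (resolvent_power 1 t)%:E)%E.
  apply: (@le_trans _ _ (\int[mu z]_(t in K N) (resolvent_power 1 t)%:E)%E); last first.
    by apply: ge0_subset_integral.
  apply: (@le_trans _ _ (\int[mu z]_(t in K N) (cst (resolvent_power 1 N)%:E t))%E).
    by rewrite integral_cst// (res_mu SR)// Kz.
  apply: ge0_le_integral => //.
  - by move=> t _; exact: f0.
  - exact: measurable_funTS.
  - move=> t; rewrite /K /= in_itv/= => /andP[h1 h2]; rewrite lee_fin resolvent_power_mono//.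
    nra.
have [->|z0] := eqVneq (nr z) 0; first by rewrite mulr0 nr_ge0.
have zp : 0 < nr z by rewrite lt_neqAle eq_sym z0 nr_ge0.
rewrite -(ler_pM2r zp) -mulrA -expr2.
apply: le_trans (cauchy_schwarz _ _); rewrite qT cab_real.
apply: le_trans (ler_norm _); rewrite -lee_fin fineK// ge0_fin_numE// integral_ge0//.
Qed.

Lemma res_bigcup_null x (F : nat -> set (measurableTypeR R)) (B : set (measurableTypeR R)) :
  (forall n, measurable (F n)) ->
  measurable B -> B `<=` \bigcup_n F n -> (forall n, E (F n) x = 0) -> E B x = 0.
Proof.
move=> mF mB BF F0.
have nz : (mu x).-negligible (\bigcup_n F n).
  apply: negligible_bigcup => n; exists (F n); split => //.
  by rewrite (res_mu SR)// F0 nr0 expr0n.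
have [N [mN N0 FN]] := nz.
apply: nr_eq0; apply/eqP; rewrite -sqrf_eq0; apply/eqP.
suff : mu x B = 0 by rewrite (res_mu SR)// => -[].
apply/eqP; rewrite -measure_le0 -N0 le_measure ?inE//.
exact: subset_trans FN.
Qed.

(* If no point carries mass, the mass of x accumulates at the infimum p of its support inside
   [-N, N]; the disjoint slices of ]p, p + 1] give infinitely many orthogonal vectors. *)
Lemma res_atom_exists x : (forall t : R, E [set t] x = 0) -> x = 0.
Proof.
move=> at0; apply: contrapT => /eqP x0.
have [N [N0 EN0]] : exists N : R, 0 <= N /\ E (K N) x <> 0.
  apply: contrapT => h; move/eqP: x0; apply.
  rewrite -(spectral_setT SR x); apply: (res_bigcup_null (F := fun n => K n%:R)) => //.
    move=> t _; exists (Num.truncn `|t|).+1 => //=; rewrite /K /= in_itv/=.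
    by rewrite -ler_norml ltW// truncnS_gt.
  by move=> n; apply: contrapT => h'; apply: h; exists n%:R.
pose I s : set (measurableTypeR R) := K N `&` `]-oo, s]%classic.
have mI s : measurable (I s) by apply: measurableI => //; exact: measurable_itv.
have mA1 (s : R) : measurable ([set s] : set (measurableTypeR R)) by exact: measurable_set1.
pose S := [set s : R | E (I s) x <> 0].
have EI s s' : s <= s' -> S s -> S s'.
  move=> ss' Ss Ss'0; apply: Ss.
  apply: (res_bigcup_null (F := fun=> I s')) => // t [Kt]; rewrite /= in_itv/= => ts.
  by exists 0%N => //; split => //=; rewrite in_itv/= (le_trans ts).
have SN : S N.
  move=> h; apply: EN0; apply: (res_bigcup_null (F := fun=> I N)) => // t Kt.
  by exists 0%N => //; split => //; move: Kt; rewrite /K /= !in_itv/= => /andP[].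
have Slb : lbound S (- N).
  move=> s Ss; rewrite leNgt; apply/negP => sN; apply: Ss.
  rewrite (_ : I s = set0) ?(res_set0 SR)//; apply/seteqP; split => // t [].
  rewrite /K /= !in_itv/= => /andP[h _] h'.
  by have := le_lt_trans (le_trans h h') sN; rewrite ltxx.
have Sinf : has_inf S by split; [exists N|exists (- N)].
pose p := inf S.
have below s : s < p -> E (I s) x = 0.
  move=> sp; apply: contrapT => h; have : p <= s by apply: ge_inf => //; exact: Sinf.2.
  by rewrite leNgt sp.
have above s : p < s -> S s.
  move=> ps; have sp : 0 < s - p by rewrite subr_gt0.
  have [s' Ss' s's] := inf_adherent sp Sinf.
  by apply: EI Ss'; rewrite ltW//; move: s's; rewrite /p; lra.
have inv_small eps : 0 < eps -> exists n : nat, n.+1%:R^-1 < eps :> R.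
  move=> e0; exists (Num.truncn eps^-1); rewrite invf_plt ?posrE ?ltr0n//.
  exact: truncnS_gt.
have Ip : E (I p) x = 0.
  apply: (res_bigcup_null (F := fun n => I (p - n.+1%:R^-1) `|` [set p])) => //.
  - by move=> n; exact: measurableU.
  - move=> t [Kt]; rewrite /= in_itv/= le_eqVlt => /orP[/eqP ->|tp]; first by exists 0%N => //; right.
    have tp' : 0 < p - t by rewrite subr_gt0.
    have [n hn] := inv_small _ tp'.
    by exists n => //; left; split => //=; rewrite in_itv/= lerBrDr addrC -lerBrDr ltW.
  - move=> n; apply: (res_bigcup_null (F := fun k => if k is 0%N then I (p - n.+1%:R^-1) else [set p])).
    + by case.
    + exact: measurableU.
    + by move=> t [h|h]; [exists 0%N|exists 1%N].
    + by case=> [|k]; [apply: below; rewrite ltrBlDr ltrDl invr_gt0|exact: at0].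
pose A n : set (measurableTypeR R) := K N `&` `]p + n.+2%:R^-1, p + n.+1%:R^-1]%classic.
have mA n : measurable (A n) by apply: measurableI => //; exact: measurable_itv.
pose u n := E (A n) x.
pose P := [set n | u n <> 0].
(* Otherwise the slices from n0 on are null; together with [I p] they cover the part of [-N, N] up
   to p + 1 / (n0 + 1), contradicting the choice of p. *)
have Pinf n0 : exists2 n, (n0 <= n)%N & P n.
  apply: contrapT => h; apply: (above (p + n0.+1%:R^-1)); first by rewrite ltrDl invr_gt0.
  (* The indices below n0 are padded with the empty set, n0 carries [I p], and an index k above n0
     carries the slice k - 1. *)
  apply: (res_bigcup_null (F := fun k => if (k < n0)%N then set0 else if k == n0 then I p else A k.-1)) => //.
  - by move=> k; case: ifP => // _; case: ifP.
  - move=> t [Kt]; rewrite /= in_itv/= => tn.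
    have [tp|tp] := leP t p.
      by exists n0 => //=; rewrite ltnn eqxx; split => //=; rewrite in_itv.
    have tp' : 0 < t - p by rewrite subr_gt0.
    have [n hn] := inv_small _ tp'.
    have ex : exists n : nat, p + n.+2%:R^-1 < t.
      exists n; move: hn; rewrite ltrBrDl; apply: le_lt_trans.
      by rewrite lerD2l lef_pV2 ?posrE ?ltr0n// ler_nat.
    (* The least m with p + 1 / (m + 2) < t is the index of the slice containing t. *)
    case: (ex_minnP ex) => m hm mmin.
    have tm : t <= p + m.+1%:R^-1.
      case: m hm mmin => [|m] hm mmin.
        by apply: le_trans tn _; rewrite lerD2l lef_pV2 ?posrE ?ltr0n// ler_nat.
      by rewrite leNgt; apply/negP => /mmin; rewrite ltnn.
    have n0m : (n0 <= m)%N.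
      have : m.+2%:R^-1 < n0.+1%:R^-1 :> R.
        by have := lt_le_trans hm tn; rewrite ltrD2l.
      by rewrite ltf_pV2 ?posrE ?ltr0n// ltr_nat.
    exists m.+1 => //=; rewrite ltnNge (leqW n0m)/= gtn_eqF//.
    by split => //=; rewrite in_itv/= hm tm.
  - move=> k; case: ifP => // kn0; first exact: (res_set0 SR).
    case: ifP => // kn0'; apply: contrapT => uk; apply: h; exists k.-1 => //.
    by rewrite -ltnS (leq_trans _ (leqSpred k))// ltn_neqAle eq_sym kn0' leqNgt kn0.
pose v n := ((nr (u n))^-1)%:C%C *: u n.
have nu n : P n -> 0 < nr (u n).
  by move=> Pn; rewrite lt_neqAle nr_ge0 andbT eq_sym; apply/eqP => /nr_eq0.
have nv n : P n -> nr (v n) = 1.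
  move=> /nu un; rewrite nrZc cab_real ger0_norm ?invr_ge0 ?nr_ge0//.
  by rewrite mulVf// gt_eqF.
have lE B : measurable B -> linear (E B) by exact: (res_lin SR).
have uK n : E (K N) (u n) = u n by apply: (res_mono SR) => // t [].
have Adisj n m : (n < m)%N -> A n `&` A m = set0.
  move=> nm; apply/seteqP; split => // t [[_ +] [_]]; rewrite /= !in_itv/= => /andP[h _] /andP[_ h'].
  have : (m.+1%:R^-1 : R) <= n.+2%:R^-1 by rewrite lef_pV2 ?posrE ?ltr0n// ler_nat.
  by have := lt_le_trans h h'; rewrite ltrD2l ltNge => /negP.
have uorth n m : n <> m -> inner (u n) (u m) = 0.
  move=> nm; rewrite (res_sym SR)// (res_disjoint SR) ?inner0r//.
  by case: (ltngtP n m) => [/Adisj|/Adisj|//]; rewrite // setIC.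
have c0 := resolvent_power_gt0 1 N.
apply: (compact_separated cT c0 Pinf (v := v)) => [n /nv ->//|n m Pn Pm nm].
have Kv : E (K N) (v n - v m) = v n - v m.
  by rewrite (linear_sub _ _ (lE _ (mK N))) !(linear_scale _ _ (lE _ (mK N))) !uK.
have lT : linear T by case: cT.
rewrite -(linear_sub _ _ lT); apply: le_trans (resolvent_below N0 Kv).
rewrite ler_peMr ?(ltW c0)// -(@ler_pXn2r _ 2)// ?nnegrE ?nr_ge0// pythagoras.
  by rewrite nrN !nv// expr1n; lra.
by rewrite innerNr innerZl innerZr uorth// !mulr0 oppr0.
Qed.

Hypothesis sH : separable_space H.

(** A vector orthogonal to all eigenvectors has E({t}) x = 0 for every t, hence is 0 by
    [res_atom_exists]. Infinitely many eigenvectors with lam^2 <= N would be orthonormal with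
    separated images under T. *)
Lemma compact_eigenbasis : exists (e : nat -> H) (lam : nat -> R),
  [/\ osys e, complete_sys e, D = diag_rel e lam &
      forall N : R, finite_set [set n | e n <> 0 /\ lam n ^+ 2 <= N]].
Proof.
have D0 : D (0, 0) by case: SA => [[]].
have [|e [lam [eo ce De]]] := eigenbasis_of D0 (D_lin SA) (fun x y x' y' => @self_adjoint_sym _ _ _ x y x' y' SA)
    (fun u v x y => @nr_cvg_closed _ _ _ u v x y SA) sH.
  move=> x h; apply: res_atom_exists => t.
  have mt : measurable ([set t] : set (measurableTypeR R)) by exact: measurable_set1.
  have := h _ _ (res_atom SA SR (res_idem SR x mt)).
  rewrite -(res_sym SR)// => h'; apply: inner_eq0.
  by rewrite (res_sym SR)// (res_idem SR)// -(res_sym SR).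
exists e, lam; split => // N; apply: contrapT => inf.
have Den n : D (e n, (lam n)%:C%C *: e n) by rewrite De; exact: diag_rel_e.
have lT : linear T by case: cT.
have Te n : T (e n) = (resolvent_power 1 (lam n))%:C%C *: e n.
  exact: (res_calculus SA SR (@measurable_resolvent_power R 1) lT qT (Den n)).
pose P := [set n | e n <> 0 /\ lam n ^+ 2 <= N].
have en n : P n -> inner (e n) (e n) = 1 by move=> [h _]; case: (eo.2 n).
have nen n : P n -> nr (e n) = 1.
  move=> /en; rewrite inner_nr => /complexI/eqP; rewrite sqrf_eq1 => /orP[/eqP//|/eqP h].
  by have := nr_ge0 (e n); rewrite h; lra.
have c0 := resolvent_power_gt0 1 (Num.sqrt `|N|).
apply: (compact_separated cT c0 (P := P) (v := e)).
- move=> n0; apply: contrapT => h; apply: inf; apply: (@sub_finite_set _ _ `I_n0) => //.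
  by move=> n Pn /=; rewrite ltnNge; apply/negP => n0n; apply: h; exists n.
- by move=> n /nen ->.
- move=> n m Pn Pm /eqP nm.
  have lb k : P k -> resolvent_power 1 (Num.sqrt `|N|) <= resolvent_power 1 (lam k).
    by move=> [_ h]; apply: resolvent_power_mono => //; rewrite sqr_sqrtr// (le_trans h)// ler_norm.
  rewrite -(@ler_pXn2r _ 2)// ?nnegrE ?nr_ge0 ?(ltW c0)// !Te pythagoras.
    rewrite nrN !nrZc !cab_real !nen// !mulr1.
    rewrite !(ger0_norm (ltW (resolvent_power_gt0 _ _))).
    have := lb _ Pn; have := lb _ Pm; move: (resolvent_power_gt0 1 (lam m)) c0.
    by nra.
  by rewrite innerNr innerZl innerZr eo.1// !mulr0 oppr0.
Qed.

End CompactResolvent.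

(** * The zeta function and operators with diagonal square *)

Lemma esum_swap (R : realType) (I J : choiceType) (a : I -> J -> \bar R) :
  (forall i j, (0 <= a i j)%E) ->
  (\esum_(i in [set: I]) \esum_(j in [set: J]) a i j =
   \esum_(j in [set: J]) \esum_(i in [set: I]) a i j)%E.
Proof.
move=> a0; rewrite !esum_esum//.
apply: (@reindex_esum R _ _ _ _ (fun p : J * I => (p.2, p.1)) (fun k => a k.1 k.2)).
split => //.
- by move=> [x1 x2] [y1 y2] _ _ [-> ->].
- by move=> [i j] _; exists (j, i).
Qed.

Lemma esumZl (R : realType) (I : choiceType) (S : set I) (a : I -> \bar R) (k : R) :
  0 <= k -> (forall i, (0 <= a i)%E) ->
  (\esum_(i in S) (k%:E * a i) = k%:E * \esum_(i in S) a i)%E.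
Proof.
move=> k0 a0; rewrite /esum -ereal_supZl//; last first.
  by apply/set0P; exists 0%E, set0; [exact: fsets_set0|rewrite fsbig_set0].
congr ereal_sup; apply/seteqP; split => x /=.
  move=> [X [finX XS] <-]; exists (\sum_(i \in X) a i)%E; first by exists X.
  by rewrite ge0_mule_fsumr.
move=> [_ [X [finX XS] <-] <-]; exists X => //.
by rewrite ge0_mule_fsumr.
Qed.

Section Trace.
Variables (R : realType) (H : hilbertType R) (e : nat -> H) (T : H -> H) (phi : nat -> R).
Hypotheses (eo : osys e) (ce : complete_sys e) (phi0 : forall n, 0 <= phi n).
Hypothesis dT : forall x n, inner (T x) (e n) = (phi n)%:C%C * inner x (e n).

Lemma form_esum x : ((complex.Re (inner (T x) x))%:E =
  \esum_(n in [set: nat]) (phi n * wt e x n)%:E)%E.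
Proof.
have w0 n : 0 <= phi n * wt e x n by rewrite mulr_ge0 ?wt_ge0.
rewrite -nneseries_esumT; last by move=> n; rewrite lee_fin.
by rewrite ((eseries_rlim _ w0).2 (diag_form_series eo ce (dT x))).
Qed.

(** Each f_i is expanded in the basis e, the two non-negative sums are exchanged, and Parseval is
    applied to e_n in the family f. As the value does not depend on f, [trace] can be computed
    although its basis is an unknown choice. *)
Lemma trace_family (I : choiceType) (f : I -> H) : osys f -> total_set (range f) ->
  (\esum_(i in [set: I]) (complex.Re (inner (T (f i)) (f i)))%:E =
   \esum_(n in [set: nat]) (phi n * nr (e n) ^+ 2)%:E)%E.
Proof.
move=> fo tf; under eq_esum do rewrite form_esum.
have w0 n x : 0 <= phi n * wt e x n by rewrite mulr_ge0 ?wt_ge0.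
rewrite esum_swap; last by move=> i n; rewrite lee_fin.
apply: eq_esum => n _; rewrite EFinM (parseval (e n) fo tf) -esumZl//; last first.
  by move=> i; rewrite lee_fin sqr_ge0.
apply: eq_esum => i _; rewrite -EFinM /wt /coef; congr (_ * _)%:E.
by rewrite inner_conj cab_conj.
Qed.

Lemma basis_exists : orthonormal_basis [set x | exists2 n, x = e n & e n <> 0].
Proof.
split.
- by move=> x [n -> en]; case: (eo.2 n).
- move=> x y [n -> en] [m -> em] nm; apply: eo.1.
  by apply: contra_not_neq nm => ->.
- apply: (total_trans (complete_total eo ce)) => _ [n _ <-].
  have [->|en] := eqVneq (e n) 0; first exact/subset_closure/lin_span0.
  by apply/subset_closure/lin_span_sub; exists n => //; exact/eqP.
Qed.

Lemma trace_basis : trace T = (\esum_(n in [set: nat]) (phi n * nr (e n) ^+ 2)%:E)%E.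
Proof.
rewrite /trace; set B := xget _ _.
have [B1 B0 tB] : orthonormal_basis B by rewrite /B; apply: xgetPex; exists [set x | exists2 n, x = e n & e n <> 0]; exact: basis_exists.
(* The unknown basis B is turned into a family indexed by H itself, with value 0 outside B. *)
pose f b := if b \in B then b else 0.
have fo : osys f.
  split=> [b c bc|b]; rewrite /f.
    case: ifPn => Bb; last by rewrite inner0l.
    case: ifPn => Bc; last by rewrite inner0r.
    by apply: B0; [exact: set_mem|exact: set_mem|exact/eqP].
  by case: ifPn => Bb; [right; apply: B1; exact: set_mem|left].
have tf : total_set (range f).
  apply: (total_trans tB) => b Bb; apply/subset_closure/lin_span_sub; exists b => //.
  by rewrite /f mem_set.
rewrite -(trace_family fo tf) esum_mkcond; apply: eq_esum => b _; rewrite /f.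
by case: ifP => // _; rewrite inner0r.
Qed.

Lemma trace_eigenfamily (I : choiceType) (f : I -> H) (psi : I -> R) :
  osys f -> total_set (range f) -> (forall i, T (f i) = (psi i)%:C%C *: f i) ->
  trace T = (\esum_(i in [set: I]) (psi i * nr (f i) ^+ 2)%:E)%E.
Proof.
move=> fo tf Tf; rewrite trace_basis -(trace_family fo tf).
by apply: eq_esum => i _; rewrite Tf innerZl inner_nr -rmorphM.
Qed.

End Trace.

Section Zeta.
Variables (R : realType) (H : hilbertType R) (e : nat -> H) (lam : nat -> R).
Hypotheses (eo : osys e) (ce : complete_sys e).
Let D := diag_rel e lam.

(** [functional_calculus] picks an operator by choice. It agrees with the diagonal one because both
    are bounded and [res_calculus] determines the chosen one on every [e n], whichever resolution it
    comes from. *)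
Lemma diag_calculus (t : R) : 0 <= t -> let T := functional_calculus D (resolvent_power t) in
  [/\ is_functional_calculus D (resolvent_power t) T, linear T, nbounded T 1 &
      forall x n, inner (T x) (e n) = (resolvent_power t (lam n))%:C%C * inner x (e n)].
Proof.
move=> t0 T.
have b1 n : `|resolvent_power t (lam n)| <= 1.
  by rewrite ger0_norm ?resolvent_power_le1// ltW// resolvent_power_gt0.
have [T' [lT' bT' hT']] := diag_ex eo ce b1.
have fcT' : is_functional_calculus D (resolvent_power t) T'.
  apply: diag_functional_calculus => //; first exact: measurable_resolvent_power.
  by move=> s; rewrite resolvent_power_le1// ltW// resolvent_power_gt0.
have fcT : is_functional_calculus D (resolvent_power t) T by exact: (xgetPex _ (ex_intro _ _ fcT')).
suff TT' : T = T' by rewrite TT'; split => //; rewrite -TT'.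
have [[lT [M bT]] [E [mu [SR qT]]]] := fcT.
have SA := diag_self_adjoint eo ce lam.
apply/funext; apply: (total_ext lT (M := M) _ lT' bT' (complete_total eo ce)).
  by move=> x; have := bT x; rewrite !nrE -rmorphM lecR.
move=> _ [n _ <-].
rewrite (res_calculus SA SR (@measurable_resolvent_power R t) lT qT (@diag_rel_e _ _ _ eo lam n)).
apply: (coef_inj ce) => m; rewrite hT' innerZl; have [->//|nm] := eqVneq m n.
by rewrite eo.1 ?mulr0// eq_sym.
Qed.

Lemma diag_eigen_calculus (f : R -> R) (T : H -> H) p (s : R) :
  (forall x n, inner (T x) (e n) = (f (lam n))%:C%C * inner x (e n)) ->
  D (p, s%:C%C *: p) -> T p = (f s)%:C%C *: p.
Proof.
move=> hT Dp; apply: (coef_inj ce) => n; rewrite hT innerZl.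
have := Dp n; rewrite /= innerZl => /eqP; rewrite -subr_eq0 -mulrBl mulf_eq0.
rewrite -rmorphB/= => /orP[/eqP h|/eqP ->]; last by rewrite !mulr0.
suff -> : s = lam n by [].
by apply/eqP; rewrite -subr_eq0; apply/eqP; apply: complexI.
Qed.

(** The resolvent power is an even function, so it acts as a scalar on every combination of
    eigenvectors for m and -m, and the zeta function can be read off a family of such
    combinations. *)
Lemma zeta_diag (t : R) (I : choiceType) (f : I -> H) (m : I -> R) : 0 <= t ->
  osys f -> total_set (range f) ->
  (forall i, exists p q a b, [/\ f i = a *: p + b *: q, D (p, (m i)%:C%C *: p) &
     D (q, (- m i)%:C%C *: q)]) ->
  zeta D t = (\esum_(i in [set: I]) (resolvent_power t (m i) * nr (f i) ^+ 2)%:E)%E.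
Proof.
move=> t0 fo tf hf; rewrite /zeta; have [_ lT bT hT] := diag_calculus t0.
have rp n : 0 <= resolvent_power t (lam n) by rewrite ltW// resolvent_power_gt0.
apply: (trace_eigenfamily eo ce rp hT fo tf) => i.
have [p [q [a [b [-> Dp Dq]]]]] := hf i.
rewrite (linear_add _ _ lT) !(linear_scale _ _ lT).
rewrite (diag_eigen_calculus hT Dp) (diag_eigen_calculus hT Dq).
have -> : resolvent_power t (- m i) = resolvent_power t (m i) by rewrite /resolvent_power sqrrN.
by rewrite scalerDr !scalerA ![_ * (resolvent_power t (m i))%:C%C]mulrC.
Qed.

Lemma ultra_bounded_limit (F : set_system H) (g : H -> R) (M : R) : UltraFilter F ->
  F [set y | `|g y| <= M] ->
  exists a, forall eps : R, 0 < eps -> F [set y | `|g y - a| < eps].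
Proof.
move=> FU FM; have FP : ProperFilter F by exact: ultra_proper.
have [|a [_ cla]] := @segment_compact R (- M) M (g @ F) _.
  by rewrite /fmap /=; apply: filterS FM => y /=; rewrite ler_norml in_itv.
exists a => eps e0; have [//|FC] := in_ultra_setVsetC [set y | `|g y - a| < eps] FU.
have FC' : (g @ F) [set r | ~ `|r - a| < eps] by [].
have [r [rC]] := cla _ _ FC' (nbhsx_ballx a eps e0).
by rewrite -ball_normE /= distrC => /rC.
Qed.

Lemma sub_sub_split (V : zmodType) (y t p q : V) : y - p = ((y - t) - (p - q)) + (t - q).
Proof. by rewrite opprB -addrA [q - p + _]addrC [t - q + _]addrA subrK addrA subrK. Qed.

Lemma psum_sub x y s : psum e (x - y) s = psum e x s - psum e y s.
Proof.
by rewrite /psum -sumrB; apply: eq_bigr => i _; rewrite -scalerBl /coef innerBl.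
Qed.

(** Compactness is checked on ultrafilters: along one, each coefficient converges, being bounded,
    and the part outside a finite set of indices is uniformly small; so the ultrafilter is
    Cauchy. *)
Lemma diag_compact (phi : nat -> R) (T : H -> H) : (forall n, `|phi n| <= 1) ->
  linear T -> nbounded T 1 ->
  (forall x n, inner (T x) (e n) = (phi n)%:C%C * inner x (e n)) ->
  (forall eps : R, 0 < eps -> finite_set [set n | e n <> 0 /\ eps <= `|phi n|]) ->
  compact_operator T.
Proof.
move=> phi1 lT bT hT fin; split => //; set A := closure _.
rewrite compact_ultra => F FU FA; have FP : ProperFilter F by exact: ultra_proper.
have A1 y : A y -> nr y <= 1.
  move=> /closure_nrP h; apply/ler_addgt0Pr => eps /h[_ [x x1 <-] hx].
  rewrite -[y](subrK (T x)); apply: le_trans (nrD _ _) _; rewrite addrC lerD ?(ltW hx)//.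
  apply: le_trans (bT x) _; rewrite mul1r.
  by move: x1; rewrite /= nrE (lecR _ 1).
have ne n : nr (e n) <= 1.
  case: (eo.2 n) => [->|]; first by rewrite nr0.
  rewrite inner_nr => /complexI h; rewrite -(@ler_pXn2r _ 2)// ?nnegrE ?nr_ge0// h expr1n//.
have coefA y n : A y -> cab (inner y (e n)) <= 1.
  move=> Ay; apply: le_trans (cauchy_schwarz _ _) _.
  by rewrite -[leRHS]mulr1 ler_pM ?nr_ge0// A1.
have /choice[c hc] : forall n, exists c : R[i], forall eps : R, 0 < eps -> F [set y | cab (inner y (e n) - c) < eps].
  move=> n.
  have bRe : F [set y | `|complex.Re (inner y (e n))| <= 1].
    apply: filterS FA => y /coefA h; apply: le_trans (h n).
    by rewrite -lecR -cabE normc_ge_Re.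
  have bIm : F [set y | `|complex.Im (inner y (e n))| <= 1].
    apply: filterS FA => y /coefA h; apply: le_trans (h n).
    rewrite -[cab _]mulr1 -(cab_i R) -cabM -normrN -ReiNIm.
    by rewrite -lecR -cabE normc_ge_Re.
  have [a ha] := ultra_bounded_limit FU bRe; have [b hb] := ultra_bounded_limit FU bIm.
  exists (a +i* b)%C => eps e0; have e20 : 0 < eps / 2 by rewrite divr_gt0.
  apply: filterS (filterI (ha _ e20) (hb _ e20)) => y [/= h1 h2].
  have -> : inner y (e n) - (a +i* b)%C =
      (complex.Re (inner y (e n)) - a)%:C%C + 'i%C * (complex.Im (inner y (e n)) - b)%:C%C.
    by case: (inner y (e n)) => u v /=; simpc.
  by apply: le_lt_trans (cabD _ _) _; rewrite cabM !cab_real cab_i; lra.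
have tail eps : 0 < eps -> exists s, uniq s /\ forall y, A y -> nr (y - psum e y s) <= eps.
  move=> e0; have [s0 hs0] : exists s : seq nat, [set n | e n <> 0 /\ eps <= `|phi n|] = [set` s].
    by apply/finite_seqP; exact: fin.
  exists (undup s0); split; first exact: undup_uniq.
  set s := undup s0; have us : uniq s by exact: undup_uniq.
  (* psi discards the finitely many values of modulus at least eps; its diagonal operator, of norm
     at most eps, is the tail of T outside s. *)
  pose psi n := if (n \in s) || (e n == 0) then 0 else phi n.
  have psi1 n : `|psi n| <= eps.
    rewrite /psi; case: ifPn => [_|]; first by rewrite normr0 ltW.
    rewrite negb_or mem_undup => /andP[ns /eqP en]; rewrite leNgt; apply/negP => /ltW h.
    by move/negP: ns; apply; have : [set` s0] n by rewrite -hs0.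
  have [T' [lT' bT' hT']] := diag_ex eo ce psi1.
  have TT' x : T x - psum e (T x) s = T' x.
    apply: (coef_inj ce) => n; rewrite innerBl inner_psum// hT' /psi /coef.
    case: ifPn => ns /=; first by rewrite subrr mul0r.
    case: eqP => [->|_]; first by rewrite !inner0r mulr0 subr0.
    by rewrite subr0 hT.
  move=> y /closure_nrP h; apply/ler_addgt0Pr => d /h[_ [x x1 <-] hx].
  have -> : y - psum e y s = ((y - T x) - psum e (y - T x) s) + (T x - psum e (T x) s).
    by rewrite psum_sub -sub_sub_split.
  apply: le_trans (nrD _ _) _; rewrite TT' addrC; apply: lerD.
    apply: le_trans (bT' x) _; rewrite -[leRHS]mulr1 ler_wpM2l ?(ltW e0)//.
    by move: x1; rewrite /= nrE (lecR _ 1).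
  apply: le_trans (ltW hx); rewrite -(@ler_pXn2r _ 2)// ?nnegrE ?nr_ge0//.
  by rewrite (bessel_eq eo (y - T x) us) lerDl sumr_ge0// => i _; exact: sqr_ge0.
have Fc : cauchy F.
  apply/cauchyP => eps e0.
  have er : eps = (complex.Re eps)%:C%C by rewrite RRe_real// gtr0_real.
  have e30 : 0 < complex.Re eps / 3 by rewrite divr_gt0// -ltcR -er.
  have [s [us hs]] := tail _ e30; exists (\sum_(n <- s) c n *: e n).
  have d0 : 0 < complex.Re eps / 3 / (size s).+1%:R by rewrite divr_gt0.
  have FI : F [set y | forall n, n \in s -> cab (inner y (e n) - c n) < complex.Re eps / 3 / (size s).+1%:R].
    elim: (s) (complex.Re eps / 3 / (size s).+1%:R) d0 => [|n r IH] d d0.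
      by apply: filterS filterT => y _ n; rewrite in_nil.
    apply: filterS (filterI (hc n d d0) (IH d d0)) => y [h1 h2] m.
    by rewrite in_cons => /orP[/eqP ->|]; [exact: h1|exact: h2].
  apply: filterS (filterI FA FI) => y [Ay hy]; rewrite -ball_normE /= nrE er ltcR nrBC.
  apply: le_lt_trans (nr_tri (psum e y s) _ _) _.
  have h1 := hs y Ay.
  have h2 : nr (psum e y s - \sum_(n <- s) c n *: e n) <= complex.Re eps / 3.
    rewrite /psum -sumrB; apply: le_trans (nr_sum _ _ _) _.
    apply: (@le_trans _ _ (\sum_(n <- s) complex.Re eps / 3 / (size s).+1%:R)).
      rewrite big_seq [leRHS]big_seq; apply: ler_sum => n ns.
      rewrite -scalerBl nrZc; apply: le_trans (ltW (hy n ns)).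
      by rewrite -[leRHS]mulr1 ler_wpM2l ?cab_ge0.
    rewrite big_const_seq count_predT iter_addr_0 -[leLHS]mulr_natr -mulrA ler_piMr ?(ltW e30)//.
    by rewrite mulrC ler_pdivrMr ?ltr0n// mul1r ler_nat.
  by move: h1 h2 e30; lra.
have /cvg_ex[p Fp] : cvg F by exact: cauchy_cvg.
exists p; split => //; apply: closed_closure => B Bp.
have [y [Ay By]] := filter_ex (filterI FA (Fp _ Bp)).
by exists y.
Qed.

Lemma diag_compact_resolvent : (forall N : R, finite_set [set n | e n <> 0 /\ lam n ^+ 2 <= N]) ->
  has_compact_resolvent D.
Proof.
move=> fin; have [fc lT bT hT] := diag_calculus (ler01 : 0 <= 1 :> R).
exists (functional_calculus D (resolvent_power 1)); split => //.
apply: (diag_compact _ lT bT hT) => [n|eps e0].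
  by rewrite ger0_norm ?resolvent_power_le1// ltW// resolvent_power_gt0.
(* (1 + lam^2)^(-1/2) >= eps implies lam^2 <= eps^(-2). *)
apply: sub_finite_set (fin (eps ^- 2)) => n [en h]; split => //.
rewrite leNgt; apply/negP => lt; move: h; apply/negP; rewrite -ltNge.
rewrite ger0_norm; last by rewrite ltW// resolvent_power_gt0.
rewrite /resolvent_power powRN div1r powR12_sqrt ?addr_ge0 ?sqr_ge0//.
rewrite invf_plt ?posrE ?sqrtr_gt0 ?ltr_pwDl ?sqr_ge0//.
rewrite -(@ltr_pXn2r _ 2)// ?nnegrE ?sqrtr_ge0 ?invr_ge0 ?(ltW e0)//.
rewrite sqr_sqrtr ?addr_ge0 ?sqr_ge0// exprVn; apply: lt_le_trans lt _.
by rewrite lerDr.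
Qed.

End Zeta.

(** * Closures of symmetric operators with diagonal square *)

Section SquareDiagonal.
Variables (R : realType) (K : hilbertType R) (D0 : set (K * K)).
Variables (I : choiceType) (f g : I -> K) (m : I -> R).
Hypotheses (D00 : D0 (0, 0)) (D0lin : forall c p q, D0 p -> D0 q -> D0 (c *: p + q)).
Hypothesis D0sym : forall x y x' y', D0 (x, y) -> D0 (x', y') -> inner y x' = inner x y'.
Hypotheses (fo : osys f) (ft : total_set (range f)) (sK : separable_space K).
Hypotheses (D0f : forall i, D0 (f i, g i)).
Hypothesis D0g : forall i, D0 (g i, (m i ^+ 2)%:C%C *: f i).

Let D := closure D0.

Lemma nr_cvg_lin (c : R[i]) (u v : nat -> K) x y : nr_cvg u x -> nr_cvg v y ->
  nr_cvg (fun n => c *: u n + v n) (c *: x + y).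
Proof.
move=> ux vy eps e0; have e20 : 0 < eps / 2 by rewrite divr_gt0.
have c0 : 0 < cab c + 1 by rewrite ltr_wpDl ?cab_ge0.
have [N hN] := ux _ (divr_gt0 e20 c0); have [N' hN'] := vy _ e20.
exists (maxn N N') => n; rewrite geq_max => /andP[/hN h1 /hN' h2].
rewrite opprD addrACA -scalerBr; apply: le_lt_trans (nrD _ _) _.
rewrite [ltRHS]splitr ler_ltD// nrZc; move: h1; rewrite ltr_pdivlMr// mulrC => /ltW.
by apply: le_trans; rewrite ler_wpM2r ?nr_ge0// lerDl.
Qed.

Lemma inv_nat_small (eps : R) : 0 < eps -> exists N : nat, forall n, (N <= n)%N -> n.+1%:R^-1 < eps.
Proof.
move=> e0; exists (Num.truncn eps^-1) => n Nn.
rewrite invf_plt ?posrE ?ltr0n//; apply: lt_le_trans (truncnS_gt _) _.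
by rewrite ler_nat ltnS.
Qed.

Lemma closure_graphP (S : set (K * K)) x y : closure S (x, y) <->
  exists u v : nat -> K, [/\ forall n, S (u n, v n), nr_cvg u x & nr_cvg v y].
Proof.
split=> [/closure_prodP h|[u [v [Suv ux vy]]]].
  have /choice[u /choice[v huv]] : forall n : nat, exists a b,
      [/\ S (a, b), nr (x - a) < n.+1%:R^-1 & nr (y - b) < n.+1%:R^-1].
    by move=> n; apply: h; rewrite invr_gt0.
  exists u, v; split.
  - by move=> n; have [] := huv n.
  - move=> eps /inv_nat_small[N hN]; exists N => n /hN; apply: lt_trans.
    by have [] := huv n; rewrite nrBC.
  - move=> eps /inv_nat_small[N hN]; exists N => n /hN; apply: lt_trans.
    by have [_ _] := huv n; rewrite nrBC.
apply/closure_prodP => eps e0; have [N hN] := ux _ e0; have [N' hN'] := vy _ e0.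
exists (u (maxn N N')), (v (maxn N N')); split => //.
  by rewrite nrBC hN// leq_maxl.
by rewrite nrBC hN'// leq_maxr.
Qed.

Lemma closure_graph_closed (u v : nat -> K) x y : (forall n, D (u n, v n)) ->
  nr_cvg u x -> nr_cvg v y -> D (x, y).
Proof.
move=> Duv ux vy; apply: closed_closure; apply/closure_graphP.
by exists u, v; split.
Qed.

Lemma closure_graph_lin c p q : D p -> D q -> D (c *: p + q).
Proof.
case: p q => [x y] [x' y'] /closure_graphP[u [v [Suv ux vy]]] /closure_graphP[u' [v' [Suv' ux' vy']]].
apply/closure_graphP; exists (fun n => c *: u n + u' n), (fun n => c *: v n + v' n); split.
- by move=> n; exact: (D0lin c (Suv n) (Suv' n)).
- exact: nr_cvg_lin.
- exact: nr_cvg_lin.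
Qed.

Lemma nr_cvg_inner (u v : nat -> K) (x y a b : K) : nr_cvg u x -> nr_cvg v y ->
  (forall n, inner (u n) a = inner (v n) b) -> inner x a = inner y b.
Proof.
move=> ux vy h; apply/eqP; rewrite -subr_eq0; apply/eqP/cab_eq0/eqP.
rewrite eq_le cab_ge0 andbT; apply/ler_addgt0Pr => eps e0; rewrite add0r.
have d0 : 0 < nr a + nr b + 1 by rewrite ltr_wpDl ?addr_ge0 ?nr_ge0.
have [N hN] := ux _ (divr_gt0 e0 d0); have [N' hN'] := vy _ (divr_gt0 e0 d0).
set n := maxn N N'; have h1 := hN n (leq_maxl _ _); have h2 := hN' n (leq_maxr _ _).
have -> : inner x a - inner y b = inner (v n - y) b - inner (u n - x) a.
  by rewrite !innerBl h; ring.
apply: le_trans (cabD _ _) _; rewrite cabN.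
have h3 : cab (inner (v n - y) b) <= eps / (nr a + nr b + 1) * nr b.
  by apply: le_trans (cauchy_schwarz _ _) _; rewrite ler_wpM2r ?nr_ge0// ltW.
have h4 : cab (inner (u n - x) a) <= eps / (nr a + nr b + 1) * nr a.
  by apply: le_trans (cauchy_schwarz _ _) _; rewrite ler_wpM2r ?nr_ge0// ltW.
apply: le_trans (lerD h3 h4) _; rewrite -mulrDr mulrAC -mulrA ler_piMr ?(ltW e0)//.
by rewrite ler_pdivrMr// mul1r addrC lerDl.
Qed.

Lemma closure_graph_sym x y x' y' : D (x, y) -> D (x', y') -> inner y x' = inner x y'.
Proof.
move=> /closure_graphP[u [v [Suv ux vy]]] /closure_graphP[u' [v' [Suv' ux' vy']]].
have h a b : D0 (a, b) -> inner y a = inner x b.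
  by move=> ab; apply: nr_cvg_inner vy ux _ => n; exact: D0sym.
rewrite (inner_conj x') (inner_conj y'); congr conjc.
by apply: nr_cvg_inner ux' vy' _ => n; rewrite (inner_conj y) (inner_conj x) (h _ _ (Suv' n)).
Qed.

Lemma sub_closure_graph x y : D0 (x, y) -> D (x, y).
Proof. exact: subset_closure. Qed.

(* On the D-invariant span of f i and g i the eigenvectors are g i + m i f i and g i - m i f i. *)
Lemma square_eigen i : exists p q a b, [/\ f i = a *: p + b *: q, D (p, (m i)%:C%C *: p) &
     D (q, (- m i)%:C%C *: q)].
Proof.
have Dp (s : R) : s ^+ 2 = m i ^+ 2 -> D (g i + s%:C%C *: f i, s%:C%C *: (g i + s%:C%C *: f i)).
  move=> s2; apply: sub_closure_graph; rewrite scalerDr scalerA -rmorphM/= -expr2 s2.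
  by rewrite [g i + _]addrC; exact: (D0lin s%:C%C (D0f i) (D0g i)).
(* If m i = 0, then ||g i||^2 = <f i, m^2 f i> = 0 by symmetry, so f i is itself in the kernel. *)
have [m0|m0] := eqVneq (m i) 0.
  have g0 : g i = 0.
    apply: inner_eq0; have := D0sym (D0f i) (D0g i).
    by rewrite m0 expr0n/= scale0r inner0r.
  exists (f i), 0, 1, 0; rewrite scale0r addr0 scale1r; split => //.
    by rewrite m0 scale0r; apply: sub_closure_graph; have := D0f i; rewrite g0.
  by rewrite scaler0; exact: sub_closure_graph.
exists (g i + (m i)%:C%C *: f i), (g i + (- m i)%:C%C *: f i), (2 * m i)^-1%:C%C, (- (2 * m i)^-1)%:C%C.
split; [|exact: Dp|by apply: Dp; rewrite sqrrN].
rewrite !scalerDr !scalerA -!rmorphM/= rmorphN/= scaleNr addrACA subrr add0r -scalerDl.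
rewrite -rmorphD/= (_ : (2 * m i)^-1 * m i + - (2 * m i)^-1 * - m i = 1) ?scale1r//.
by field.
Qed.

Lemma square_eigen_sep x : (forall p (t : R), D (p, t%:C%C *: p) -> inner x p = 0) -> x = 0.
Proof.
move=> h; apply: small_eq0 => eps e0.
have x0 i : coef f x i = 0.
  have [p [q [a [b [fE Dp Dq]]]]] := square_eigen i.
  by rewrite /coef fE innerDr !innerZr (h _ _ Dp) (h _ _ Dq) !mulr0 addr0.
have [s us] := psum_approx fo x ft e0.
rewrite /psum big1 ?subr0 => [/ltW//|i _].
by rewrite x0 scale0r.
Qed.

Lemma square_diag : exists (e : nat -> K) (lam : nat -> R),
  [/\ osys e, complete_sys e & D = diag_rel e lam].
Proof.
apply: (eigenbasis_of _ closure_graph_lin closure_graph_sym closure_graph_closed sK square_eigen_sep).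
exact: sub_closure_graph.
Qed.

Lemma square_self_adjoint : self_adjoint D.
Proof. by have [e [lam [eo ce ->]]] := square_diag; exact: diag_self_adjoint. Qed.

Lemma square_zeta (t : R) : 0 <= t ->
  zeta D t = (\esum_(i in [set: I]) (resolvent_power t (m i) * nr (f i) ^+ 2)%:E)%E.
Proof.
have [e [lam [eo ce De]]] := square_diag => t0.
have := square_eigen; rewrite De => hf.
exact: (zeta_diag eo ce t0 fo ft hf).
Qed.

Lemma osys_nr1 (J : eqType) (e : J -> K) n : osys e -> e n <> 0 -> nr (e n) = 1.
Proof.
move=> eo en; case: (eo.2 n) => //; rewrite inner_nr => /complexI/eqP.
rewrite sqrf_eq1 => /orP[/eqP//|/eqP h].
by have := nr_ge0 (e n); rewrite h; lra.
Qed.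

(** An eigenvector with lam^2 <= N is a combination of the finitely many f_i with m_i^2 <= N, since
    it is orthogonal to the f_i with m_i^2 different from lam^2. Summing |<e_n, f_i>|^2 in both
    orders shows that there are no more such eigenvectors than such i. *)
Lemma square_compact : (forall N : R, finite_set [set i | f i <> 0 /\ m i ^+ 2 <= N]) ->
  has_compact_resolvent D.
Proof.
move=> fin; have [e [lam [eo ce De]]] := square_diag.
rewrite De; apply: diag_compact_resolvent => // N; apply: contrapT => inf.
have [F0 hF0] : exists s : seq I, [set i | f i <> 0 /\ m i ^+ 2 <= N] = [set` s].
  by apply/finite_seqP; exact: fin.
pose F := undup F0; have uF : uniq F by exact: undup_uniq.
have [B BS Bn] := infinite_set_fset (size F).+1 inf.
have De' n : D (e n, (lam n)%:C%C *: e n) by rewrite De; exact: diag_rel_e.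
have expand n : e n <> 0 -> lam n ^+ 2 <= N ->
    1 = \sum_(i <- F) cab (coef f (e n) i) ^+ 2.
  move=> en ln; have z0 : e n - psum f (e n) F = 0.
    apply: small_eq0 => eps e0.
    have c0 i : coef f (e n - psum f (e n) F) i = 0.
      rewrite /coef innerBl inner_psum//; case: ifPn => iF; first by rewrite subrr.
      rewrite subr0; have [fi|/eqP fi] := eqVneq (f i) 0; first by rewrite fi inner0r.
      have h1 := closure_graph_sym (De' n) (sub_closure_graph (D0f i)).
      have h2 := closure_graph_sym (De' n) (sub_closure_graph (D0g i)).
      move: h1 h2; rewrite !innerZl innerZr conjc_real => h1; rewrite -h1 mulrA -rmorphM/= -expr2.
      move=> /eqP; rewrite -subr_eq0 -mulrBl mulf_eq0 -rmorphB/= => /orP[|/eqP//].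
      move=> /eqP/complexI h; exfalso; move/negP: iF; apply; rewrite mem_undup.
      have : [set` F0] i by rewrite -hF0; split => //; move: h ln; lra.
      by [].
    have [s us] := psum_approx fo (e n - psum f (e n) F) ft e0.
    by rewrite {2}/psum big1 ?subr0 => [/ltW//|i _]; rewrite c0 scale0r.
  have := bessel_eq fo (e n) uF; rewrite z0 nr0 expr0n/= add0r => <-.
  by rewrite osys_nr1// expr1n.
have : (size F).+1%:R <= (size F)%:R :> R.
  apply: (@le_trans _ _ (\sum_(n <- B) (1 : R))).
    by rewrite big_const_seq count_predT iter_addr_0 ler_nat.
  have -> : \sum_(n <- B) (1 : R) = \sum_(n <- B) \sum_(i <- F) cab (coef f (e n) i) ^+ 2.
    rewrite big_seq [RHS]big_seq; apply: eq_bigr => n nB.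
    by have [en ln] := BS n nB; exact: expand.
  rewrite exchange_big/=.
  apply: (@le_trans _ _ (\sum_(i <- F) (1 : R))).
    apply: ler_sum => i _.
    under eq_bigr do rewrite /coef inner_conj cab_conj.
    apply: le_trans (bessel eo (f i) (fset_uniq B)) _.
    have [->|/eqP fi] := eqVneq (f i) 0; first by rewrite nr0 expr0n ler01.
    by rewrite osys_nr1// expr1n.
  by rewrite big_const_seq count_predT iter_addr_0.
by rewrite ler_nat ltnn.
Qed.

End SquareDiagonal.

(** * Finite-dimensional spectra and length functions *)

Lemma normr_mulself (R : realType) (x : R) : `|x| * `|x| = x * x.
Proof. by rewrite -normrM ger0_norm// -expr2 sqr_ge0. Qed.

Section FiniteBasis.
Variables (R : realType) (V : hilbertType R).

Definition fonb d (w : 'I_d -> V) :=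
  (forall i j, inner (w i) (w j) = (i == j)%:R) /\
  forall x, (forall i, inner x (w i) = 0) -> x = 0.

(** Vectors depending on the previous ones are dropped, so s may be any spanning list. *)
Lemma gram_schmidt (s : seq V) : exists b : seq V, [/\ uniq b,
  forall v w, v \in b -> w \in b -> inner v w = (v == w)%:R &
  forall x, x \in s -> x = \sum_(v <- b) inner x v *: v].
Proof.
elim: s => [|a s [b [ub b1 bs]]]; first by exists [::]; split.
pose r := a - \sum_(v <- b) inner a v *: v.
have rb v : v \in b -> inner r v = 0.
  move=> vb; rewrite innerBl inner_suml (bigD1_seq v)//= innerZl (b1 v v)// eqxx mulr1.
  rewrite big_seq_cond big1 ?addr0 ?subrr// => w /andP[wb wv].
  by rewrite innerZl (b1 w v)// (negbTE wv) mulr0.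
have [r0|r0] := eqVneq r 0.
  exists b; split => // x; rewrite in_cons => /orP[/eqP ->|/bs//].
  by apply/eqP; rewrite -subr_eq0 -/r r0.
have nr0' : 0 < nr r by rewrite lt_neqAle nr_ge0 andbT eq_sym; apply: contra_neq r0 => /nr_eq0.
pose q := ((nr r)^-1)%:C%C *: r.
have q1 : inner q q = 1.
  rewrite inner_nr nrZc cab_real ger0_norm ?invr_ge0 ?nr_ge0//.
  by rewrite mulVf ?gt_eqF// expr1n.
have qb v : v \in b -> inner q v = 0 by move=> vb; rewrite innerZl rb// mulr0.
have qnb : q \notin b.
  by apply/negP => /qb; rewrite q1 => /eqP; rewrite oner_eq0.
exists (q :: b); split; first by rewrite /= qnb.
  move=> v w; rewrite !in_cons => /orP[/eqP ->|vb] /orP[/eqP ->|wb].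
  - by rewrite eqxx q1.
  - by rewrite qb//; case: eqP => // qw; move: qnb; rewrite qw wb.
  - by rewrite inner_conj qb// conjc0; case: eqP => // qw; move: qnb; rewrite -qw vb.
  - exact: b1.
have rq : r = (nr r)%:C%C *: q.
  by rewrite scalerA -rmorphM/= mulfV ?gt_eqF// scale1r.
move=> x; rewrite in_cons big_cons => /orP[/eqP ->|xs].
  have aE : a = r + \sum_(v <- b) inner a v *: v by rewrite /r subrK.
  have -> : inner a q = (nr r)%:C%C.
    rewrite {1}aE innerDl inner_suml big_seq big1 ?addr0.
      by rewrite {1}rq innerZl q1 mulr1.
    by move=> v vb; rewrite innerZl (inner_conj q) qb// conjc0 mulr0.
  by rewrite -rq -aE.
rewrite {2}(bs x xs) inner_suml big_seq big1 ?scale0r ?add0r; first exact: bs.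
by move=> v vb; rewrite innerZl (inner_conj q) qb// conjc0 mulr0.
Qed.

Lemma finite_onb : finite_dimensional V -> exists d (v : 'I_d -> V), fonb v.
Proof.
move=> [n [e eV]]; have [b [ub b1 bs]] := gram_schmidt [seq e i | i : 'I_n].
exists (size b), (fun i => nth 0 b i); split => [i j|x xb].
  by rewrite b1 ?mem_nth// nth_uniq.
have xb' v : v \in b -> inner x v = 0.
  by move=> /(nthP 0)[k kb <-]; exact: (xb (Ordinal kb)).
have xe i : inner x (e i) = 0.
  rewrite (bs (e i)) ?inner_sumr ?big_seq ?big1//.
    by move=> v vb; rewrite innerZr xb'// mulr0.
  by apply/mapP; exists i => //; rewrite mem_enum.
have : lin_span (range e) x by rewrite eV.
move=> [k [c [s [hs xE]]]]; apply: inner_eq0; rewrite {2}xE inner_sumr big1// => i _.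
by rewrite innerZr; have [j _ <-] := hs i; rewrite xe mulr0.
Qed.

Variables (d : nat).

Lemma fonb_expand (w : 'I_d -> V) x : fonb w -> x = \sum_i inner x (w i) *: w i.
Proof.
move=> [w1 wc]; apply/eqP; rewrite -subr_eq0; apply/eqP/wc => j.
rewrite innerBl inner_suml (bigD1 j)//= innerZl w1 eqxx mulr1 big1 ?addr0 ?subrr//.
by move=> i ij; rewrite innerZl w1 (negbTE ij) mulr0.
Qed.

Lemma fonb_osys (w : 'I_d -> V) : fonb w -> osys w.
Proof.
move=> [w1 _]; split=> [i j ij|i]; rewrite w1; first by rewrite (negbTE ij).
by right; rewrite eqxx.
Qed.

Lemma fonb_ne0 (w : 'I_d -> V) i : fonb w -> w i <> 0.
Proof.
by move=> [w1 _] wi; have := w1 i i; rewrite wi inner0l eqxx => /esym/eqP; rewrite oner_eq0.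
Qed.

Lemma fonb_total (w : 'I_d -> V) : fonb w -> total_set (range w).
Proof.
move=> wb; rewrite /total_set -subTset => x _; apply: subset_closure.
by exists d, (fun i => inner x (w i)), w; split; [move=> i; exists i|exact: fonb_expand].
Qed.

(** The matrix of T is hermitian, and the spectral theorem for matrices diagonalizes it. Its entry
    (i, j) is <T v_i, v_j>, so T acts on coordinate rows from the right and the eigenvectors are the
    rows of P. *)
Lemma self_adjoint_eigenbasis (v : 'I_d -> V) (T : V -> V) : fonb v ->
  self_adjoint_operator T ->
  exists (w : 'I_d -> V) (m : 'I_d -> R), fonb w /\ forall k, T (w k) = (m k)%:C%C *: w k.
Proof.
move=> vb [[lT _] sT]; pose A := \matrix_(i, j) inner (T (v i)) (v j).
have conjE (z : R[i]) : Num.conj z = conjc z by [].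
have Ah : A \is hermsymmx.
  apply/is_hermitianmxP; rewrite expr0 scale1r; apply/matrixP => i j.
  by rewrite !mxE conjE sT -inner_conj.
have /orthomx_spectralP := hermitian_normalmx Ah.
set P := spectralmx A; set D := spectral_diag A => AE.
have Pu : P \is unitarymx := spectral_unitarymx A.
have PA : P *m A = diag_mx D *m P.
  by rewrite AE !mulmxA mulmxV ?mul1mx// unitarymx_unit.
have PP := unitarymxP Pu; have PP' : (P ^t*)%sesqui *m P = 1%:M.
  by rewrite -(invmx_unitary Pu) mulVmx// unitarymx_unit.
have Dr k : D 0 k = (complex.Re (D 0 k))%:C%C.
  have /mxOverP/(_ 0 k) := hermitian_spectral_diag_real Ah.
  by move=> /RRe_real.
pose w k := \sum_j P k j *: v j.
have wb : fonb w.
  split=> [i j|x xw].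
    rewrite inner_suml; have := congr1 (fun M : 'M[R[i]]_d => M i j) PP; rewrite !mxE => <-.
    apply: eq_bigr => k _; rewrite innerZl inner_sumr (bigD1 k)//= innerZr vb.1 eqxx mulr1.
    rewrite big1 ?addr0 ?mxE// => l lk.
    by rewrite innerZr vb.1 eq_sym (negbTE lk) mulr0.
  apply: vb.2 => j.
  have -> : v j = \sum_k conjc (P k j) *: w k.
    under eq_bigr do rewrite scaler_sumr.
    rewrite exchange_big/= (bigD1 j)//= -[LHS]addr0; congr (_ + _).
      under eq_bigr do rewrite scalerA.
      rewrite -scaler_suml; have := congr1 (fun M : 'M[R[i]]_d => M j j) PP'; rewrite !mxE eqxx.
      move=> h; rewrite -[LHS]scale1r -[1]/(1%:R) -h; congr (_ *: _).
      by apply: eq_bigr => k _; rewrite !mxE.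
    rewrite big1// => i ij; under eq_bigr do rewrite scalerA.
    rewrite -scaler_suml; have := congr1 (fun M : 'M[R[i]]_d => M j i) PP'; rewrite !mxE eq_sym (negbTE ij).
    move=> h; rewrite -[RHS](scale0r (v i)) -[0]/(0%:R) -[in RHS]h; congr (_ *: _).
    by apply: eq_bigr => k _; rewrite !mxE.
  by rewrite inner_sumr big1// => k _; rewrite innerZr xw mulr0.
exists w, (fun k => complex.Re (D 0 k)); split => // k.
rewrite -Dr /w linear_bigsum//.
under eq_bigr do rewrite (linear_scale _ _ lT).
have Tv j : T (v j) = \sum_i A j i *: v i.
  by rewrite [LHS](fonb_expand (T (v j)) vb); apply: eq_bigr => i _; rewrite mxE.
under eq_bigr do rewrite Tv scaler_sumr.
rewrite exchange_big scaler_sumr/=; apply: eq_bigr => i _.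
under eq_bigr do rewrite scalerA.
rewrite -scaler_suml scalerA; congr (_ *: _).
have := congr1 (fun M : 'M[R[i]]_d => M k i) PA; rewrite mxE => ->.
by rewrite mul_diag_mx mxE.
Qed.

Section Eigenbasis.
Variables (w : 'I_d -> V) (m : 'I_d -> R) (T : V -> V).
Hypotheses (wb : fonb w) (lT : linear T) (Tw : forall k, T (w k) = (m k)%:C%C *: w k).

Definition fdiag (c : 'I_d -> R) (x : V) : V := \sum_k ((c k)%:C%C * inner x (w k)) *: w k.

Lemma fdiag_linear c : linear (fdiag c).
Proof.
move=> a x y; rewrite /fdiag scaler_sumr -big_split/=; apply: eq_bigr => k _.
by rewrite innerDl innerZl scalerA -scalerDl; congr (_ *: _); ring.
Qed.

Lemma fdiag_inner c x k : inner (fdiag c x) (w k) = (c k)%:C%C * inner x (w k).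
Proof.
rewrite inner_suml (bigD1 k)//= innerZl wb.1 eqxx mulr1 big1 ?addr0// => j jk.
by rewrite innerZl wb.1 (negbTE jk) mulr0.
Qed.

Lemma fdiag_w c k : fdiag c (w k) = (c k)%:C%C *: w k.
Proof.
rewrite /fdiag (bigD1 k)//= wb.1 eqxx mulr1 big1 ?addr0// => j jk.
by rewrite wb.1 eq_sym (negbTE jk) mulr0 scale0r.
Qed.

Lemma fonb_ext (S S' : V -> V) : linear S -> linear S' -> (forall k, S (w k) = S' (w k)) ->
  forall x, S x = S' x.
Proof.
move=> lS lS' h x; rewrite (fonb_expand x wb) !linear_bigsum//.
by apply: eq_bigr => k _; rewrite (linear_scale _ _ lS) (linear_scale _ _ lS') h.
Qed.

Lemma fdiag_comp c c' x : fdiag c (fdiag c' x) = fdiag (fun k => c k * c' k) x.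
Proof.
by rewrite /fdiag; apply: eq_bigr => k _; rewrite fdiag_inner rmorphM mulrA.
Qed.

Lemma fdiag_self_adjoint c : self_adjoint_operator (fdiag c).
Proof.
split; last first.
  move=> x y; rewrite inner_suml inner_sumr; apply: eq_bigr => k _.
  by rewrite innerZl innerZr conjcM conjc_real -inner_conj; ring.
split; first exact: fdiag_linear.
exists (\sum_k `|c k|) => x; rewrite !nrE -rmorphM lecR mulr_suml.
apply: le_trans (nr_sum _ _ _) _; apply: ler_sum => k _.
have w1 : nr (w k) = 1 by apply: osys_nr1; [exact: fonb_osys|exact: fonb_ne0].
rewrite nrZc w1 mulr1 cabM cab_real ler_wpM2l//.
by apply: le_trans (cauchy_schwarz _ _) _; rewrite w1 mulr1.
Qed.

Lemma Sp_eigen t : Sp T t <-> exists k, m k = t.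
Proof.
split=> [spt|[k mk] [S [[lS _] _ S1]]]; last first.
  apply: (fonb_ne0 (i := k) wb); rewrite -[LHS]S1 Tw mk subrr.
  exact: linear_0.
apply: contrapT => h; apply: spt.
have mt k : m k - t != 0 by apply/eqP => /eqP; rewrite subr_eq0 => /eqP mk; apply: h; exists k.
have TtE x : T x - t%:C%C *: x = fdiag (fun k => m k - t) x.
  apply: (fonb_ext (S := fun x => T x - t%:C%C *: x)) => [a u v||k]; last 2 first.
  - exact: fdiag_linear.
  - by rewrite fdiag_w Tw -scalerBl -rmorphB.
  by rewrite lT scalerDr opprD addrACA scalerBr !scalerA mulrC.
have fdiag1 x : fdiag (fun=> 1) x = x.
  by rewrite [RHS](fonb_expand x wb); apply: eq_bigr => k _; rewrite mul1r.
exists (fdiag (fun k => (m k - t)^-1)); split.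
- by have [] := fdiag_self_adjoint (fun k => (m k - t)^-1).
- move=> x; rewrite TtE fdiag_comp -[RHS]fdiag1; congr (fdiag _ x).
  by apply/funext => k; rewrite mulfV.
- move=> x; rewrite TtE fdiag_comp -[RHS]fdiag1; congr (fdiag _ x).
  by apply/funext => k; rewrite mulVf.
Qed.

(** The defect z satisfies P z = - |m| z, and positivity of P forces |m| ||z||^2 = 0. If m = 0, then
    ||P w||^2 = <T^2 w, w> = 0. *)
Lemma absolute_value_eigen P k : is_absolute_value T P -> P (w k) = `|m k|%:C%C *: w k.
Proof.
move=> [[[[lP _] sP] pP] PP].
pose z := P (w k) - `|m k|%:C%C *: w k.
have Pz : P z = - `|m k|%:C%C *: z.
  rewrite /z (linear_sub _ _ lP) (linear_scale _ _ lP) PP Tw (linear_scale _ _ lT) Tw.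
  rewrite scalerBr !scalerA mulNr -!rmorphM/= normr_mulself.
  by rewrite !scaleNr opprK addrC.
have := pP z; rewrite Pz innerZl inner_nr -rmorphN -rmorphM/= ler0c mulNr oppr_ge0 => h.
have /eqP : `|m k| * nr z ^+ 2 = 0.
  by apply/eqP; rewrite eq_le h mulr_ge0 ?sqr_ge0.
rewrite mulf_eq0 => /orP[/eqP m0|]; last first.
  by rewrite sqrf_eq0 => /eqP/nr_eq0/eqP; rewrite subr_eq0 => /eqP.
rewrite m0 scale0r; apply: inner_eq0; rewrite sP PP Tw (linear_scale _ _ lT) Tw.
by move/eqP: m0; rewrite normr_eq0 => /eqP ->; rewrite !scale0r inner0r.
Qed.

Lemma absolute_value_exists : is_absolute_value T (fdiag (fun k => `|m k|)).
Proof.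
split; last first.
  move=> x; rewrite fdiag_comp.
  apply: (fonb_ext (S' := fun x => T (T x))) => [||k]; first exact: fdiag_linear.
    by move=> a u v; rewrite !lT.
  by rewrite fdiag_w Tw (linear_scale _ _ lT) Tw scalerA -rmorphM/= normr_mulself.
split; first exact: fdiag_self_adjoint.
move=> x; rewrite inner_suml sumr_ge0// => k _.
rewrite innerZl (inner_conj x) -mulrA mul_conjc -rmorphM ler0c.
by rewrite mulr_ge0 ?sqr_ge0.
Qed.

End Eigenbasis.
End FiniteBasis.

Lemma length_ballP (R : realType) (G : groupType) (V : hilbertType R) (l : G -> V -> V) d
    (w : G -> 'I_d -> V) (m : G -> 'I_d -> R) n g :
  (forall g, fonb (w g)) -> (forall g, linear (l g)) ->
  (forall g k, l g (w g k) = (m g k)%:C%C *: w g k) ->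
  length_ball l n g <-> exists k, `|m g k| <= n%:R.
Proof.
move=> wb ll lw; split=> [[P [t [Pabs spt _ tn]]]|[k0 hk0]].
  have lP : linear P by case: Pabs => [[[[]]]].
  have Pw k := absolute_value_eigen (ll g) (lw g) k Pabs.
  by have /(Sp_eigen (wb g) lP Pw)[k mk] := spt; exists k; rewrite mk.
have [k _ kmin] := @arg_minP _ _ _ k0 xpredT (fun k => `|m g k|) isT.
exists (fdiag (w g) (fun k => `|m g k|)), `|m g k|.
have lP := fdiag_linear (w g) (fun k => `|m g k|).
have SpP := Sp_eigen (wb g) lP (fdiag_w (wb g) (fun k => `|m g k|)).
split.
- exact: absolute_value_exists.
- by apply/SpP; exists k.
- by move=> s /SpP[j <-]; exact: kmin.
- exact: le_trans (kmin k0 isT) hk0.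
Qed.

Section ProperLength.
Variables (R : realType) (G : groupType) (V : hilbertType R) (l : G -> V -> V) (d : nat).
Variables (w : G -> 'I_d -> V) (m : G -> 'I_d -> R).
Hypotheses (wb : forall g, fonb (w g)) (ll : forall g, linear (l g)).
Hypothesis lw : forall g k, l g (w g k) = (m g k)%:C%C *: w g k.
Hypothesis lp : proper_length l.

Lemma proper_finite (N : R) : finite_set [set p : G * 'I_d | m p.1 p.2 ^+ 2 <= N].
Proof.
have [_ fin1 fin2] := lp; pose S := length_spectrum l `&` `[- Num.sqrt N, Num.sqrt N].
have Sfin : finite_set (\bigcup_(t in S) [set x | Sp (l x) t]).
  by apply: bigcup_finite => [|t [+ _]]; [exact: fin1|exact: fin2].
apply: (@sub_finite_set _ _ ((\bigcup_(t in S) [set x | Sp (l x) t]) `*` [set: 'I_d])).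
  move=> [g k] /= mN; split => //.
  have spm : Sp (l g) (m g k) by apply/(Sp_eigen (wb g) (ll g) (lw g)); exists k.
  exists (m g k) => //; split; first by exists g.
  rewrite /= in_itv/= -ler_norml -sqrtr_sqr ler_sqrt//.
  by apply: le_trans mN; exact: sqr_ge0.
by apply: finite_setX.
Qed.

(** Every g has at least one eigenvalue because d > 0, so G is exhausted by the finite sets of
    [proper_finite]. *)
Lemma proper_countable : (0 < d)%N -> countable [set: G].
Proof.
move=> d0; pose k0 := Ordinal d0.
rewrite (_ : [set: G] = \bigcup_(n in [set: nat]) (fst @` [set p : G * 'I_d | m p.1 p.2 ^+ 2 <= n%:R])).
  apply: bigcup_countable => // n _; apply: finite_set_countable.
  exact/finite_image/proper_finite.
apply/seteqP; split => // g _; exists (Num.truncn (m g k0 ^+ 2)).+1 => //.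
exists (g, k0) => //=; apply: ltW.
exact: truncnS_gt.
Qed.

End ProperLength.

(** * C*-algebras and block operators *)

Section CStar.
Variables (R : realType) (A : cstarType R).
Implicit Types (a b h z : A).

Lemma cmul0x a : (0 : A) ** a = 0.
Proof. by have := cmulZl 0 (0 : A) a; rewrite !scale0r. Qed.

Lemma cmulx0 a : a ** (0 : A) = 0.
Proof. by have := cmulZr 0 a (0 : A); rewrite !scale0r. Qed.

Lemma cmulNl a b : (- a) ** b = - (a ** b).
Proof. by rewrite -scaleN1r cmulZl scaleN1r. Qed.

Lemma cmulNr a b : a ** (- b) = - (a ** b).
Proof. by rewrite -scaleN1r cmulZr scaleN1r. Qed.

Lemma star0 : star (0 : A) = 0.
Proof. by have := starZ 0 (0 : A); rewrite scale0r conjc0 scale0r. Qed.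

Lemma starN a : star (- a) = - star a.
Proof. by rewrite -scaleN1r starZ rmorphN1 scaleN1r. Qed.

Lemma star1 : star (cone : A) = cone.
Proof. by rewrite -[LHS]cmul1x -[X in X ** _](starK cone) -starM cmul1x starK. Qed.

Lemma nr_cmul a b : nr (a ** b) <= nr a * nr b.
Proof. by rewrite -lecR rmorphM/= -!nrE normr_cmul. Qed.

Lemma nr_cstar a : nr (star a ** a) = nr a ^+ 2.
Proof. by apply: complexI; rewrite -nrE cstar_identity nrE rmorphXn. Qed.

Lemma nr_star_le a : nr a <= nr (star a).
Proof.
have [a0|a0] := eqVneq (nr a) 0; first by rewrite a0 nr_ge0.
have ap : 0 < nr a by rewrite lt_neqAle eq_sym a0 nr_ge0.
by rewrite -(ler_pM2r ap) -expr2 -nr_cstar nr_cmul.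
Qed.

Lemma nr_star a : nr (star a) = nr a.
Proof. by apply/eqP; rewrite eq_le nr_star_le andbT -{2}(starK a) nr_star_le. Qed.

Lemma nr_cvg_unique (E : normedModType R[i]) (u : nat -> E) x y :
  nr_cvg u x -> nr_cvg u y -> x = y.
Proof.
move=> ux uy; apply/eqP; rewrite -subr_eq0; apply/eqP/small_eq0 => eps e0.
have e20 : 0 < eps / 2 by rewrite divr_gt0.
have [N hN] := ux _ e20; have [N' hN'] := uy _ e20.
have h1 := hN _ (leq_maxl N N'); have h2 := hN' _ (leq_maxr N N').
apply: le_trans (nr_tri (u (maxn N N')) _ _) _; rewrite nrBC; lra.
Qed.

(* The square root of 1 - h is 1 - z, with z the limit of z_(n+1) = (h + z_n^2) / 2. *)
Lemma cstar_sqrt h : star h = h -> nr h < 1 ->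
  exists y, star y = y /\ y ** y = cone - h.
Proof.
(* r < 1 is a fixed point of r -> (||h|| + r^2) / 2. It bounds all iterates, and on the ball of
   radius r it is also a contraction factor of F. *)
move=> hs h1; pose s := Num.sqrt (1 - nr h); pose r := 1 - s.
have s0 : 0 < s by rewrite sqrtr_gt0 subr_gt0.
have s2 : s ^+ 2 = 1 - nr h by rewrite sqr_sqrtr// subr_ge0 ltW.
have s1 : s <= 1.
  by rewrite -(@ler_pXn2r _ 2)// ?nnegrE ?(ltW s0)// s2 expr1n gerBl nr_ge0.
have r0 : 0 <= r by rewrite subr_ge0.
have r1 : r < 1 by rewrite /r ltrBlDr ltrDl.
have rE : (nr h + r ^+ 2) / 2 = r.
  have -> : nr h = 1 - s ^+ 2 by rewrite s2 opprB addrC subrK.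
  by rewrite /r; field.
pose F z := (2^-1 : R)%:C%C *: (h + z ** z).
have nF a : nr ((2^-1 : R)%:C%C *: a) = 2^-1 * nr a.
  by rewrite nrZ -/(cab _) cab_real ger0_norm.
pose z := fun n => iter n F 0.
have zs n : star (z n) = z n.
  by elim: n => [|n IH]; [exact: star0|rewrite /= starZ conjc_real starD hs starM IH].
have zb n : nr (z n) <= r.
  elim: n => [|n IH]; first by rewrite nr0.
  rewrite /= nF -[leRHS]rE mulrC ler_pM2r ?invr_gt0//.
  apply: le_trans (nrD _ _) _; rewrite lerD2l; apply: le_trans (nr_cmul _ _) _.
  by rewrite expr2 ler_pM ?nr_ge0.
have Fd a b : nr a <= r -> nr b <= r -> nr (F a - F b) <= r * nr (a - b).
  move=> ar br; rewrite -scalerBr nF.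
  have -> : h + a ** a - (h + b ** b) = a ** (a - b) + (a - b) ** b.
    rewrite opprD addrACA subrr add0r cmulDr cmulDl cmulNr cmulNl.
    by rewrite addrA subrK.
  have : nr (a ** (a - b) + (a - b) ** b) <= 2 * (r * nr (a - b)).
    apply: le_trans (nrD _ _) _.
    have h2 : nr (a ** (a - b)) <= r * nr (a - b).
      by apply: le_trans (nr_cmul _ _) _; rewrite ler_wpM2r ?nr_ge0.
    have h3 : nr ((a - b) ** b) <= r * nr (a - b).
      by apply: le_trans (nr_cmul _ _) _; rewrite mulrC ler_wpM2r ?nr_ge0.
    by move: h2 h3; lra.
  by lra.
have zd n : nr (z n.+1 - z n) <= r ^+ n.
  elim: n => [|n IH].
    by rewrite subr0 expr0; apply: le_trans (zb 1%N) (ltW r1).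
  apply: (@le_trans _ _ (r * nr (z n.+1 - z n))); first exact: (Fd (z n.+1) (z n) (zb _) (zb _)).
  by rewrite exprS ler_wpM2l.
have zmn n k : nr (z (n + k)%N - z n) <= r ^+ n / (1 - r).
  have r1' : 0 < 1 - r by rewrite subr_gt0.
  suff : nr (z (n + k)%N - z n) <= r ^+ n * ((1 - r ^+ k) / (1 - r)).
    move=> /le_trans; apply; rewrite ler_wpM2l ?exprn_ge0// ler_pdivrMr// mulVf ?gt_eqF//.
    by rewrite gerBl exprn_ge0.
  elim: k => [|k IH]; first by rewrite addn0 subrr nr0 expr0 subrr mul0r mulr0.
  apply: le_trans (nr_tri (z (n + k)%N) _ _) _.
  apply: le_trans (lerD _ IH) _; first by rewrite addnS; exact: zd.
  rewrite exprD exprS le_eqVlt; apply/orP; left; apply/eqP.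
  by field; rewrite gt_eqF.
have rpow eps : 0 < eps -> exists N, r ^+ N / (1 - r) < eps.
  move=> e0; have r1' : 0 < 1 - r by rewrite subr_gt0.
  have /cvgrPdist_lt/(_ _ (mulr_gt0 e0 r1')) : (fun n => r ^+ n) @ \oo --> (0 : R).
    by apply: cvg_expr; rewrite ger0_norm.
  move=> [N _ /(_ N (leqnn N))] /=; rewrite sub0r normrN ger0_norm ?exprn_ge0//.
  by move=> h2; exists N; rewrite ltr_pdivrMr.
have [|y zy] := @seq_complete R A z.
  move=> eps e0; have e20 : 0 < eps / 2 by rewrite divr_gt0.
  have [N hN] := rpow _ e20; exists N => i j Ni Nj.
  have hi := zmn N (i - N)%N; have hj := zmn N (j - N)%N.
  rewrite subnKC// in hi; rewrite subnKC// in hj.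
  by apply: le_lt_trans (nr_tri (z N) _ _) _; rewrite (nrBC (z N)); lra.
have yr : nr y <= r.
  apply/ler_addgt0Pr => eps /zy[N /(_ N (leqnn N))] hN.
  rewrite -[y](subrK (z N)); apply: le_trans (nrD _ _) _; rewrite addrC nrBC.
  by rewrite lerD ?zb// ltW.
have yF : y = F y.
  apply: (@nr_cvg_unique _ (fun n => z n.+1)) => eps e0.
    by have [N hN] := zy _ e0; exists N => n Nn; exact: hN (leqW Nn).
  have [N hN] := zy _ e0; exists N => n /hN; apply: le_lt_trans.
  apply: le_trans (Fd _ _ (zb _) yr) _.
  by rewrite ler_piMl ?nr_ge0// ltW.
have ys : star y = y.
  apply: (nr_cvg_unique (u := z)) => // eps /zy[N hN]; exists N => n /hN.
  by rewrite -(nr_star (z n - y)) starD starN zs.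
exists (cone - y); split; first by rewrite starD starN star1 ys.
have hE : h = y + y - y ** y.
  have -> : y + y = (2 : R)%:C%C *: y by rewrite rmorphD scalerDl !scale1r.
  by rewrite {1}yF scalerA -rmorphM/= mulfV// scale1r addrK.
rewrite hE cmulDl cmul1x cmulNl cmulDr cmulx1 cmulNr.
by rewrite -[y + y - _]addrA [in RHS]opprD addrA.
Qed.

Lemma rep_linear (H : hilbertType R) (pi : A -> H -> H) a : representation pi -> linear (pi a).
Proof. by move=> rp; have [] := representation_bounded rp a. Qed.

(** A representation is only assumed bounded. For c > ||a||^2 the element 1 - a^* a / c is the
    square of a self-adjoint y, and <pi(y^2) xi, xi> = ||pi(y) xi||^2 >= 0 gives ||pi(a) xi||^2 <= c
    ||xi||^2. *)
Lemma rep_contractive (H : hilbertType R) (pi : A -> H -> H) a : representation pi ->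
  nbounded (pi a) (nr a).
Proof.
move=> rp xi; rewrite -(@ler_pXn2r _ 2)// ?nnegrE ?mulr_ge0 ?nr_ge0//.
have key eps : 0 < eps -> nr (pi a xi) ^+ 2 <= (nr a ^+ 2 + eps) * nr xi ^+ 2.
  move=> e0; set c := nr a ^+ 2 + eps.
  have c0 : 0 < c by rewrite ltr_wpDl ?sqr_ge0.
  pose h := (c^-1)%:C%C *: (star a ** a).
  have hs : star h = h by rewrite starZ conjc_real starM starK.
  have h1 : nr h < 1.
    rewrite nrZ -/(cab _) cab_real ger0_norm ?invr_ge0 ?(ltW c0)// nr_cstar mulrC.
    by rewrite ltr_pdivrMr// mul1r ltrDl.
  have [y [ys yy]] := cstar_sqrt hs h1.
  have : 0 <= inner (pi (y ** y) xi) xi.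
    by rewrite (representationM rp) -{1}ys (representation_star rp) inner_nr ler0c sqr_ge0.
  rewrite yy (representationD rp) (representation1 rp) -scaleN1r (representationZ rp) scaleN1r.
  rewrite (representationZ rp) (representationM rp) innerBl innerZl (representation_star rp).
  rewrite !inner_nr -rmorphM -rmorphB ler0c subr_ge0 mulrC ler_pdivrMr// mulrC.
  by [].
rewrite exprMn; apply/ler_addgt0Pr => eps e0.
have d0 : 0 < nr xi ^+ 2 + 1 by rewrite ltr_wpDl ?sqr_ge0.
apply: le_trans (key _ (divr_gt0 e0 d0)) _; rewrite mulrDl lerD2l mulrAC -mulrA.
by rewrite ler_piMr ?(ltW e0)// ler_pdivrMr// mul1r lerDl.
Qed.

End CStar.

(** * Block diagonal operators *)

Section Block.
Variables (R : realType) (X Y K K' : hilbertType R) (I : choiceType).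
Variables (iota : I -> X -> K) (iota' : I -> Y -> K') (c : I -> X -> Y).
Variables (kappa : I -> R) (M : R).
Hypotheses (li : forall i, linear (iota i)) (li' : forall i, linear (iota' i)).
Hypotheses (lc : forall i, linear (c i)) (M0 : 0 <= M).
Hypothesis iP : forall i j x y, inner (iota i x) (iota j y) = ((i == j)%:R * kappa i)%:C%C * inner x y.
Hypothesis iP' : forall i j x y, inner (iota' i x) (iota' j y) = ((i == j)%:R * kappa i)%:C%C * inner x y.
Hypothesis (k0 : forall i, 0 <= kappa i) (cM : forall i, nbounded (c i) M).
Hypothesis itot : total_set [set iota p.1 p.2 | p in [set: I * X]].

Lemma block_nr (Z Q : hilbertType R) (th : I -> Z -> Q) (s : seq I) (xi : I -> Z) : uniq s ->
  (forall i j x y, inner (th i x) (th j y) = ((i == j)%:R * kappa i)%:C%C * inner x y) ->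
  nr (\sum_(i <- s) th i (xi i)) ^+ 2 = \sum_(i <- s) kappa i * nr (xi i) ^+ 2.
Proof.
move=> us tP; apply: complexI; rewrite -inner_nr inner_suml rmorph_sum/=.
rewrite big_seq [RHS]big_seq; apply: eq_bigr => i is_.
rewrite inner_sumr (bigD1_seq i)//= tP eqxx mul1r inner_nr -rmorphM/= big1 ?addr0//.
by move=> j ij; rewrite tP eq_sym (negbTE ij) mul0r mul0r.
Qed.

(** The blocks are pairwise orthogonal and scaled by the same [kappa i] on both sides, so square
    norms are weighted sums over blocks and the bound M passes from the blocks to T. The value 0 of
    [kappa i] occurs when a block comes from a zero vector of a system. *)
Lemma block_operator : exists T : K -> K', [/\ linear T, nbounded T M &
  forall i x, T (iota i x) = iota' i (c i x)].
Proof.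
pose Gm : set (K * K') := lin_span [set (iota p.1 p.2, iota' p.1 (c p.1 p.2)) | p in [set: I * X]].
have rep x y : Gm (x, y) -> exists (s : seq I) (xi : I -> X), [/\ uniq s,
    x = \sum_(i <- s) iota i (xi i) & y = \sum_(i <- s) iota' i (c i (xi i))].
  move=> [n [a [p [hp xyE]]]].
  have /choice[k hk] : forall i, exists q : I * X, p i = (iota q.1 q.2, iota' q.1 (c q.1 q.2)).
    by move=> i; have [q _ <-] := hp i; exists q.
  pose s := undup [seq (k i).1 | i : 'I_n].
  have ks i : (k i).1 \in s by rewrite mem_undup; apply/mapP; exists i; rewrite ?mem_enum.
  have us : uniq s by exact: undup_uniq.
  exists s, (fun j => \sum_(i < n | (k i).1 == j) a i *: (k i).2).
  have gen (Q : lmodType R[i]) (th : I -> X -> Q) : (forall i, linear (th i)) ->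
      \sum_(j <- s) th j (\sum_(i < n | (k i).1 == j) a i *: (k i).2) =
      \sum_(i < n) a i *: th (k i).1 (k i).2.
    move=> lth; under eq_bigr do rewrite (linear_bigsum _ _ _ (lth _)).
    rewrite (exchange_big_dep predT)//=; apply: eq_bigr => i _.
    under eq_bigl do rewrite eq_sym.
    rewrite -big_filter filter_pred1_uniq// big_seq1.
    by rewrite (linear_scale _ _ (lth _)).
  have fstS : (\sum_(i < n) a i *: p i).1 = \sum_(i < n) a i *: (p i).1.
    by elim/big_rec2 : _ => // i u v _ <-.
  have sndS : (\sum_(i < n) a i *: p i).2 = \sum_(i < n) a i *: (p i).2.
    by elim/big_rec2 : _ => // i u v _ <-.
  split => //.
    rewrite (gen _ iota)//; have := congr1 fst xyE; rewrite fstS => /= ->.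
    by apply: eq_bigr => i _; rewrite hk.
  rewrite (gen _ (fun i x => iota' i (c i x))); last first.
    by move=> i b u v; rewrite lc li'.
  by have := congr1 snd xyE; rewrite sndS => /= ->; apply: eq_bigr => i _; rewrite hk.
have [||||T [lT bT TG]] := @bounded_extension R K K' Gm M M0.
- exact: lin_span0.
- by move=> b p q; exact: lin_spanP.
- move=> x y /rep[s [xi [us -> ->]]].
  rewrite -(@ler_pXn2r _ 2)// ?nnegrE ?mulr_ge0 ?nr_ge0// exprMn.
  rewrite (block_nr (fun i => c i (xi i)) us iP') (block_nr xi us iP) mulr_sumr.
  apply: ler_sum => i _; rewrite [X in _ <= X]mulrCA ler_wpM2l// -exprMn lerXn2r ?nnegrE ?mulr_ge0 ?nr_ge0//.
  exact: cM.
- rewrite -subTset => x _; have : closure (lin_span [set iota p.1 p.2 | p in [set: I * X]]) x.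
    by rewrite itot.
  apply: closureS; apply: lin_span_ind => /=.
  + by exists 0; exact: lin_span0.
  + move=> b u v [u' hu] [v' hv]; exists (b *: u' + v').
    exact: (lin_spanP b hu hv).
  + move=> _ [p _ <-]; exists (iota' p.1 (c p.1 p.2)).
    by apply: lin_span_sub; exists p.
exists T; split => // i x; apply: TG; apply: lin_span_sub.
by exists (i, x).
Qed.

End Block.

(** * Dirac operators on tensor products *)

Lemma opnorm_bound (R : realType) (H : hilbertType R) (T : H -> H) :
  bounded_operator T -> nbounded T (opnorm T).
Proof.
move=> [lT [M0 bM]] x; pose S := [set M : R | 0 <= M /\ forall x, `|T x| <= M%:C%C * `|x|].
have S0 : S `|M0|.
  split => // y; apply: le_trans (bM y) _; rewrite !nrE -!rmorphM lecR.
  by rewrite ler_wpM2r ?nr_ge0// ler_norm.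
have [x0|x0] := eqVneq (nr x) 0.
  by rewrite (nr_eq0 x0) (linear_0 lT) nr0 mulr0.
have xp : 0 < nr x by rewrite lt_neqAle eq_sym x0 nr_ge0.
rewrite -ler_pdivrMr//; apply: lb_le_inf; first by exists `|M0|.
move=> M [_ hM]; rewrite ler_pdivrMr//.
by have := hM x; rewrite !nrE -rmorphM lecR.
Qed.

Lemma opnorm_le (R : realType) (H : hilbertType R) (T : H -> H) (M : R) : 0 <= M ->
  nbounded T M -> opnorm T <= M.
Proof.
move=> M0 bT; apply: ge_inf; first by exists 0 => y [].
by split => // x; rewrite !nrE -rmorphM lecR.
Qed.

Lemma opnorm_ge0 (R : realType) (H : hilbertType R) (T : H -> H) :
  bounded_operator T -> 0 <= opnorm T.
Proof.
move=> [lT [M0 bM]]; apply: lb_le_inf; last by move=> M [].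
exists `|M0|; split => // y; apply: le_trans (bM y) _; rewrite !nrE -!rmorphM lecR.
by rewrite ler_wpM2r ?nr_ge0// ler_norm.
Qed.

Lemma separable_onb (R : realType) (H : hilbertType R) : separable_space H ->
  exists e : nat -> H, osys e /\ complete_sys e.
Proof.
move=> sH; have [||||e [eo ce _]] := @onb_of_cone R H setT sH => //; last by exists e.
by move=> x h; apply: inner_eq0; exact: h.
Qed.

Lemma nr_cvg_bounded (R : realType) (E F : normedModType R[i]) (T : E -> F) (M : R) (u : nat -> E) x :
  linear T -> nbounded T M -> nr_cvg u x -> nr_cvg (T \o u) (T x).
Proof.
move=> lT bT ux eps e0; have m0 : 0 < `|M| + 1 by rewrite ltr_wpDl.
have [N hN] := ux _ (divr_gt0 e0 m0); exists N => n /hN /=.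
rewrite ltr_pdivlMr// mulrC -(linear_sub _ _ lT) => h; apply: le_lt_trans (bT _) (le_lt_trans _ h).
by rewrite ler_wpM2r ?nr_ge0// (le_trans (ler_norm _))// lerDl.
Qed.

Lemma realCM (R : realType) (a b : R) : (a * b)%:C%C = a%:C%C * b%:C%C.
Proof. exact: rmorphM. Qed.

Lemma realCMn (R : realType) (n : nat) (a : R) : (n%:R * a)%:C%C = n%:R * a%:C%C.
Proof. by rewrite realCM rmorph_nat. Qed.

Lemma tensor_nr (R : realType) (H1 H2 W : hilbertType R) (t : H1 -> H2 -> W) x y :
  hilbert_tensor t -> nr (t x y) = nr x * nr y.
Proof.
move=> ht; apply/eqP; rewrite -(@eqrXn2 _ 2)// ?mulr_ge0 ?nr_ge0//; apply/eqP/complexI.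
by rewrite -inner_nr (tensor_inner ht) !inner_nr exprMn [RHS]realCM.
Qed.

(** The elementary tensors xi (x) delta_g (x) v of the triple product, freed from the intermediate
    spaces L and W. *)
Record tensor3 (R : realType) (G : groupType) (H V K : hilbertType R) (e : H -> G -> V -> K) : Prop := {
  tensor3l : forall g v, linear (fun xi => e xi g v);
  tensor3r : forall xi g, linear (e xi g);
  tensor3_inner : forall xi g v xi' g' v',
    inner (e xi g v) (e xi' g' v') = (g == g')%:R * (inner xi xi' * inner v v');
  tensor3_total : total_set [set e p.1.1 p.1.2 p.2 | p in [set: H * G * V]]
}.

Lemma tensor3_of_tensors (R : realType) (G : groupType) (H V L W K : hilbertType R)
    (delta : G -> L) (t : H -> L -> W) (t' : W -> V -> K) :
  ell2 delta -> hilbert_tensor t -> hilbert_tensor t' ->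
  tensor3 (fun xi g v => t' (t xi (delta g)) v).
Proof.
move=> hd ht ht'; split.
- by move=> g v c x y /=; rewrite (tensor_linearl ht) (tensor_linearl ht').
- by move=> xi g; exact: (tensor_linearr ht').
- move=> xi g v xi' g' v'; rewrite (tensor_inner ht') (tensor_inner ht) (ell2_inner hd).
  by ring.
- set S' := (X in total_set X).
  apply: (total_trans (tensor_total ht')) => _ [w _ [v _ <-]].
  have cs := closed_subspace_span S'.
  apply: (@total_transfer _ _ _ (fun w => t' w v) (nr v) [set t x y | x in setT & y in setT]) => //.
  + exact: (tensor_linearl ht').
  + by move=> z; rewrite (tensor_nr _ _ ht') mulrC.
  + exact: (tensor_total ht).
  + move=> _ [x _ [y _ <-]].
    apply: (@total_transfer _ _ _ (fun y => t' (t x y) v) (nr x * nr v) (range delta)) => //.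
    * by move=> c a b /=; rewrite (tensor_linearr ht) (tensor_linearl ht').
    * by move=> z; rewrite (tensor_nr _ _ ht') (tensor_nr _ _ ht) mulrAC.
    * exact: (ell2_total hd).
    * move=> _ [g _ <-]; apply/subset_closure/lin_span_sub.
      by exists (x, g, v).
Qed.

Section Tensor3.
Variables (R : realType) (G : groupType) (H V K : hilbertType R) (e : H -> G -> V -> K).
Hypothesis he : tensor3 e.

Lemma tensor3_nr xi g v : nr (e xi g v) = nr xi * nr v.
Proof.
apply/eqP; rewrite -(@eqrXn2 _ 2)// ?mulr_ge0 ?nr_ge0//; apply/eqP/complexI.
by rewrite -inner_nr (tensor3_inner he) eqxx mul1r !inner_nr exprMn [RHS]realCM.
Qed.

Lemma tensor3_nbl g v : nbounded (fun xi => e xi g v) (nr v).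
Proof. by move=> xi; rewrite tensor3_nr mulrC. Qed.

Lemma tensor3_nbr xi g : nbounded (e xi g) (nr xi).
Proof. by move=> v; rewrite tensor3_nr. Qed.

(** Q may vary with g because the eigenbasis of [l g] does. *)
Lemma tensor3_subtotal (S : set H) (Q : G -> set V) : total_set S -> (forall g, total_set (Q g)) ->
  total_set [set z | exists xi g v, [/\ S xi, Q g v & z = e xi g v]].
Proof.
move=> tS tQ; set S' := (X in total_set X).
have cs := closed_subspace_span S'.
apply: (total_trans (tensor3_total he)) => _ [[[xi g] v] _ <-] /=.
apply: (total_transfer (tensor3r he xi g) (tensor3_nbr xi g) (tQ g) cs) => {}v Qv.
apply: (total_transfer (tensor3l he g v) (tensor3_nbl g v) tS cs) => {}xi Sxi.
by apply/subset_closure/lin_span_sub; exists xi, g, v.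
Qed.

Lemma tensor3_ext (T T' : K -> K) (M M' : R) : linear T -> nbounded T M -> linear T' -> nbounded T' M' ->
  (forall xi g v, T (e xi g v) = T' (e xi g v)) -> forall x, T x = T' x.
Proof.
move=> lT bT lT' bT' h; apply: (total_ext lT bT lT' bT' (tensor3_total he)).
by move=> _ [[[xi g] v] _ <-] /=.
Qed.

Variables (d : nat) (v : 'I_d -> V).
Hypotheses (vb : fonb v) (sH : separable_space H).

(** The blocks are copies of H indexed by G and a basis of V; left translation by x permutes
    them. *)
Lemma tensor3_blockl (c : G -> H -> H) (M : R) (x : G) : 0 <= M -> (forall y, linear (c y)) ->
  (forall y, nbounded (c y) M) ->
  exists T : K -> K, [/\ linear T, nbounded T M &
    forall xi y z, T (e xi y z) = e (c y xi) (x * y)%g z].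
Proof.
move=> M0 lc bc.
pose iota (p : G * 'I_d) xi := e xi p.1 (v p.2).
pose iota' (p : G * 'I_d) xi := e xi (x * p.1)%g (v p.2).
have [|||||||||T [lT bT hT]] := @block_operator R H H K K (G * 'I_d)%type iota iota'
  (fun p => c p.1) (fun=> 1) M.
- by move=> p; exact: tensor3l.
- by move=> p; exact: (tensor3l he).
- by move=> p; exact: lc.
- by [].
- move=> [g i] [g' j] a b; rewrite /iota (tensor3_inner he)/= vb.1 mulr1.
  by rewrite -pair_eqE /pair_eq/= -mulnb natrM rmorphM !rmorph_nat; ring.
- move=> [g i] [g' j] a b; rewrite /iota' (tensor3_inner he)/= vb.1 mulr1.
  rewrite -pair_eqE /pair_eq/= -mulnb natrM rmorphM !rmorph_nat.
  rewrite (inj_eq (mulgI x)); ring.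
- by move=> p; exact: ler01.
- by move=> p; exact: bc.
- have tH : total_set [set: H].
    by rewrite /total_set -subTset => z _; apply/subset_closure/lin_span_sub.
  rewrite (_ : [set iota p.1 p.2 | p in setT] =
    [set z | exists xi g w, [/\ [set: H] xi, range v w & z = e xi g w]]).
    by apply: tensor3_subtotal => // g; exact: fonb_total.
  apply/seteqP; split => [_ [[[g i] xi] _ <-]|_ [xi [g [_ [_ [i _ <-] ->]]]]].
    by exists xi, g, (v i).
  by exists ((g, i), xi).
exists T; split => // xi y z.
rewrite (fonb_expand z vb) (linear_bigsum _ _ _ (tensor3r he xi y)) (linear_bigsum _ _ _ lT).
rewrite (linear_bigsum _ _ _ (tensor3r he (c y xi) (x * y)%g)); apply: eq_bigr => i _.
rewrite (linear_scale _ _ (tensor3r he _ _)) (linear_scale _ _ (tensor3r he _ _)).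
by rewrite (linear_scale _ _ lT); congr (_ *: _); exact: (hT (y, i) xi).
Qed.

(** Here the blocks are copies of V, indexed by G and an orthonormal system of H. The formula is
    first known for xi in that system and extends to all xi by density. *)
Lemma tensor3_blockr (m : G -> V -> V) (M : R) : 0 <= M -> (forall y, linear (m y)) ->
  (forall y, nbounded (m y) M) ->
  exists T : K -> K, [/\ linear T, nbounded T M &
    forall xi y z, T (e xi y z) = e xi y (m y z)].
Proof.
move=> M0 lm bm; have [b [bo bc]] := separable_onb sH.
pose iota (p : nat * G) z := e (b p.1) p.2 z.
have iP (p q : nat * G) (z z' : V) : inner (iota p z) (iota q z') =
    ((p == q)%:R * nr (b p.1) ^+ 2)%:C%C * inner z z'.
  case: p q => [i g] [j g']; rewrite /iota (tensor3_inner he)/=.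
  rewrite realCMn -inner_nr -pair_eqE /pair_eq/= -mulnb natrM.
  by have [->|ij] := eqVneq i j; [rewrite !mul1r; ring|rewrite bo.1//= mulr0n; ring].
have tb : total_set (range b) by exact: complete_total.
have tV : total_set [set: V].
  by rewrite /total_set -subTset => z _; apply/subset_closure/lin_span_sub.
have [|||||||||T [lT bT hT]] := @block_operator R V V K K (nat * G)%type iota iota
  (fun p => m p.2) (fun p => nr (b p.1) ^+ 2) M.
- by move=> p; exact: (tensor3r he).
- by move=> p; exact: (tensor3r he).
- by move=> p; exact: lm.
- by [].
- exact: iP.
- exact: iP.
- by move=> p; exact: sqr_ge0.
- by move=> p; exact: bm.
- rewrite (_ : [set iota p.1 p.2 | p in setT] =
    [set z | exists xi g w, [/\ range b xi, [set: V] w & z = e xi g w]]).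
    exact: tensor3_subtotal.
  apply/seteqP; split => [_ [[[i g] w] _ <-]|_ [_ [g [w [[i _ <-] _ ->]]]]].
    by exists (b i), g, w; split => //; exists i.
  by exists ((i, g), w).
exists T; split => // xi y z.
apply: (@total_ext _ _ _ (fun xi => T (e xi y z)) (fun xi => e xi y (m y z)) (M * nr z) (nr (m y z)) (range b)) => //.
- by move=> c p q /=; rewrite (tensor3l he) lT.
- move=> p; apply: le_trans (bT _) _; by rewrite tensor3_nr [nr p * _]mulrC mulrA.
- exact: (tensor3l he).
- exact: tensor3_nbl.
- by move=> _ [i _ <-]; exact: (hT (i, y) z).
Qed.

End Tensor3.

Section Spin.
Variables (R : realType) (G : groupType) (H V K : hilbertType R) (e : H -> G -> V -> K).
Variables (l : G -> V -> V) (D : set (H * H)).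
Hypotheses (he : tensor3 e) (ll : forall g, linear (l g)).

(* Scalars theta = c give dirac_entry c, and theta = chi gives the matrix of even_to_odd. *)
Definition spin (theta : H -> H) : set (K * K) :=
  lin_span [set p | exists xi eta g v, D (xi, eta) /\
    p = (e xi g v, e eta g v + e (theta xi) g (l g v))].

Lemma dirac_entry_spin c : dirac_entry e l D c = spin (fun xi => c *: xi).
Proof.
rewrite /dirac_entry /spin; congr lin_span; apply/seteqP.
split=> [_ [xi [eta [g [v [Dx ->]]]]]|_ [xi [eta [g [v [Dx ->]]]]]]; exists xi, eta, g, v.
  by rewrite (linear_scale _ _ (tensor3l he _ _)).
by rewrite (linear_scale _ _ (tensor3l he _ _)).
Qed.

Lemma spin_gen theta xi eta g v : D (xi, eta) ->
  spin theta (e xi g v, e eta g v + e (theta xi) g (l g v)).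
Proof. by move=> Dx; apply: lin_span_sub; exists xi, eta, g, v. Qed.

Lemma spin0 theta : spin theta (0, 0).
Proof. exact: lin_span0. Qed.

Lemma spin_lin theta c p q : spin theta p -> spin theta q -> spin theta (c *: p + q).
Proof. exact: lin_spanP. Qed.

(** A pair of adjoint parameters is allowed because the off-diagonal entries of the odd to even
    operator, with theta = i and theta = -i, are adjoint to each other and not symmetric. *)
Lemma spin_sym theta theta' x y x' y' :
  (forall xi eta xi' eta', D (xi, eta) -> D (xi', eta') -> inner eta xi' = inner xi eta') ->
  (forall xi xi', inner (theta xi) xi' = inner xi (theta' xi')) ->
  (forall g v w, inner (l g v) w = inner v (l g w)) ->
  spin theta (x, y) -> spin theta' (x', y') -> inner y x' = inner x y'.
Proof.
move=> Dsym tsym lsym.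
have key : spin theta `<=` [set p | forall q, spin theta' q -> inner p.2 q.1 = inner p.1 q.2].
  apply: lin_span_ind => /=.
  - by move=> q _; rewrite !inner0l.
  - by move=> c p q hp hq r sr; rewrite !innerDl !innerZl hp// hq.
  move=> _ [xi [eta [g [v [Dx ->]]]]] q /= sq.
  have : spin theta' `<=` [set q | inner (e eta g v + e (theta xi) g (l g v)) q.1 = inner (e xi g v) q.2].
    apply: lin_span_ind => /=.
    - by rewrite !inner0r.
    - by move=> c p r hp hr; rewrite !innerDr !innerZr hp hr.
    move=> _ [xi' [eta' [g' [v' [Dx' ->]]]]] /=.
    rewrite innerDl innerDr !(tensor3_inner he) (Dsym _ _ _ _ Dx Dx') tsym.
    by have [->|gg] := eqVneq g g'; [rewrite lsym|rewrite !mul0r].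
  exact.
by move=> sp sq; exact: (key _ sp _ sq).
Qed.

Section Commutator.
Variables (d : nat) (v0 : 'I_d -> V) (x : G) (c C : G -> H -> H) (M1 M2 M3 : R) (theta : H -> H).
Hypotheses (vb : fonb v0) (sH : separable_space H).
Hypotheses (lc : forall y, linear (c y)) (bc : forall y, nbounded (c y) M1).
Hypotheses (lC : forall y, linear (C y)) (bC : forall y, nbounded (C y) M2).
Hypotheses (lt : linear theta) (bt : nbounded theta 1).
Hypothesis ct : forall y xi, c y (theta xi) = theta (c y xi).
Hypothesis bl : forall y, nbounded (fun v => l (x * y)%g v - l y v) M3.
Hypothesis DC : forall y xi eta, D (xi, eta) -> D (c y xi, c y eta + C y xi).
Hypotheses (M10 : 0 <= M1) (M20 : 0 <= M2) (M30 : 0 <= M3).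

(** [E1] carries the commutators [C y] of D with the entries, [E2] the differences l(xy) - l(y), and
    [E3] applies theta and the entry [c y] to the latter; the bounds are uniform in y, hence M2 + M1
    M3. As theta commutes with the entries, no further term arises. *)
Lemma spin_commutator (P : K -> K) : linear P ->
  (forall xi y v, P (e xi y v) = e (c y xi) (x * y)%g v) ->
  exists (E : K -> K) (M : R), [/\ linear E, nbounded E M &
    forall p q, spin theta (p, q) -> spin theta (P p, P q + E p)].
Proof.
move=> lP hP.
have [E1 [lE1 bE1 hE1]] := tensor3_blockl he vb x M20 lC bC.
have lm y : linear (fun v => l (x * y)%g v - l y v).
  by move=> a u w /=; rewrite !ll scalerBr opprD addrACA.
have [E2 [lE2 bE2 hE2]] := tensor3_blockr he sH M30 lm bl.
have lct y : linear (fun xi => theta (c y xi)) by move=> a u w /=; rewrite lc lt.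
have bct y : nbounded (fun xi => theta (c y xi)) M1.
  by move=> xi; apply: le_trans (bt _) _; rewrite mul1r; exact: bc.
have [E3 [lE3 bE3 hE3]] := tensor3_blockl he vb x M10 lct bct.
exists (fun z => E1 z + E3 (E2 z)), (M2 + M1 * M3); split.
- by move=> a u w; rewrite lE1 lE2 lE3 scalerDr addrACA.
- move=> z; apply: le_trans (nrD _ _) _; rewrite mulrDl lerD//.
  by apply: le_trans (bE3 _) _; rewrite -mulrA ler_wpM2l.
move=> p q sp.
have : spin theta `<=` [set r | spin theta (P r.1, P r.2 + (E1 r.1 + E3 (E2 r.1)))].
  apply: lin_span_ind => /=.
  - by rewrite (linear_0 lP) (linear_0 lE2) (linear_0 lE1) (linear_0 lE3) !addr0; exact: spin0.
  - move=> a [p1 p2] [q1 q2] /= h h'; have := spin_lin a h h'.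
    congr (spin _ (_, _)) => /=; first by rewrite lP.
    rewrite lP lE1 lE2 lE3 [in LHS]scalerDr addrACA; congr (_ + _).
    by rewrite [in LHS]scalerDr addrACA.
  move=> _ [xi [eta [g [v [Dx ->]]]]] /=.
  have := spin_gen theta (x * g)%g v (DC g Dx).
  congr (spin _ (_, _)); first by rewrite hP.
  rewrite (linear_add _ _ lP) !hP hE1 hE2 hE3 ct.
  rewrite (linear_add _ _ (tensor3l he _ _)) (linear_sub _ _ (tensor3r he _ _)).
  rewrite -!addrA; congr (_ + _); rewrite [RHS]addrCA; congr (_ + _).
  by rewrite addrC subrK.
by move=> /(_ _ sp).
Qed.

End Commutator.
End Spin.

(** * The crossed product *)

Lemma adjoint_ext (R : realType) (K : hilbertType R) (T T' : K -> K) (M M' : R) (S : set K) :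
  linear T -> nbounded T M -> linear T' -> nbounded T' M' -> total_set S ->
  (forall x y, S x -> S y -> inner (T x) y = inner x (T' y)) ->
  forall x y, inner (T x) y = inner x (T' y).
Proof.
move=> lT bT lT' bT' tS h.
have cs (z : K) : nbounded (fun x => inner x z : R[i]^o) (nr z).
  by move=> x; rewrite mulrC; exact: cauchy_schwarz.
have lin (z : K) : linear (fun x => inner x z : R[i]^o).
  by move=> c p q /=; rewrite innerDl innerZl.
have linT (z : K) (P : K -> K) : linear P -> linear (fun x => inner (P x) z : R[i]^o).
  by move=> lP c p q /=; rewrite lP innerDl innerZl.
have csT (z : K) (P : K -> K) N : nbounded P N -> nbounded (fun x => inner (P x) z : R[i]^o) (nr z * N).
  move=> bP x; apply: le_trans (cs z _) _; rewrite -mulrA ler_wpM2l ?nr_ge0//.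
have h1 x y : S y -> inner (T x) y = inner x (T' y).
  move=> Sy; apply: (total_ext (linT y T lT) (csT y T _ bT) (lin (T' y)) (cs (T' y)) tS) => z Sz.
  exact: h.
move=> x y; rewrite [LHS]inner_conj [RHS]inner_conj; congr conjc.
apply: (total_ext (lin (T x)) (cs (T x)) (linT x T' lT') (csT x T' _ bT') tS) => z Sz.
by rewrite [LHS]inner_conj h1// -inner_conj.
Qed.

Section Automorphisms.
Variables (R : realType) (A : cstarType R).

Lemma automorphism_one (f : A -> A) : star_automorphism f -> f cone = cone.
Proof.
move=> [[g gf fg] _ fM _]; have fg1 b : f cone ** b = b by rewrite -{1}(fg b) -fM cmul1x fg.
by rewrite -[LHS]cmulx1 fg1.
Qed.

Lemma nr_cone : nr (cone : A) = 1.
Proof.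
have h : nr (cone : A) = nr (cone : A) ^+ 2 by rewrite -nr_cstar star1 cmul1x.
have n0 : nr (cone : A) != 0 by apply/eqP => /nr_eq0/eqP; apply/negP; exact: cone_neq0.
by apply: (mulIf n0); rewrite mul1r -expr2 -h.
Qed.

Lemma nr_unitary (s : A) : unitary s -> nr s = 1.
Proof.
move=> [ss _]; apply/eqP; rewrite -(@eqrXn2 _ 2)// ?nr_ge0// -nr_cstar ss nr_cone expr1n.
exact: eqxx.
Qed.

Lemma rep_automorphism (H : hilbertType R) (pi : A -> H -> H) (f : A -> A) :
  representation pi -> star_automorphism f -> representation (fun a => pi (f a)).
Proof.
move=> rp fa; have [_ lf fM fs] := fa; split.
- by move=> a; exact: (representation_bounded rp).
- by move=> a b x; rewrite (linear_add _ _ lf) (representationD rp).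
- by move=> k a x; rewrite (linear_scale _ _ lf) (representationZ rp).
- by move=> a b x; rewrite fM (representationM rp).
- by move=> x; rewrite (automorphism_one fa) (representation1 rp).
- by move=> a x y; rewrite fs (representation_star rp).
Qed.

End Automorphisms.

Section Amplification.
Variables (R : realType) (V W K : hilbertType R) (t' : W -> V -> K) (d : nat) (v : 'I_d -> V).
Hypotheses (ht' : hilbert_tensor t') (vb : fonb v).

Lemma amplification (T : W -> W) (M : R) : 0 <= M -> linear T -> nbounded T M ->
  exists P : K -> K, [/\ linear P, nbounded P M & forall w z, P (t' w z) = t' (T w) z].
Proof.
move=> M0 lT bT; pose iota (k : 'I_d) w := t' w (v k).
have iP (i k : 'I_d) (x y : W) : inner (iota i x) (iota k y) = ((i == k)%:R * 1)%:C%C * inner x y.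
  by rewrite /iota (tensor_inner ht') vb.1 mulr1 rmorph_nat mulrC.
have [||||||P [lP bP hP]] := @block_operator R W W K K 'I_d iota iota (fun=> T) (fun=> 1) M _ _ _ M0 iP iP.
- by move=> k; exact: (tensor_linearl ht').
- by move=> k; exact: (tensor_linearl ht').
- by [].
- by move=> _; exact: ler01.
- by [].
- have tV := fonb_total vb; set S' := (X in total_set X).
  apply: (total_trans (tensor_total ht')) => _ [w _ [z _ <-]].
  apply: (total_transfer (tensor_linearr ht' w) _ tV (closed_subspace_span S')) => [z'|_ [k _ <-]].
    by rewrite (tensor_nr _ _ ht').
  by apply/subset_closure/lin_span_sub; exists (k, w).
exists P; split => // w z; rewrite (fonb_expand z vb).
rewrite (linear_bigsum _ _ _ (tensor_linearr ht' w)) (linear_bigsum _ _ _ lP).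
rewrite (linear_bigsum _ _ _ (tensor_linearr ht' (T w))); apply: eq_bigr => k _.
rewrite (linear_scale _ _ (tensor_linearr ht' _)) (linear_scale _ _ (tensor_linearr ht' _)).
by rewrite (linear_scale _ _ lP); congr (_ *: _); exact: hP.
Qed.

(** The bound [nr b] for the amplified operators comes from the contractivity of j; every algebraic
    identity then holds because it holds on elementary tensors. *)
Lemma amplify_representation (B : cstarType R) (j : B -> W -> W) : representation j ->
  exists Pi : B -> K -> K, representation Pi /\ forall b w z, Pi b (t' w z) = t' (j b w) z.
Proof.
move=> rj.
have /choice[Pi hPi] : forall b, exists P : K -> K,
    [/\ linear P, nbounded P (nr b) & forall w z, P (t' w z) = t' (j b w) z].
  by move=> b; apply: amplification; [exact: nr_ge0|exact: rep_linear|exact: rep_contractive].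
have lP b : linear (Pi b) by case: (hPi b).
have bP b : nbounded (Pi b) (nr b) by case: (hPi b).
have PE b w z : Pi b (t' w z) = t' (j b w) z by case: (hPi b).
have tt := tensor_total ht'.
exists Pi; split => //; split.
- by move=> b; exact/(nbounded_operator (lP b))/bP.
- move=> a b; apply: (total_ext (lP _) (bP _) (M' := nr a + nr b) _ _ tt).
  + by move=> c x y /=; rewrite !lP scalerDr addrACA.
  + by move=> x; rewrite mulrDl (le_trans (nrD _ _))// lerD ?bP.
  + by move=> _ [w _ [z _ <-]]; rewrite !PE (representationD rj) (linear_add _ _ (tensor_linearl ht' _)).
- move=> k a; apply: (total_ext (lP _) (bP _) (M' := cab k * nr a) _ _ tt).
  + by move=> c x y /=; rewrite lP scalerDr !scalerA [c * k]mulrC.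
  + by move=> x; rewrite nrZ -/(cab k) -mulrA ler_wpM2l ?cab_ge0 ?bP.
  + by move=> _ [w _ [z _ <-]]; rewrite !PE (representationZ rj) (linear_scale _ _ (tensor_linearl ht' _)).
- move=> a b; apply: (total_ext (lP _) (bP _) (M' := nr a * nr b) _ _ tt).
  + by move=> c x y /=; rewrite !lP.
  + by move=> x; apply: le_trans (bP _ _) _; rewrite -mulrA ler_wpM2l ?nr_ge0 ?bP.
  + by move=> _ [w _ [z _ <-]]; rewrite !PE (representationM rj).
- apply: (total_ext (lP _) (bP _) (M' := 1) _ _ tt) => //.
  + by move=> x; rewrite mul1r.
  + by move=> _ [w _ [z _ <-]]; rewrite !PE (representation1 rj).
- move=> a; apply: (adjoint_ext (lP _) (bP _) (lP _) (bP _) tt).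
  move=> _ _ [w _ [z _ <-]] [w' _ [z' _ <-]].
  by rewrite !PE !(tensor_inner ht') (representation_star rj).
Qed.

(** A fixed nonzero z in V recovers [j b] from [Pi b] on the tensors [t' w z] without loss of norm,
    and the norm of B is the operator norm of [j b]. *)
Lemma amplification_bound (B : cstarType R) (j : B -> W -> W) (Pi : B -> K -> K) :
  (exists z : V, z <> 0) -> representation j -> (forall b, `|b| = (opnorm (j b))%:C%C) ->
  (forall b w z, Pi b (t' w z) = t' (j b w) z) ->
  forall b M, 0 <= M -> nbounded (Pi b) M -> nr b <= M.
Proof.
move=> [z z0] rj jb PE b M M0 bP.
have -> : nr b = opnorm (j b) by apply: complexI; rewrite -nrE jb.
apply: opnorm_le => // w.
have zp : 0 < nr z by rewrite lt_neqAle nr_ge0 andbT eq_sym; apply/eqP => /nr_eq0.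
by rewrite -(ler_pM2r zp) -(tensor_nr _ _ ht') -PE -mulrA -(tensor_nr _ _ ht').
Qed.

End Amplification.

Section CrossedProduct.
Variables (R : realType) (A : cstarType R) (G : groupType) (H V K : hilbertType R).
Variables (rho : G -> A -> A) (sigma : G -> G -> A) (pi : A -> H -> H).
Variables (e : H -> G -> V -> K) (B : cstarType R) (Pi : B -> K -> K) (u : A -> G -> B).
Variables (d : nat) (v : 'I_d -> V).
Hypotheses (tp : twisting_pair rho sigma) (rp : representation pi).
Hypotheses (he : tensor3 e) (vb : fonb v) (rPi : representation Pi).
Hypothesis PiE : forall a x xi y z,
  Pi (u a x) (e xi y z) = e (induced_entry rho sigma pi x y a xi) (x * y)%g z.
Hypothesis Pib : forall b M, 0 <= M -> nbounded (Pi b) M -> nr b <= M.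
Hypothesis udense : closure (Cc u setT) = [set: B].

Local Notation entry := (induced_entry rho sigma pi).

Lemma entry_linear x y a : linear (entry x y a).
Proof. exact: (rep_linear _ rp). Qed.

Lemma rho_linear x : linear (rho x).
Proof. by case: (twisting_automorphism tp x). Qed.

Lemma entry_linearl x y k a b xi : entry x y (k *: a + b) xi = k *: entry x y a xi + entry x y b xi.
Proof.
by rewrite /induced_entry rho_linear cmulDl cmulZl (representationD rp) (representationZ rp).
Qed.

Lemma entry_bound x y a : nbounded (entry x y a) (nr a).
Proof.
move=> xi; rewrite /induced_entry (representationM rp).
apply: le_trans (rep_contractive a (rep_automorphism rp (twisting_automorphism tp _)) _) _.
rewrite ler_wpM2l ?nr_ge0//; apply: le_trans (rep_contractive _ rp _) _.
by rewrite (nr_unitary (twisting_unitary tp _ _)) mul1r.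
Qed.

Lemma Pi_linear b : linear (Pi b).
Proof. exact: rep_linear. Qed.

(** The structure of B is visible only through Pi. Testing on elementary tensors is how the
    linearity of u, the convolution product and the involution are obtained. *)
Lemma Pi_ext b b' : (forall xi y z, Pi b (e xi y z) = Pi b' (e xi y z)) -> b = b'.
Proof.
move=> h; apply/eqP; rewrite -subr_eq0; apply/eqP/nr_eq0/eqP; rewrite eq_le nr_ge0 andbT.
apply: Pib => // x; rewrite (representationD rPi) -scaleN1r (representationZ rPi) scaleN1r.
rewrite (tensor3_ext he (Pi_linear b) (rep_contractive b rPi) (Pi_linear b') (rep_contractive b' rPi) h).
by rewrite subrr nr0 mul0r.
Qed.

Lemma u_linear x : linear (u^~ x).
Proof.
move=> k a b; apply: Pi_ext => xi y z /=.
rewrite (representationD rPi) (representationZ rPi) !PiE entry_linearl.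
by rewrite (tensor3l he).
Qed.

Lemma u0 x : u 0 x = 0.
Proof. exact: (linear_0 (u_linear x)). Qed.

Lemma nr_u a x : nr (u a x) <= nr a.
Proof.
have [T [lT bT hT]] := tensor3_blockl he vb x (nr_ge0 a) (fun y => entry_linear x y a)
  (fun y => entry_bound x y a).
apply: Pib (nr_ge0 a) _ => p.
rewrite (tensor3_ext he (Pi_linear _) (rep_contractive _ rPi) lT bT) // => xi y z.
by rewrite PiE hT.
Qed.

Lemma u_one : u cone 1%g = cone.
Proof.
apply: Pi_ext => xi y z; rewrite PiE (representation1 rPi) mul1g /induced_entry.
rewrite (automorphism_one (twisting_automorphism tp _)) (twisting_1r tp) cmul1x.
by rewrite (representation1 rp).
Qed.

Lemma unitary_mul s a : unitary (s : A) -> a ** star s ** s = a.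
Proof. by move=> [ss _]; rewrite -cmulA ss cmulx1. Qed.

Lemma u_mul a x b y : u a x ** u b y = u (a ** rho x b ** sigma x y) (x * y)%g.
Proof.
apply: Pi_ext => xi z w; rewrite (representationM rPi) !PiE mulgA; congr (e _ _ _).
rewrite /induced_entry -(representationM rp).
have -> : ((x * y)^-1 = y^-1 * x^-1)%g by rewrite invgM.
rewrite invgM mulgA; set g := (z^-1 * y^-1 * x^-1)%g.
have gx : (z^-1 * y^-1 = g * x)%g by rewrite /g mulgVK.
have [_ _ rM _] := twisting_automorphism tp g.
(* With g = (x y z)^-1, both sides are products of rho_g(a), a conjugate of rho_gx(b) and values of
   sigma; the twisted action and the cocycle identity bring them to the same form. *)
rewrite gx !rM (twisting_action tp) (twisting_cocycle tp).
have su p q := unitary_mul _ (twisting_unitary tp p q).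
congr (pi _ xi); rewrite !cmulA.
by rewrite su su.
Qed.

Lemma u_star a x : star (u a x) = u (star (sigma x^-1%g x) ** rho x^-1%g (star a)) x^-1%g.
Proof.
set a' := star _ ** _.
have adj p q : inner (Pi (u a' x^-1%g) p) q = inner p (Pi (u a x) q).
  move: p q; apply: (adjoint_ext (Pi_linear _) (rep_contractive _ rPi) (Pi_linear _)
    (rep_contractive _ rPi) (tensor3_total he)) => _ _ [[[xi y] z] _ <-] [[[xi' y'] z'] _ <-] /=.
  rewrite !PiE !(tensor3_inner he).
  (* Both inner products vanish unless y = x y'. *)
  have [->|yy] := eqVneq y (x * y')%g; last first.
    rewrite (_ : (x^-1 * y == y')%g = false) ?mul0r//.
    by apply/negbTE; apply: contra_neq yy => <-; rewrite mulVKg.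
  rewrite mulKg eqxx !mul1r; congr (_ * _).
  rewrite -(representation_star rp); congr inner; congr (pi _ xi).
  have -> : ((x * y')^-1 * x^-1^-1 = y'^-1)%g by rewrite invgK invgM mulgVK.
  set h := y'^-1%g; rewrite starM.
  have [_ _ rM rS] := twisting_automorphism tp h.
  have [_ _ rM' rS'] := twisting_automorphism tp (h * x^-1)%g.
  rewrite -rS' /a' rM rS (twisting_action tp) (twisting_cocycle tp) mulVg (twisting_1r tp) star1 cmulx1.
  have su p q := unitary_mul _ (twisting_unitary tp p q).
  by rewrite starM !cmulA su su.
apply: Pi_ext => xi y z; apply: inner_ext => q.
by rewrite adj (representation_star rPi).
Qed.

(** Finitely supported functions become spans, on which induction and density arguments work; u
    kills the value 0, so supports may be enlarged freely. *)
Lemma Cc_span (S : set A) : S 0 -> (forall k a b, S a -> S b -> S (k *: a + b)) ->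
  Cc u S = lin_span [set b | exists a x, S a /\ b = u a x].
Proof.
move=> S0 SD; apply/seteqP; split.
  move=> _ [f [fin Sf ->]]; rewrite fsbig_finite//=.
  elim/big_rec : _ => [|x b _ ih]; first exact: lin_span0.
  by rewrite -[u _ _]scale1r; apply: lin_spanP => //; apply: lin_span_sub; exists (f x), x.
apply: lin_span_ind.
- exists (fun=> 0); split => //.
    by rewrite (_ : [set _ | _] = set0)//; apply/seteqP; split => x //=; rewrite eqxx.
  by rewrite fsbig1// => x; rewrite /= eqxx.
- move=> c _ _ [f [ff Sf ->]] [g [fg Sg ->]].
  exists (fun x => c *: f x + g x); pose F := [set x | f x != 0] `|` [set x | g x != 0].
  have fF : finite_set F by rewrite finite_setU.
  have sub h : [set x | h x != 0] `<=` F ->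
      \sum_(x \in [set x | h x != 0]) u (h x) x = \sum_(x \in F) u (h x) x.
    move=> hF; apply: fsbig_widen => // x [_ /=] /negP; rewrite negbK => /eqP ->.
    exact: u0.
  have cF : [set x | c *: f x + g x != 0] `<=` F.
    move=> x /= h; rewrite /F /=; have [f0|] := eqVneq (f x) 0; last by left.
    by right; move: h; rewrite f0 scaler0 add0r.
  split; first exact: sub_finite_set cF fF.
    by move=> x; exact: SD.
  rewrite !sub//; [|by move=> x; right|by move=> x; left].
  rewrite !fsbig_finite//= scaler_sumr -big_split/=; apply: eq_bigr => x _.
  by rewrite (u_linear x).
- move=> _ [a [x [Sa ->]]]; exists (fun y => if y == x then a else 0); split.
  + apply: (@sub_finite_set _ _ [set x]) => // y /=.
    by case: (y =P x) => // _ /eqP.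
  + by move=> y; case: ifP.
  + rewrite (@fsbig_widen _ _ _ _ _ [set x]); last 2 first.
    * by move=> y /=; case: (y =P x) => // _ /eqP.
    * by move=> y [_ /=] /negP; rewrite negbK => /eqP ->; exact: u0.
    by rewrite fsbig_set1 eqxx.
Qed.

Variables (A0 : set A).
Hypotheses (sA0 : star_subalgebra A0) (sm : smooth A0 rho sigma).

Lemma A0_rho x a : A0 a -> A0 (rho x a).
Proof. by move=> A0a; rewrite -(sm.1 x); exists a. Qed.

Lemma A0_lin k a b : A0 a -> A0 b -> A0 (k *: a + b).
Proof. by move=> ? ?; apply: (subalgebraD sA0) => //; exact: (subalgebraZ sA0). Qed.

Lemma A0_0 : A0 0.
Proof. by rewrite -(scale0r cone); apply: (subalgebraZ sA0); exact: (subalgebra1 sA0). Qed.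

Let gen := [set b | exists a x, A0 a /\ b = u a x].

Lemma Cc_A0 : Cc u A0 = lin_span gen.
Proof. by apply: Cc_span; [exact: A0_0|exact: A0_lin]. Qed.

(** Smoothness keeps the coefficients of products and adjoints of generators in A0. *)
Lemma Cc_star_subalgebra : star_subalgebra (Cc u A0).
Proof.
rewrite Cc_A0; split.
- by apply: lin_span_sub; exists cone, 1%g; split; [exact: (subalgebra1 sA0)|rewrite u_one].
- by move=> a b ga gb; rewrite -[a]scale1r; exact: lin_spanP.
- by move=> k a ga; rewrite -[_ *: _]addr0; apply: lin_spanP => //; exact: lin_span0.
- have key : lin_span gen `<=` [set a | forall b, lin_span gen b -> lin_span gen (a ** b)].
    apply: lin_span_ind => /=.
    + by move=> b _; rewrite cmul0x; exact: lin_span0.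
    + by move=> c a a' ha ha' b gb; rewrite cmulDl cmulZl; apply: lin_spanP; [exact: ha|exact: ha'].
    + move=> _ [a [x [A0a ->]]] /=; apply: lin_span_ind => /=.
      * by rewrite cmulx0; exact: lin_span0.
      * by move=> c b b' ? ?; rewrite cmulDr cmulZr; exact: lin_spanP.
      * move=> _ [b [y [A0b ->]]]; rewrite u_mul; apply: lin_span_sub.
        eexists; exists (x * y)%g; split; last by [].
        apply: (subalgebraM sA0); last exact: sm.2.
        by apply: (subalgebraM sA0) => //; exact: A0_rho.
  by move=> a b ga gb; exact: key.
- apply: lin_span_ind => /=.
  + by rewrite star0; exact: lin_span0.
  + by move=> c a b ha hb; rewrite starD starZ; exact: lin_spanP.
  + move=> _ [a [x [A0a ->]]]; rewrite /= u_star; apply: lin_span_sub.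
    eexists; exists (x^-1)%g; split; last by [].
    apply: (subalgebraM sA0); first by apply: (subalgebra_star sA0); exact: sm.2.
    by apply: A0_rho; exact: (subalgebra_star sA0).
Qed.

Lemma u_nbounded x : nbounded (u^~ x) 1.
Proof. by move=> a; rewrite mul1r; exact: nr_u. Qed.

(** For fixed x the map a -> a delta_x is a contraction, so the density of A0 in A carries over to
    each generator. *)
Lemma Cc_dense : dense A0 -> dense (Cc u A0).
Proof.
move=> /dense_closureP dA; apply/dense_closureP; rewrite Cc_A0.
have := udense; rewrite Cc_span// => tS; apply: (total_trans tS) => _ [a [x [_ ->]]].
apply: (@total_transfer _ _ _ (u^~ x) 1 A0) (closed_subspace_span gen) _ a => //.
- exact: u_linear.
- exact: u_nbounded.
- by rewrite -subTset -dA; apply: closure_subset; exact: lin_span_sub.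
- by move=> b A0b; apply/subset_closure/lin_span_sub; exists b, x.
Qed.

Lemma crossed_separable : separable_space A -> countable [set: G] -> separable_space B.
Proof.
move=> [S [cS /dense_closureP dS]] cG.
apply: (@separable_of_total _ _ [set u p.1 p.2 | p in S `*` [set: G]]).
  by apply: sub_countable (card_image_le _ _) _; exact: countableX.
have := udense; rewrite Cc_span// => tS; apply: (total_trans tS) => _ [a [x [_ ->]]].
set S' := [set _ | _ in _].
apply: (@total_transfer _ _ _ (u^~ x) 1 S) (closed_subspace_span S') _ a => //.
- exact: u_linear.
- exact: u_nbounded.
- by rewrite -subTset -dS; apply: closure_subset; exact: lin_span_sub.
- by move=> b Sb; apply/subset_closure/lin_span_sub; exists (b, x).
Qed.

End CrossedProduct.

(** * Spectral triples from a core *)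

(** The Hilbert norm lies between the maximum and the sum of the norms of the components. *)
Lemma nbhs_dsum (R : realType) (U V : hilbertType R) (x : dsum U V) (P : set (dsum U V)) :
  nbhs x P <-> @nbhs _ (U * V)%type x P.
Proof.
split=> [/nbhs_nrP[e e0 eP]|[[P1 P2] [/nbhs_nrP[e1 e10 eP1] /nbhs_nrP[e2 e20 eP2]] sP]].
  have e20 : 0 < e / 2 by rewrite divr_gt0.
  exists ([set y | nr (x.1 - y) < e / 2], [set y | nr (x.2 - y) < e / 2]).
    by split; apply/nbhs_nrP; exists (e / 2).
  move=> y [/= h1 h2]; apply: eP; rewrite [ltRHS]splitr.
  apply: le_lt_trans (ltrD h1 h2).
  by rewrite -lecR rmorphD /= -!nrE; exact: dsum_norm_le.
apply/nbhs_nrP; exists (Num.min e1 e2); first by rewrite lt_min e10.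
move=> y; rewrite lt_min => /andP[h1 h2]; apply: sP; split => /=.
  apply: eP1; apply: le_lt_trans h1; rewrite -lecR -!nrE.
  exact: (dsum_norm_fst (x - y)).
apply: eP2; apply: le_lt_trans h2; rewrite -lecR -!nrE.
exact: (dsum_norm_snd (x - y)).
Qed.

(* The closure in odd_to_even refers to the product topology instead of the Hilbert norm of dsum. *)
Lemma closure_dsum (R : realType) (U V : hilbertType R) (S : set (dsum U V * dsum U V)) :
  @closure ((U * V) * (U * V))%type S = closure S.
Proof.
apply/seteqP; split => -[x y] h P [[P1 P2] [/= n1 n2] sP].
  by apply: h; exists (P1, P2) => //; split; exact/nbhs_dsum.
by apply: h; exists (P1, P2) => //; split => /=; exact/nbhs_dsum.
Qed.

Section DirectSumFacts.
Variables (R : realType) (K : hilbertType R).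
Local Notation DK := (dsum K K).

Lemma inner_dsum (x y : DK) : inner x y = inner x.1 y.1 + inner x.2 y.2.
Proof. by []. Qed.

Lemma nr_dsum (x : DK) : nr x ^+ 2 = nr x.1 ^+ 2 + nr x.2 ^+ 2.
Proof. by apply: complexI; rewrite rmorphD /= -!inner_nr inner_dsum. Qed.

Lemma dsum_matrix (T T' : K -> K) M M' : linear T -> nbounded T M -> linear T' -> nbounded T' M' ->
  0 <= M -> 0 <= M' ->
  linear (dsum_diag T) /\ nbounded (dsum_diag T) M /\
  linear (fun x : DK => (T x.2, T' x.1) : DK) /\
  nbounded (fun x : DK => (T x.2, T' x.1) : DK) (M + M').
Proof.
move=> lT bT lT' bT' M0 M0'; split; [|split; [|split]].
- move=> c x y; rewrite /dsum_diag.
  by congr pair => /=; rewrite lT.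
- move=> x; rewrite -(@ler_pXn2r _ 2)// ?nnegrE ?mulr_ge0 ?nr_ge0//.
  rewrite exprMn !nr_dsum mulrDr -!exprMn /dsum_diag/=.
  by rewrite lerD// ler_pXn2r ?nnegrE ?mulr_ge0 ?nr_ge0.
- by move=> c x y; congr pair => /=; rewrite ?lT ?lT'.
- move=> x; rewrite -(@ler_pXn2r _ 2)// ?nnegrE ?mulr_ge0 ?addr_ge0 ?nr_ge0//.
  rewrite exprMn !nr_dsum/= mulrDr addrC -!exprMn.
  have h (a b c : R) : 0 <= b -> a <= c * b -> c <= M + M' -> a <= (M + M') * b.
    by move=> b0 ab cM; apply: le_trans ab _; rewrite ler_wpM2r.
  rewrite lerD// ler_pXn2r ?nnegrE ?mulr_ge0 ?addr_ge0 ?nr_ge0//.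
    by apply: (h _ _ M') => //; rewrite ?nr_ge0 ?lerDr.
  by apply: (h _ _ M) => //; rewrite ?nr_ge0 ?lerDl.
Qed.

Lemma dsum_representation (B : cstarType R) (Pi : B -> K -> K) : representation Pi ->
  representation (fun b => dsum_diag (Pi b)).
Proof.
move=> rp; split.
- move=> b; have lb := rep_linear b rp; have bb := rep_contractive b rp.
  have [l [bd _]] := dsum_matrix lb bb lb bb (nr_ge0 b) (nr_ge0 b).
  exact: nbounded_operator l bd.
- by move=> a b x; rewrite /dsum_diag !(representationD rp).
- by move=> k a x; rewrite /dsum_diag !(representationZ rp).
- by move=> a b x; rewrite /dsum_diag !(representationM rp).
- by move=> [x y]; rewrite /dsum_diag !(representation1 rp).
- by move=> a x y; rewrite !inner_dsum /dsum_diag !(representation_star rp).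
Qed.

Lemma dsum_total (S : set K) : total_set S ->
  total_set [set z : DK | exists2 x, S x & z = (x, 0) \/ z = (0, x)].
Proof.
move=> tS; set S' := (X in total_set X).
have cs := closed_subspace_span S'.
have [lid bid] : linear (@id K) /\ nbounded (@id K) 1 by split => // x; rewrite mul1r.
have inl x : closure (lin_span S') ((x, 0) : DK).
  apply: (@total_transfer _ _ _ (fun x => (x, 0) : DK) 1 S) => //.
  - by move=> c p q; congr pair => /=; rewrite scaler0 addr0.
  - move=> p; rewrite mul1r -(@ler_pXn2r _ 2)// ?nnegrE ?nr_ge0// nr_dsum/= nr0 expr0n/= addr0.
    exact: lexx.
  - by move=> s Ss; apply/subset_closure/lin_span_sub; exists s => //; left.
have inr x : closure (lin_span S') ((0, x) : DK).
  apply: (@total_transfer _ _ _ (fun x => (0, x) : DK) 1 S) => //.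
  - by move=> c p q; congr pair => /=; rewrite scaler0 addr0.
  - move=> p; rewrite mul1r -(@ler_pXn2r _ 2)// ?nnegrE ?nr_ge0// nr_dsum/= nr0 expr0n/= add0r.
    exact: lexx.
  - by move=> s Ss; apply/subset_closure/lin_span_sub; exists s => //; right.
rewrite /total_set -subTset => -[x y] _; have [_ cD _] := cs.
have := cD 1 _ _ (inl x) (inr y); congr (closure _ _).
by rewrite scale1r; congr pair => /=; rewrite ?addr0 ?add0r.
Qed.

(** The grading is isometric, so its anticommutation with the operator passes from the core to the
    closure. *)
Lemma standard_gradingE (S : set (DK * DK)) (B : cstarType R) (Pi : B -> K -> K) :
  representation Pi ->
  (forall x y, S (x, y) -> S (standard_grading x, - standard_grading y)) ->
  grading (fun b => dsum_diag (Pi b)) (closure S) (@standard_grading R K).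
Proof.
move=> rp hS.
have lin : linear (@standard_grading R K).
  by move=> c x y; congr pair => /=; rewrite scalerN opprD.
have nrS (x : DK) : nr (standard_grading x) = nr x.
  by apply/eqP; rewrite -(@eqrXn2 _ 2)// ?nr_ge0// !nr_dsum /standard_grading/= nrN.
have bS : nbounded (@standard_grading R K) 1 by move=> x; rewrite nrS mul1r.
split.
- split; first exact: nbounded_operator lin bS.
  by move=> x y; rewrite !inner_dsum/= innerNl innerNr.
- by move=> [x y]; rewrite /standard_grading/= opprK.
- by move=> a x; rewrite /standard_grading/dsum_diag/= -scaleN1r -(linear_scale _ _ (rep_linear _ rp)) scaleN1r.
- move=> x y /closure_graphP[p [q [pq px qy]]]; apply/closure_graphP.
  exists (@standard_grading R K \o p), (fun n => - standard_grading (q n)); split.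
  + by move=> n; exact: hS.
  + exact: nr_cvg_bounded lin bS px.
  + move=> eps e0; have [N hN] := qy _ e0; exists N => n /hN.
    by rewrite -opprD nrN -(linear_sub _ _ lin) nrS.
Qed.

End DirectSumFacts.

(* On the span of f i and g i the square of S is m i ^+ 2. *)
Record square_core (R : realType) (K : hilbertType R) (S : set (K * K)) (I : choiceType)
    (f g : I -> K) (m : I -> R) : Prop := {
  core0 : S (0, 0);
  core_lin : forall c p q, S p -> S q -> S (c *: p + q);
  core_sym : forall x y x' y', S (x, y) -> S (x', y') -> inner y x' = inner x y';
  core_osys : osys f;
  core_total : total_set (range f);
  core_f : forall i, S (f i, g i);
  core_g : forall i, S (g i, (m i ^+ 2)%:C%C *: f i)
}.

Section CoreTriple.
Variables (R : realType) (K : hilbertType R) (S : set (K * K)) (I : choiceType).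
Variables (f g : I -> K) (m : I -> R) (B : cstarType R) (B0 : set B) (P : B -> K -> K).
Hypotheses (sc : square_core S f g m) (cI : countable [set: I]) (rP : representation P).

Lemma core_separable : separable_space K.
Proof.
apply: (separable_of_total _ (core_total sc)).
exact: sub_countable (card_image_le _ _) cI.
Qed.

Lemma core_zeta (t : R) : 0 <= t ->
  zeta (closure S) t = (\esum_(i in [set: I]) (resolvent_power t (m i) * nr (f i) ^+ 2)%:E)%E.
Proof.
move=> t0; have [a b c h h' i j] := sc.
exact: (square_zeta a b c h h' core_separable i j t0).
Qed.

Lemma core_self_adjoint : self_adjoint (closure S).
Proof.
have [a b c h h' i j] := sc.
exact: (square_self_adjoint a b c h h' core_separable i j).
Qed.

(** A bounded commutator on the core passes to the closure by continuity, and with it the invariance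
    of the domain. *)
Lemma core_commutator T E M N : linear T -> nbounded T M -> linear E -> nbounded E N ->
  (forall p q, S (p, q) -> S (T p, T q + E p)) ->
  forall x y, closure S (x, y) -> closure S (T x, T y + E x).
Proof.
move=> lT bT lE bE h x y /closure_graphP[p [q [pq px qy]]]; apply/closure_graphP.
exists (T \o p), (fun n => 1 *: T (q n) + E (p n)); split.
- by move=> n; rewrite scale1r; exact: h.
- exact: nr_cvg_bounded lT bT px.
- rewrite -[T y]scale1r; apply: nr_cvg_lin.
    exact: nr_cvg_bounded lT bT qy.
  exact: nr_cvg_bounded lE bE px.
Qed.

Lemma core_triple : separable_space B -> star_subalgebra B0 -> dense B0 ->
  (forall N : R, finite_set [set i | f i <> 0 /\ m i ^+ 2 <= N]) ->
  (forall b, B0 b -> exists E M, [/\ linear E, nbounded E M &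
     forall p q, S (p, q) -> S (P b p, P b q + E p)]) ->
  spectral_triple B0 P (closure S).
Proof.
move=> sB sa dB fin com; have SA := core_self_adjoint.
have key b : B0 b -> exists E M, [/\ linear E, nbounded E M &
    forall x y, closure S (x, y) -> closure S (P b x, P b y + E x)].
  move=> /com[E [M [lE bE h]]]; exists E, M; split => //.
  exact: core_commutator (rep_linear b rP) (rep_contractive b rP) lE bE h.
split => //.
- exact: core_separable.
- have [a b c h h' i j] := sc.
  exact: (square_compact a b c h h' core_separable i j fin).
- by move=> b /key[E [M [_ _ h]]] x [y /h ?]; exists (P b y + E x).
- move=> b /key[E [M [lE bE h]]]; exists E; split; first exact: nbounded_operator lE bE.
  have [[_ _ fn] _ _] := SA.
  by move=> x y z /h h1 h2; rewrite (fn _ _ _ h2 h1) addrC addKr.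
Qed.

(** A vanishing commutator is exploited on the core only; the converse, for scalars, uses that the
    closure is single-valued. *)
Lemma core_nondegenerate : injective P ->
  (forall b, B0 b -> (forall x y z, S (x, y) -> S (P b x, z) -> z = P b y) ->
     exists k : R[i], b = k *: (cone : B)) ->
  nondegenerate B0 P (closure S).
Proof.
move=> iP h; split => // b B0b; split.
- move=> [_ com]; apply: h => // x y z Sxy Sz.
  have := com x y z (subset_closure Sxy) (subset_closure Sz).
  by move/eqP; rewrite eq_sym subr_eq0 => /eqP.
- move=> [k ->]; split.
    have l0 : linear (fun _ : K => 0 : K) by move=> c x y; rewrite scaler0 addr0.
    by apply: (nbounded_operator l0 (M := 0)) => x; rewrite nr0 mul0r.
  move=> x y z xy; rewrite (representationZ rP) (representation1 rP) => xz.
  have [[D0 Dl fn] _ _] := core_self_adjoint.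
  have := Dl k _ _ xy D0; rewrite addr0 => h'.
  by rewrite (fn _ _ _ xz h') (representationZ rP) (representation1 rP) subrr.
Qed.

End CoreTriple.

(** * Dirac operators over the crossed product *)

Section Dirac.
Variables (R : realType) (A : cstarType R) (G : groupType) (H V K : hilbertType R).
Variables (rho : G -> A -> A) (sigma : G -> G -> A) (A0 : set A) (pi : A -> H -> H).
Variables (D : set (H * H)) (l : G -> V -> V).
Variables (e : H -> G -> V -> K) (B : cstarType R) (Pi : B -> K -> K) (u : A -> G -> B).
Variables (d : nat) (v0 : 'I_d -> V).
Hypotheses (tp : twisting_pair rho sigma) (st : spectral_triple A0 pi D) (sm : smooth A0 rho sigma).
Hypothesis hC : forall a, A0 a -> forall y, exists M : R, forall x, exists C : H -> H,
  commutator_extension D (pi (rho x a ** sigma x y)) C /\ opnorm C <= M.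
Hypotheses (lsa : forall g, self_adjoint_operator (l g)) (ltb : translation_bounded l).
Hypotheses (he : tensor3 e) (vb : fonb v0) (rPi : representation Pi).
Hypothesis PiE : forall a x xi y z,
  Pi (u a x) (e xi y z) = e (induced_entry rho sigma pi x y a xi) (x * y)%g z.
Hypothesis Pib : forall b M, 0 <= M -> nbounded (Pi b) M -> nr b <= M.

Local Notation entry := (induced_entry rho sigma pi).
Local Notation spin := (spin e l D).

Let rp : representation pi := triple_representation st.
Let sA0 : star_subalgebra A0 := triple_subalgebra st.
Let SA : self_adjoint D := triple_self_adjoint st.

Lemma l_linear g : linear (l g).
Proof. by case: (lsa g) => -[]. Qed.

Lemma l_sym g v w : inner (l g v) w = inner v (l g w).
Proof. by case: (lsa g). Qed.

Lemma entry_A0 x y a : A0 a -> A0 (rho (y^-1 * x^-1)%g a ** sigma (y^-1 * x^-1)%g x).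
Proof. by move=> A0a; apply: (subalgebraM sA0); [exact: (A0_rho sm)|exact: sm.2]. Qed.

Lemma entry_dom x y a xi : A0 a -> Dom D xi -> Dom D (entry x y a xi).
Proof. by move=> A0a; apply: (triple_dom st); exact: entry_A0. Qed.

Lemma bounded_opB (E : hilbertType R) (T T' : E -> E) : bounded_operator T -> bounded_operator T' ->
  bounded_operator (fun v => T v - T' v).
Proof.
move=> bT bT'; have [lT _] := bT; have [lT' _] := bT'.
apply: (nbounded_operator (M := opnorm T + opnorm T')).
  by move=> c x y; rewrite lT lT' scalerBr opprD addrACA.
move=> x; apply: le_trans (nrB _ _) _; rewrite mulrDl.
by rewrite lerD// opnorm_bound.
Qed.

(** The entry at y is pi(rho_g(a) sigma_{g,x}) with g = y^-1 x^-1, so the assumed supremum bounds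
    its commutators uniformly in y. Translation boundedness is used at x^-1, which gives the
    differences l(y) - l(x y). *)
Lemma Pi_generator a x theta : A0 a -> linear theta -> nbounded theta 1 ->
  (forall b xi, theta (pi b xi) = pi b (theta xi)) ->
  exists E M, [/\ linear E, nbounded E M &
    forall p q, spin theta (p, q) -> spin theta (Pi (u a x) p, Pi (u a x) q + E p)].
Proof.
move=> A0a lth bth ct; have [M2 hM2] := hC A0a x.
have /choice[C hCg] := hM2; have [M3 hM3] := ltb x^-1%g.
have Cb y : bounded_operator (C y) by case: (hCg y) => -[].
have lb g : bounded_operator (l g) by case: (lsa g).
have M20 : 0 <= M2 by apply: le_trans (opnorm_ge0 (Cb 1%g)) _; case: (hCg 1%g).
have M30 : 0 <= M3.
  by apply: le_trans (opnorm_ge0 (bounded_opB (lb 1%g) (lb ((x^-1)^-1 * 1)%g))) (hM3 _).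
apply: (@spin_commutator _ _ _ _ _ _ l D he l_linear d v0 x (fun y => entry x y a)
  (fun y => C (y^-1 * x^-1)%g) (nr a) M2 M3 theta vb (triple_separable_space st)) => //.
- by move=> y; exact: (entry_linear rho sigma rp).
- by move=> y; exact: (entry_bound tp rp).
- by move=> y; case: (Cb (y^-1 * x^-1)%g).
- move=> y z; apply: le_trans (opnorm_bound (Cb _) z) _.
  by rewrite ler_wpM2r ?nr_ge0//; case: (hCg (y^-1 * x^-1)%g).
- by move=> y xi; rewrite /induced_entry ct.
- move=> y z /=; rewrite nrBC.
  have h := opnorm_bound (bounded_opB (lb y) (lb ((x^-1)^-1 * y)%g)) z.
  by have := le_trans h (ler_wpM2r (nr_ge0 z) (hM3 y)); rewrite /= invgK.
- move=> y xi eta Dx; have [z Dz] := entry_dom x y A0a (ex_intro _ _ Dx).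
  by have [[_ cC] _] := hCg (y^-1 * x^-1)%g; rewrite (cC _ _ _ Dx Dz) subrKC.
- exact: nr_ge0.
- exact: rep_linear.
Qed.

Lemma Pi_spin b theta : Cc u A0 b -> linear theta -> nbounded theta 1 ->
  (forall b xi, theta (pi b xi) = pi b (theta xi)) ->
  exists E M, [/\ linear E, nbounded E M &
    forall p q, spin theta (p, q) -> spin theta (Pi b p, Pi b q + E p)].
Proof.
move=> + lth bth ct; rewrite (Cc_A0 tp rp he rPi PiE Pib sA0) => Bb; move: b Bb.
apply: lin_span_ind => /=.
- exists (fun=> 0), 0; split.
  + by move=> c x y; rewrite scaler0 addr0.
  + by move=> x; rewrite nr0 mul0r.
  + move=> p q _; rewrite -(scale0r cone) !(representationZ rPi) !scale0r addr0.
    exact: lin_span0.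
- move=> c b b' [E [M [lE bE hE]]] [E' [M' [lE' bE' hE']]].
  exists (fun p => c *: E p + E' p), (cab c * M + M'); split.
  + by move=> a x y; rewrite lE lE' !scalerDr !scalerA addrACA [c * a]mulrC.
  + move=> x; apply: le_trans (nrD _ _) _; rewrite mulrDl lerD// nrZ -mulrA ler_wpM2l//.
    exact: cab_ge0.
  + move=> p q s; have := lin_spanP c (hE _ _ s) (hE' _ _ s); congr (spin _ (_, _)) => /=.
      by rewrite (representationD rPi) (representationZ rPi).
    by rewrite (representationD rPi) (representationZ rPi) scalerDr addrACA.
- by move=> _ [a [x [A0a ->]]]; exact: Pi_generator.
Qed.

(* Testing the commutation on xi (x) delta_1 (x) w isolates the coefficient of delta_x. *)
Lemma spin_component theta b (s : seq G) (f : G -> A) x xi eta zeta w (m : R) : uniq s -> x \in s ->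
  (forall y, A0 (f y)) -> b = \sum_(y <- s) u (f y) y ->
  l 1%g w = 0 -> l x w = m%:C%C *: w -> w <> 0 ->
  (forall p q r, spin theta (p, q) -> spin theta (Pi b p, r) -> r = Pi b q) ->
  linear theta ->
  D (xi, eta) -> D (entry x 1%g (f x) xi, zeta) ->
  zeta + m%:C%C *: theta (entry x 1%g (f x) xi) = entry x 1%g (f x) eta.
Proof.
move=> us xs A0f bE l1 lw w0 com lth Dx Dz.
have /choice[Z hZ] : forall y, exists z, D (entry y 1%g (f y) xi, z).
  by move=> y; apply: entry_dom => //; exists eta.
have Pbe p : Pi b (e p 1%g w) = \sum_(y <- s) e (entry y 1%g (f y) p) y w.
  rewrite bE; have PiL : linear (Pi^~ (e p 1%g w)).
    by move=> c a a'; rewrite (representationD rPi) (representationZ rPi).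
  rewrite (linear_bigsum _ _ _ PiL); apply: eq_bigr => y _.
  by rewrite PiE mulg1.
have gx : spin theta (e xi 1%g w, e eta 1%g w).
  have := spin_gen e l theta 1%g w Dx; rewrite l1 (linear_0 (tensor3r he _ _)) addr0.
  exact.
have sumgen : spin theta (Pi b (e xi 1%g w), \sum_(y <- s) (e (Z y) y w + e (theta (entry y 1%g (f y) xi)) y (l y w))).
  rewrite Pbe; elim: s {us xs bE Pbe} => [|y s ih]; first by rewrite !big_nil; exact: lin_span0.
  rewrite !big_cons; have := lin_spanP 1 (spin_gen e l theta y w (hZ y)) ih.
  by congr (spin _ (_, _)) => /=; rewrite scale1r.
(* Pairing with r (x) delta_x (x) w, where r is the difference of the two sides of the goal, leaves
   ||r||^2 ||w||^2 = 0. *)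
have := com _ _ _ gx sumgen; rewrite Pbe => /(congr1 (fun p => inner p (e (zeta + m%:C%C *: theta (entry x 1%g (f x) xi) - entry x 1%g (f x) eta) x w))).
have -> : zeta = Z x by have [[_ _ fn] _ _] := SA; exact: fn Dz (hZ x).
set r := _ - _; rewrite !inner_suml.
have xo (p : H) y (v : V) : y != x -> inner (e p y v) (e r x w) = 0.
  by move=> yx; rewrite (tensor3_inner he) (negbTE yx) mul0r.
rewrite (bigD1_seq x)//= [in RHS](bigD1_seq x)//= !big1 ?addr0; last 2 first.
- by move=> y yx; rewrite xo.
- by move=> y yx; rewrite innerDl !xo ?addr0.
rewrite lw (linear_scale _ _ (tensor3r he _ _)) -(linear_scale _ _ (tensor3l he x w)).
rewrite -(linear_add _ _ (tensor3l he x w)) !(tensor3_inner he) eqxx !mul1r => /eqP.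
rewrite -subr_eq0 -mulrBl mulf_eq0 -innerBl => /orP[|]/eqP/inner_eq0 //.
by move/eqP; rewrite subr_eq0 => /eqP.
Qed.

Section Eigenfamily.
Hypotheses (lp : proper_length l) (d0 : (0 < d)%N).
Variables (ev : nat -> H) (lam : nat -> R) (w : G -> 'I_d -> V) (mm : G -> 'I_d -> R).
Hypotheses (eo : osys ev) (ce : complete_sys ev) (De : D = diag_rel ev lam).
Hypothesis fin : forall N : R, finite_set [set n | ev n <> 0 /\ lam n ^+ 2 <= N].
Hypotheses (wb : forall g, fonb (w g)) (lw : forall g k, l g (w g k) = (mm g k)%:C%C *: w g k).

Local Notation I := (nat * G * 'I_d)%type.

Definition eigenfamily (p : I) : K := e (ev p.1.1) p.1.2 (w p.1.2 p.2).
Definition dirac_modulus (p : I) : R := Num.sqrt (lam p.1.1 ^+ 2 + mm p.1.2 p.2 ^+ 2).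

Lemma dirac_modulus2 p : dirac_modulus p ^+ 2 = lam p.1.1 ^+ 2 + mm p.1.2 p.2 ^+ 2.
Proof. by rewrite sqr_sqrtr// addr_ge0 ?sqr_ge0. Qed.

Lemma eigenfamily_osys : osys eigenfamily.
Proof.
split=> [[[n g] k] [[n' g'] k'] ne|[[n g] k]]; rewrite /eigenfamily/=.
  rewrite (tensor3_inner he); have [gg|_] := eqVneq g g'; last by rewrite mul0r.
  move: ne; rewrite -gg !xpair_eqE eqxx andbT negb_and (wb g).1.
  by case/orP => h; [rewrite eo.1// mul0r mulr0|rewrite (negbTE h) !mulr0].
rewrite (tensor3_inner he) eqxx (wb g).1 eqxx mul1r mulr1.
by have [->|] := eo.2 n; [left; exact: (linear_0 (tensor3l he g _))|right].
Qed.

Lemma eigenfamily_nr p : nr (eigenfamily p) = nr (ev p.1.1).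
Proof.
have w1 : nr (w p.1.2 p.2) = 1.
  apply/eqP; rewrite -(@eqrXn2 _ 2)// ?nr_ge0//; apply/eqP/complexI.
  by rewrite -inner_nr (wb _).1 eqxx expr1n.
by rewrite (tensor3_nr he) w1 mulr1.
Qed.

Lemma eigenfamily_total : total_set (range eigenfamily).
Proof.
rewrite (_ : range _ = [set z | exists xi g v, [/\ range ev xi, range (w g) v & z = e xi g v]]).
  by apply: (tensor3_subtotal he) => [|g]; [exact: complete_total|exact: fonb_total].
apply/seteqP; split => [_ [[[n g] k] _ <-]|_ [_ [g [_ [[n _ <-] [k _ <-] ->]]]]].
  by exists (ev n), g, (w g k); split.
by exists ((n, g), k).
Qed.

Lemma eigenfamily_finite (N : R) :
  finite_set [set p | eigenfamily p <> 0 /\ dirac_modulus p ^+ 2 <= N].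
Proof.
have f2 := proper_finite wb l_linear lw lp N.
apply: (@sub_finite_set _ _ ((fun q : nat * (G * 'I_d) => (q.1, q.2.1, q.2.2) : I) @`
   ([set n | ev n <> 0 /\ lam n ^+ 2 <= N] `*` [set p | mm p.1 p.2 ^+ 2 <= N]))).
  move=> [[n g] k] [/= f0]; rewrite dirac_modulus2/= => le.
  exists (n, (g, k)) => //; split => /=; first split.
  - by move=> en; apply: f0; rewrite /eigenfamily/= en; exact: (linear_0 (tensor3l he _ _)).
  - by apply: le_trans le; rewrite lerDl sqr_ge0.
  - by apply: le_trans le; rewrite lerDr sqr_ge0.
by apply: finite_image; apply: finite_setX.
Qed.

Lemma eigenfamily_countable : countable [set: I].
Proof.
have cG := proper_countable wb l_linear lw lp d0.
apply: (@sub_countable _ _ _ ((fun q : nat * (G * 'I_d) => (q.1, q.2.1, q.2.2) : I) @`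
   ([set: nat] `*` ([set: G] `*` [set: 'I_d])))).
  by apply: subset_card_le => -[[n g] k] _; exists (n, (g, k)).
apply: sub_countable (card_image_le _ _) _; apply: countableX => //.
by apply: countableX => //; exact: finite_set_countable.
Qed.

Lemma D_ev n : D (ev n, (lam n)%:C%C *: ev n).
Proof. by rewrite De; exact: diag_rel_e. Qed.

Lemma D_linear c x y x' y' : D (x, y) -> D (x', y') -> D (c *: x + x', c *: y + y').
Proof. by case: SA => [[_ h _] _ _] h1 h2; exact: (h c _ _ h1 h2). Qed.

Lemma length_unit v : l 1%g v = 0.
Proof. by have [h _ _] := lp; exact: (h 1%g).2. Qed.

Lemma length_eigenvalue x : x <> 1%g -> exists k, mm x k != 0.
Proof.
move=> x1; apply: contrapT => h; apply: x1; have [hl _ _] := lp; apply/hl => v.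
rewrite (fonb_expand v (wb x)) (linear_bigsum _ _ _ (l_linear x)) big1// => k _.
rewrite (linear_scale _ _ (l_linear x)) lw.
have -> : mm x k = 0 by apply/eqP; apply: contrapT => /negP mk; apply: h; exists k.
by rewrite scale0r scaler0.
Qed.

(** The common end of both parities; [key] is what the vanishing commutator says about each
    component. Off the unit it kills the entry on the dense domain, and faithfulness of pi,
    unitarity of sigma and injectivity of rho_g give f x = 0. At the unit it says that D commutes
    with the coefficient. *)
Lemma nondegenerate_scalar b : nondegenerate A0 pi D -> Cc u A0 b ->
  (forall s f x xi eta zeta, uniq s -> x \in s -> (forall y, A0 (f y)) ->
     b = \sum_(y <- s) u (f y) y -> D (xi, eta) -> D (entry x 1%g (f x) xi, zeta) ->
     if x == 1%g then zeta = entry x 1%g (f x) eta else entry x 1%g (f x) xi = 0) ->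
  exists k : R[i], b = k *: cone.
Proof.
move=> [ip nd] [f [ff A0f bE]] key.
pose s : seq G := fset_set [set x | f x != 0].
have us : uniq s by exact: fset_uniq.
have bs : b = \sum_(y <- s) u (f y) y by rewrite bE fsbig_finite.
have dD : dense (Dom D) by case: SA.
have f0 x : x \in s -> x != 1%g -> f x = 0.
  move=> xs x1; set g := (1^-1 * x^-1)%g.
  have e0 : entry x 1%g (f x) = fun=> 0.
    have bo := representation_bounded rp (rho g (f x) ** sigma g x).
    apply/funext; have lz : linear (fun _ : H => 0 : H) by move=> c p q; rewrite scaler0 addr0.
    have bz : nbounded (fun _ : H => 0 : H) 0 by move=> p; rewrite nr0 mul0r.
    apply: (total_ext (rep_linear _ rp) (rep_contractive _ rp) lz bz (S := Dom D)).
      by rewrite -subTset -((dense_closureP _).1 dD); apply: closure_subset; exact: lin_span_sub.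
    move=> xi [eta Dx]; have [zeta Dz] := entry_dom x 1%g (A0f x) (ex_intro _ _ Dx).
    by have := key s f x xi eta zeta us xs A0f bs Dx Dz; rewrite (negbTE x1).
  have pi0 : pi 0 = fun=> 0.
    by apply/funext => xi; rewrite -(scale0r cone) (representationZ rp) scale0r.
  have /ip/(congr1 (fun a => a ** star (sigma g x))) : pi (rho g (f x) ** sigma g x) = pi 0 by rewrite pi0 -e0.
  rewrite -cmulA (twisting_unitary tp g x).2 cmulx1 cmul0x => r0.
  have [bij lr _ _] := twisting_automorphism tp g.
  by apply: (bij_inj bij); rewrite r0 (linear_0 lr).
have bE' : b = u (f 1%g) 1%g.
  rewrite bs; have [s1|s1] := boolP (1%g \in s).
    rewrite (bigD1_seq 1%g)//= big1_seq ?addr0// => y /andP[y1 ys].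
    by rewrite (f0 y ys y1) (u0 tp rp he rPi PiE Pib).
  have -> : f 1%g = 0.
    apply/eqP/negP => /negP f1; move/negP: s1; apply.
    by rewrite /s in_fset_set// inE.
  rewrite (u0 tp rp he rPi PiE Pib) big1_seq// => y /andP[_ ys].
  rewrite (f0 y ys) ?(u0 tp rp he rPi PiE Pib)//.
  by apply: contraNneq s1 => <-.
have e1 xi : entry 1%g 1%g (f 1%g) xi = pi (f 1%g) xi.
  by rewrite /induced_entry invg1 mulg1 (twisting_1 tp) (twisting_1r tp) cmulx1.
suff [k fk] : exists k : R[i], f 1%g = k *: cone.
  exists k; rewrite bE' fk (linear_scale _ _ (u_linear tp rp he rPi PiE Pib 1%g)).
  by rewrite (u_one tp rp he rPi PiE Pib).
have [s1|s1] := boolP (1%g \in s); last first.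
  exists 0; rewrite scale0r; apply/eqP/negP => /negP f1; move/negP: s1; apply.
  by rewrite /s in_fset_set// inE.
apply/(nd _ (A0f 1%g)); split.
  have lz : linear (fun _ : H => 0 : H) by move=> c p q; rewrite scaler0 addr0.
  by apply: (nbounded_operator lz (M := 0)) => p; rewrite nr0 mul0r.
move=> x y z Dx Dz; have := key s f 1%g x y z us s1 A0f bs Dx.
by rewrite eqxx !e1 => /(_ Dz) ->; rewrite subrr.
Qed.

Section Even.
Variable chi : H -> H.
Hypothesis gr : grading pi D chi.

Lemma chi_linear : linear chi.
Proof. by case: (grading_self_adjoint gr) => -[]. Qed.

Lemma chi_nbounded : nbounded chi 1.
Proof.
move=> x; rewrite mul1r -(@ler_pXn2r _ 2)// ?nnegrE ?nr_ge0// le_eqVlt; apply/orP; left.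
apply/eqP/complexI; rewrite -!inner_nr.
by have [_ ->] := grading_self_adjoint gr; rewrite (grading_involutive gr).
Qed.

(** Each xi splits into (xi + chi xi) / 2 and (xi - chi xi) / 2; as chi anticommutes with D, the
    images under D are (eta - chi eta) / 2 and (eta + chi eta) / 2. *)
Lemma even_to_oddE : even_to_odd e l D chi = closure (spin chi).
Proof.
congr closure; apply/seteqP; split; apply: lin_span_ind.
- exact: lin_span0.
- by move=> c p q; exact: lin_spanP.
- move=> _ [] [xi [eta [g [v [Dx cx ->]]]]]; apply: lin_span_sub; exists xi, eta, g, v; split => //.
    by rewrite cx addrC.
  by rewrite cx -[- xi]scaleN1r (linear_scale _ _ (tensor3l he _ _)) scaleN1r.
- exact: lin_span0.
- by move=> c p q; exact: lin_spanP.
- move=> _ [xi [eta [g [v [Dx ->]]]]].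
  have Dc := grading_odd gr Dx; set S := (X in lin_span X).
  have lc := chi_linear; have cc := grading_involutive gr.
  have h1 : S (e (xi + chi xi) g v, e (xi + chi xi) g (l g v) + e (eta - chi eta) g v).
    left; exists (xi + chi xi), (eta - chi eta), g, v; split => //.
      by rewrite -[xi + _]addr0 -{1}[xi]scale1r -{1}[eta]scale1r addr0; exact: D_linear.
    by rewrite (linear_add _ _ lc) cc addrC.
  have h2 : S (e (xi - chi xi) g v, e (eta + chi eta) g v - e (xi - chi xi) g (l g v)).
    right; exists (xi - chi xi), (eta + chi eta), g, v; split => //.
      have := D_linear (-1) Dc Dx.
      by rewrite !scaleN1r opprK [- _ + xi]addrC [chi eta + _]addrC.
    by rewrite (linear_sub _ _ lc) cc opprB.
  have := lin_spanP (2%:R^-1) (lin_span_sub h1) (lin_spanP (2%:R^-1) (lin_span_sub h2) (lin_span0 S)).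
  have half (x : K) : x = 2%:R^-1 *: (x + x).
    by rewrite scalerDr -scalerDl -[2^-1]div1r -splitr scale1r.
  congr (lin_span _ _); congr pair => /=; rewrite addr0 -scalerDr.
    rewrite (linear_add _ _ (tensor3l he _ _)) (linear_sub _ _ (tensor3l he _ _)).
    by rewrite addrACA subrr addr0 -half.
  rewrite !(linear_sub _ _ (tensor3l he _ _)) !(linear_add _ _ (tensor3l he _ _)) opprB.
  rewrite [RHS]half; congr (_ *: _).
  set a := e xi g (l g v); set b := e (chi xi) _ _; set p := e eta _ _; set q := e (chi eta) _ _.
  rewrite [p + q + _]addrC addrACA [b - a]addrC [a + b + _]addrACA subrr add0r.
  by rewrite [p - q + _]addrACA addNr addr0 addrACA [b + p]addrC.
Qed.

Definition even_image (p : I) : K :=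
  (lam p.1.1)%:C%C *: eigenfamily p + (mm p.1.2 p.2)%:C%C *: e (chi (ev p.1.1)) p.1.2 (w p.1.2 p.2).

(** D (x) 1 anticommutes with the operator chi (x) M_l, so the mixed terms cancel in the square. *)
Lemma even_core : square_core (spin chi) eigenfamily even_image dirac_modulus.
Proof.
have gen (p : I) xi (t : R[i]) : D (xi, t *: xi) -> spin chi (e xi p.1.2 (w p.1.2 p.2),
    t *: e xi p.1.2 (w p.1.2 p.2) + (mm p.1.2 p.2)%:C%C *: e (chi xi) p.1.2 (w p.1.2 p.2)).
  move=> Dx; have := spin_gen e l chi p.1.2 (w p.1.2 p.2) Dx.
  by rewrite (linear_scale _ _ (tensor3l he _ _)) lw (linear_scale _ _ (tensor3r he _ _)).
split.
- exact: lin_span0.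
- by move=> c p q; exact: lin_spanP.
- move=> x y x' y'; apply: (spin_sym he) => //.
  + by move=> ? ? ? ?; exact: self_adjoint_sym.
  + by case: (grading_self_adjoint gr).
  + exact: l_sym.
- exact: eigenfamily_osys.
- exact: eigenfamily_total.
- by move=> p; apply: gen; exact: D_ev.
- move=> p; have h1 := gen p _ _ (D_ev p.1.1).
  have Dc : D (chi (ev p.1.1), - (lam p.1.1)%:C%C *: chi (ev p.1.1)).
    have := grading_odd gr (D_ev p.1.1).
    by rewrite (linear_scale _ _ chi_linear) scaleNr.
  have h2 := gen p _ _ Dc; rewrite (grading_involutive gr) in h2.
  have := lin_spanP (lam p.1.1)%:C%C h1 (lin_spanP (mm p.1.2 p.2)%:C%C h2 (spin0 e l D chi)).
  congr (spin _ _); congr pair => /=; first by rewrite addr0.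
  rewrite addr0 !scalerDr !scalerA dirac_modulus2 mulrN [_ * (lam _)%:C%C in X in _ + X = _]mulrC.
  rewrite scaleNr addrA addrK -scalerDl; congr (_ *: _).
  by rewrite -!rmorphM -rmorphD/= -!expr2.
Qed.

Lemma even_triple : separable_space B -> dense (Cc u A0) ->
  spectral_triple (Cc u A0) Pi (even_to_odd e l D chi).
Proof.
move=> sB dB; rewrite even_to_oddE.
apply: (core_triple even_core eigenfamily_countable rPi) => //.
- exact: (Cc_star_subalgebra tp rp he rPi PiE Pib).
- exact: eigenfamily_finite.
- move=> b Bb; apply: Pi_spin => //; [exact: chi_linear|exact: chi_nbounded|].
  exact: (grading_even gr).
Qed.

Lemma Pi_injective : injective Pi.
Proof. by move=> b b' bb; apply: (Pi_ext he rPi Pib) => xi y z; rewrite bb. Qed.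

Lemma even_nondegenerate : nondegenerate A0 pi D ->
  nondegenerate (Cc u A0) Pi (even_to_odd e l D chi).
Proof.
move=> nd; rewrite even_to_oddE.
apply: (core_nondegenerate even_core eigenfamily_countable rPi Pi_injective) => b Bb com.
apply: nondegenerate_scalar => // s f x xi eta zeta us xs A0f bs Dx Dz.
have comp k xi' eta' zeta' (Dx' : D (xi', eta')) (Dz' : D (entry x 1%g (f x) xi', zeta')) :=
  spin_component us xs A0f bs (length_unit (w x k)) (lw x k) (@fonb_ne0 _ _ _ (w x) k (wb x))
    com chi_linear Dx' Dz'.
case: (x =P 1%g) => [x1|x1].
  have := comp (Ordinal d0) _ _ _ Dx Dz.
  suff -> : mm x (Ordinal d0) = 0 by rewrite scale0r addr0.
  have lx : l x (w x (Ordinal d0)) = 0 by rewrite x1 length_unit.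
  have /esym/eqP := lw x (Ordinal d0); rewrite lx scaler_eq0.
  move=> /orP[|/eqP/(@fonb_ne0 _ _ _ (w x) (Ordinal d0) (wb x))//].
  by rewrite (inj_eq (@complexI R)) => /eqP.
have [k mk] := length_eigenvalue x1.
have h1 := comp k _ _ _ Dx Dz.
have cE y : entry x 1%g (f x) (chi y) = chi (entry x 1%g (f x) y).
  by rewrite /induced_entry (grading_even gr).
have Dz' := grading_odd gr Dz; rewrite -cE in Dz'.
have := comp k _ _ _ (grading_odd gr Dx) Dz'.
rewrite cE (grading_involutive gr) -[- chi eta]scaleN1r (linear_scale _ _ (entry_linear rho sigma rp _ _ _)) cE -h1.
set a := entry _ _ _ _; rewrite (linear_add _ _ chi_linear) (linear_scale _ _ chi_linear).
rewrite (grading_involutive gr) scaleN1r opprD => /addrI/eqP.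
rewrite -addr_eq0 -mulr2n -scaler_nat scalerA scaler_eq0 mulf_eq0 pnatr_eq0/= => /orP[|/eqP//].
by rewrite (inj_eq (@complexI R)) (negbTE mk).
Qed.

End Even.

Definition odd_spin : set (dsum K K * dsum K K) :=
  [set p | spin (fun xi => - 'i%C *: xi) (p.1.2, p.2.1) /\ spin (fun xi => 'i%C *: xi) (p.1.1, p.2.2)].

Lemma odd_to_evenE : odd_to_even e l D = closure odd_spin.
Proof.
rewrite /odd_to_even /odd_spin !(dirac_entry_spin l D he).
exact: closure_dsum.
Qed.

Definition odd_family (p : I * bool) : dsum K K :=
  if p.2 then (eigenfamily p.1, 0) else (0, eigenfamily p.1).

(** The factor is lam + i m on the first summand and lam - i m on the second; their product is lam^2
    + m^2. *)
Definition odd_image (p : I * bool) : dsum K K :=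
  let z := (lam p.1.1.1)%:C%C + (if p.2 then 'i%C else - 'i%C) * (mm p.1.1.2 p.1.2)%:C%C in
  if p.2 then (0, z *: eigenfamily p.1) else (z *: eigenfamily p.1, 0).

Lemma spin_scale (c : R[i]) (p : I) (t : R[i]) :
  spin (fun xi => c *: xi) (t *: eigenfamily p,
    t *: (((lam p.1.1)%:C%C + c * (mm p.1.2 p.2)%:C%C) *: eigenfamily p)).
Proof.
have := spin_gen e l (fun xi => c *: xi) p.1.2 (w p.1.2 p.2) (D_ev p.1.1).
rewrite !(linear_scale _ _ (tensor3l he _ _)) lw (linear_scale _ _ (tensor3r he _ _)).
rewrite scalerA -scalerDl => h.
have := spin_lin t h (spin0 e l D (fun xi => c *: xi)).
by congr (spin _ (_, _)) => /=; rewrite addr0.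
Qed.

Lemma odd_family_osys : osys odd_family.
Proof.
have fo := eigenfamily_osys.
split=> [[p b] [q c] ne|[p b]]; rewrite inner_dsum /odd_family/=.
  move: ne; rewrite xpair_eqE negb_and.
  case: b c => [] [] /=; rewrite ?orbF ?inner0l ?inner0r ?add0r ?addr0//.
  - exact: fo.1.
  - exact: fo.1.
have [f0|f1] := fo.2 p; [left|right]; case: b => /=; rewrite ?f0 ?inner0l ?inner0r ?addr0 ?add0r//.
Qed.

Lemma odd_family_nr p : nr (odd_family p) ^+ 2 = nr (ev p.1.1.1) ^+ 2.
Proof.
rewrite nr_dsum /odd_family; case: p.2 => /=; rewrite nr0 expr0n/= ?addr0 ?add0r eigenfamily_nr//.
Qed.

Lemma odd_family_total : total_set (range odd_family).
Proof.
have := dsum_total eigenfamily_total; congr total_set; apply/seteqP; split.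
  by move=> _ [_ [p _ <-] []->]; [exists (p, true)|exists (p, false)].
by move=> _ [[p b] _ <-]; exists (eigenfamily p); [exists p|case: b; [left|right]].
Qed.

Lemma odd_core : square_core odd_spin odd_family odd_image (fun p => dirac_modulus p.1).
Proof.
have ii : 'i%C * 'i%C = -1 :> R[i] by rewrite -expr2 sqr_i.
have zz (p : I) (c : R[i]) : c * c = -1 ->
    ((lam p.1.1)%:C%C - c * (mm p.1.2 p.2)%:C%C) *
    ((lam p.1.1)%:C%C + c * (mm p.1.2 p.2)%:C%C) = (dirac_modulus p ^+ 2)%:C%C.
  move=> cc; rewrite -subr_sqr exprMn [c ^+ 2]expr2 cc mulN1r opprK dirac_modulus2.
  by rewrite rmorphD !rmorphXn.
split.
- by split; exact: spin0.
- by move=> c p q [h1 h2] [h1' h2']; split; [exact: (spin_lin c h1 h1')|exact: (spin_lin c h2 h2')].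
- have tsym (c : R[i]) xi xi' : conjc c = - c -> inner (c *: xi : H) xi' = inner xi (- c *: xi').
    by move=> cc; rewrite innerZl innerZr rmorphN /= cc opprK.
  move=> x y x' y' [/= h1 h2] [/= h1' h2']; rewrite !inner_dsum addrC; congr (_ + _).
    apply: (spin_sym he _ _ _ h2 h1') => [? ? ? ?|? ?|]; [exact: self_adjoint_sym| |exact: l_sym].
    by rewrite tsym// conjc_i.
  apply: (spin_sym he _ _ _ h1 h2') => [? ? ? ?|? ?|]; [exact: self_adjoint_sym| |exact: l_sym].
  have ci : conjc (- 'i%C) = - - 'i%C :> R[i] by rewrite -conjc_i conjcK conjc_i opprK.
  by rewrite (tsym _ _ _ ci) opprK.
- exact: odd_family_osys.
- exact: odd_family_total.
- move=> [p []]; split; rewrite /odd_image /odd_family /=; (try exact: spin0).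
    by have := spin_scale 'i%C p 1; rewrite !scale1r.
  by have := spin_scale (- 'i%C) p 1; rewrite !scale1r.
- move=> [p []]; split; rewrite /odd_image /odd_family /= ?scaler0; (try exact: spin0).
    have := spin_scale (- 'i%C) p ((lam p.1.1)%:C%C + 'i%C * (mm p.1.2 p.2)%:C%C).
    by congr (spin _ (_, _)); rewrite scalerA mulrC mulNr zz.
  have := spin_scale 'i%C p ((lam p.1.1)%:C%C - 'i%C * (mm p.1.2 p.2)%:C%C).
  by rewrite scalerA zz// mulNr.
Qed.

Lemma odd_countable : countable [set: I * bool].
Proof.
rewrite -setXTT; apply: countableX; first exact: eigenfamily_countable.
exact: finite_set_countable.
Qed.

Lemma theta_bound (c : R[i]) : cab c = 1 -> nbounded (fun xi : H => c *: xi) 1.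
Proof. by move=> c1 x; rewrite nrZ -/(cab c) c1. Qed.

Lemma theta_linear (c : R[i]) : linear (fun xi : H => c *: xi).
Proof. by move=> a x y; rewrite scalerDr !scalerA mulrC. Qed.

Lemma odd_triple : separable_space B -> dense (Cc u A0) ->
  even_spectral_triple (Cc u A0) (fun b => dsum_diag (Pi b))
    (odd_to_even e l D) (@standard_grading R K).
Proof.
move=> sB dB; rewrite odd_to_evenE; split; last first.
  apply: standard_gradingE => // x y [h1 h2]; split => /=.
    have := spin_lin (-1) h1 (spin0 e l D _).
    by congr (spin _ (_, _)) => /=; rewrite addr0 scaleN1r.
  by rewrite opprK.
apply: (core_triple odd_core odd_countable (dsum_representation rPi)) => //.
- exact: (Cc_star_subalgebra tp rp he rPi PiE Pib).
- move=> N; apply: (@sub_finite_set _ _ ((fun q : I * bool => q) @`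
    ([set p | eigenfamily p <> 0 /\ dirac_modulus p ^+ 2 <= N] `*` [set: bool]))).
    move=> [p b] [/= f0 le]; exists (p, b) => //; split => //; split => // p0; apply: f0.
    by rewrite /odd_family/= p0 if_same.
  by apply: finite_image; apply: finite_setX => //; exact: eigenfamily_finite.
move=> b Bb.
have ct (c : R[i]) a xi : c *: pi a xi = pi a (c *: xi).
  by rewrite (linear_scale _ _ (rep_linear a rp)).
have [E [M [lE bE hE]]] : exists E M, [/\ linear E, nbounded E M & forall p q,
    spin (fun xi => 'i%C *: xi) (p, q) -> spin (fun xi => 'i%C *: xi) (Pi b p, Pi b q + E p)].
  apply: Pi_spin => //; [exact: theta_linear|apply: theta_bound; exact: cab_i].
have [E' [M' [lE' bE' hE']]] : exists E M, [/\ linear E, nbounded E M & forall p q,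
    spin (fun xi => - 'i%C *: xi) (p, q) -> spin (fun xi => - 'i%C *: xi) (Pi b p, Pi b q + E p)].
  by apply: Pi_spin => //; [exact: theta_linear|apply: theta_bound; rewrite cabN cab_i].
have nb (T : K -> K) N : nbounded T N -> nbounded T `|N|.
  by move=> bT x; apply: le_trans (bT x) _; rewrite ler_wpM2r ?nr_ge0// ler_norm.
have [_ [_ [lm bm]]] := dsum_matrix lE' (nb _ _ bE') lE (nb _ _ bE) (normr_ge0 _) (normr_ge0 _).
exists (fun x => (E' x.2, E x.1)), (`|M'| + `|M|); split => // p q [h1 h2].
by split => /=; [exact: hE'|exact: hE].
Qed.

Lemma odd_nondegenerate : nondegenerate A0 pi D ->
  nondegenerate (Cc u A0) (fun b => dsum_diag (Pi b)) (odd_to_even e l D).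
Proof.
move=> nd; rewrite odd_to_evenE.
apply: (core_nondegenerate odd_core odd_countable (dsum_representation rPi)).
  move=> b b' bb; apply: Pi_injective; apply/funext => x.
  by have /(congr1 (fun T => (T (x, 0)).1)) := bb.
move=> b Bb com.
(* Vectors with one zero component test the two off-diagonal blocks separately. *)
have comi x y z : spin (fun xi => 'i%C *: xi) (x, y) -> spin (fun xi => 'i%C *: xi) (Pi b x, z) ->
    z = Pi b y.
  move=> h h'; have P0 := linear_0 (rep_linear b rPi).
  have := com (x, 0) (0, y) (0, z) _ _; rewrite /odd_spin /dsum_diag /= P0.
  by move=> /(_ (conj (spin0 _ _ _ _) h) (conj (spin0 _ _ _ _) h'))/(congr1 snd).
have comj x y z : spin (fun xi => - 'i%C *: xi) (x, y) ->
    spin (fun xi => - 'i%C *: xi) (Pi b x, z) -> z = Pi b y.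
  move=> h h'; have P0 := linear_0 (rep_linear b rPi).
  have := com (0, x) (y, 0) (z, 0) _ _; rewrite /odd_spin /dsum_diag /= P0.
  by move=> /(_ (conj h (spin0 _ _ _ _)) (conj h' (spin0 _ _ _ _)))/(congr1 fst).
apply: nondegenerate_scalar => // s f x xi eta zeta us xs A0f bs Dx Dz.
have comp k := spin_component us xs A0f bs (length_unit (w x k)) (lw x k)
    (@fonb_ne0 _ _ _ (w x) k (wb x)) comi (theta_linear _) Dx Dz.
have comp' k := spin_component us xs A0f bs (length_unit (w x k)) (lw x k)
    (@fonb_ne0 _ _ _ (w x) k (wb x)) comj (theta_linear _) Dx Dz.
have mi (k : 'I_d) : (mm x k)%:C%C *: ('i%C *: entry x 1%g (f x) xi) = 0.
  have := comp' k; rewrite -(comp k) scaleNr scalerN => /addrI/esym/eqP.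
  by rewrite -addr_eq0 -mulr2n -scaler_nat scaler_eq0 pnatr_eq0/= => /eqP.
case: (x =P 1%g) => [x1|x1].
  by have := comp (Ordinal d0); rewrite mi addr0.
have [k mk] := length_eigenvalue x1; have /eqP := mi k.
rewrite !scaler_eq0 (inj_eq (@complexI R)) (negbTE mk)/= => /orP[|/eqP//].
by move=> /eqP i0; have := @cab_i R; rewrite i0 cab0 => /esym/eqP; rewrite oner_eq0.
Qed.

End Eigenfamily.
End Dirac.

(** * Zeta function estimates *)

Section Summable.
Variable R : realType.

Definition summable (I : choiceType) (f : I -> R) :=
  exists M, forall s : seq I, uniq s -> \sum_(x <- s) f x <= M.

Lemma esum_summable (I : choiceType) (f : I -> R) : (forall x, 0 <= f x) ->
  ((\esum_(i in [set: I]) (f i)%:E < +oo)%E <-> summable f).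
Proof.
move=> f0; split=> [lt|[M hM]].
- have ge s : uniq s -> ((\sum_(x <- s) f x)%:E <= \esum_(i in [set: I]) (f i)%:E)%E.
    move=> us; apply: esum_ge; exists [set` s]; first by split => //; exact: finite_seq.
    by rewrite -fsbig_seq// sumEFin.
  exists (fine (\esum_(i in [set: I]) (f i)%:E)) => s us.
  rewrite -lee_fin fineK ?ge// ge0_fin_numE//.
  by apply: esum_ge0 => x _; rewrite lee_fin.
- apply: (@le_lt_trans _ _ M%:E); last exact: ltry.
  apply: ge_ereal_sup => _ [X [finX _] <-].
  by rewrite fsbig_finite//= sumEFin lee_fin hM// fset_uniq.
Qed.

Lemma sum_subseq (I : choiceType) (f : I -> R) (s s' : seq I) : (forall x, 0 <= f x) ->
  uniq s -> uniq s' -> {subset s <= s'} -> \sum_(x <- s) f x <= \sum_(x <- s') f x.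
Proof.
move=> f0 us us' ss'; rewrite [leRHS](bigID (mem s))/=.
have p : perm_eq s [seq x <- s' | x \in s].
  apply: uniq_perm => //; first exact: filter_uniq.
  by move=> x; rewrite mem_filter; have [/ss'->|] := boolP (x \in s).
rewrite (perm_big _ p)/= big_filter lerDl; exact: sumr_ge0.
Qed.

Lemma summable_comp (I J : choiceType) (f : I -> R) (h : J -> I) : injective h -> summable f ->
  summable (f \o h).
Proof.
move=> ih [M hM]; exists M => s us.
by rewrite -(big_map h xpredT f) hM// map_inj_uniq.
Qed.

Lemma summable_le (I : choiceType) (f h : I -> R) (c : R) : 0 <= c -> (forall x, f x <= c * h x) ->
  summable h -> summable f.
Proof.
move=> c0 fh [M hM]; exists (c * M) => s us.
apply: (@le_trans _ _ (\sum_(x <- s) c * h x)); first exact: ler_sum.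
by rewrite -mulr_sumr ler_wpM2l ?hM.
Qed.

Lemma summable_prod (I J : choiceType) (f : I -> R) (h : J -> R) : (forall x, 0 <= f x) ->
  (forall y, 0 <= h y) -> summable f -> summable h -> summable (fun p : I * J => f p.1 * h p.2).
Proof.
move=> f0 h0 [M hM] [N hN]; exists (M * N) => s us.
pose s1 := undup [seq p.1 | p <- s]; pose s2 := undup [seq p.2 | p <- s].
have u1 : uniq s1 by exact: undup_uniq.
have u2 : uniq s2 by exact: undup_uniq.
apply: (@le_trans _ _ (\sum_(p <- [seq (x, y) | x <- s1, y <- s2]) f p.1 * h p.2)).
  apply: sum_subseq => //.
  - by move=> x; rewrite mulr_ge0.
  - by apply: allpairs_uniq => // -[a b] [a' b'] _ _ [-> ->].
  - move=> p ps; apply/allpairsP; exists p; split; last by case: p {ps}.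
      by rewrite mem_undup; apply/mapP; exists p.
    by rewrite mem_undup; apply/mapP; exists p.
rewrite big_allpairs_dep/=.
under eq_bigr do rewrite -mulr_sumr.
rewrite -mulr_suml ler_pM ?hM ?hN//; exact: sumr_ge0.
Qed.

End Summable.

(** * Power weights, dyadic sums and growth of balls *)

Section PowerWeights.
Variable R : realType.
Implicit Types (s t x y : R).

Lemma resolvent_power_sqrt s x y :
  resolvent_power s (Num.sqrt (x ^+ 2 + y ^+ 2)) = (1 + x ^+ 2 + y ^+ 2) `^ (- (s / 2)).
Proof. by rewrite /resolvent_power sqr_sqrtr ?addr_ge0 ?sqr_ge0// addrA. Qed.

Lemma powRN_anti s x y : 0 <= s -> 0 < x -> x <= y -> y `^ (- s) <= x `^ (- s).
Proof.
move=> s0 x0 xy; have y0 : 0 < y := lt_le_trans x0 xy.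
by rewrite !powRN lef_pV2 ?posrE ?powR_gt0// ge0_ler_powR// nnegrE ltW.
Qed.

(** 1 + x^2 + y^2 dominates both 1 + x^2 and 1 + y^2; the exponent is shared between them. *)
Lemma weight_split p q x y : 0 <= p -> 0 <= q ->
  resolvent_power (p + q) (Num.sqrt (x ^+ 2 + y ^+ 2)) <= resolvent_power p x * resolvent_power q y.
Proof.
move=> p0 q0; rewrite resolvent_power_sqrt mulrDl opprD.
have x0 := sqr_ge0 x; have y0 := sqr_ge0 y.
rewrite powRD; last by apply/implyP => _; rewrite gt_eqF//; lra.
by rewrite ler_pM ?powR_ge0// powRN_anti ?divr_ge0//; lra.
Qed.

End PowerWeights.

Section Growth.
Variables (R : realType) (G : choiceType) (d : nat) (m : G -> 'I_d -> R) (N : nat -> {fset G}).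
Hypothesis NP : forall n g, (g \in N n) <-> exists k, `|m g k| <= n%:R.

Lemma count_ball (s : seq (G * 'I_d)) n : uniq s ->
  \sum_(p <- s) (`|m p.1 p.2| <= n%:R)%R%:R <= (d * #|` N n|)%N%:R :> R.
Proof.
move=> us; rewrite -natr_sum ler_nat.
have -> : (\sum_(p <- s) (`|m p.1 p.2| <= n%:R)%R)%N =
    count (fun p => `|m p.1 p.2| <= n%:R) s.
  by rewrite -sum1_count [RHS]big_mkcond/=; apply: eq_bigr => p _; case: ifP.
rewrite -size_filter.
have -> : (d * #|` N n| = size [seq (g, k) | g <- enum_fset (N n), k <- enum 'I_d])%N.
  by rewrite size_allpairs size_enum_ord mulnC.
apply: uniq_leq_size; first exact: filter_uniq.
move=> [g k]; rewrite mem_filter/= => /andP[mk _]; apply/allpairsP; exists (g, k).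
by split => //=; [apply/NP; exists k|rewrite mem_enum].
Qed.

(** j is least with |x| <= 2^j. If j > 0, then |x| > 2^(j-1), which bounds the weight by 2^(-q
    (j-1)); the factor 2^q restores the exponent j and also covers the case j = 0. *)
Lemma dyadic_weight q x : 0 <= q -> exists j : nat, `|x| <= (2 ^ j)%N%:R /\
  resolvent_power q x <= 2 `^ q * (2 `^ (- q)) ^+ j :> R.
Proof.
move=> q0; have ex : exists j, `|x| <= (2 ^ j)%N%:R.
  exists (Num.truncn `|x|).+1; apply/ltW/(lt_le_trans (truncnS_gt _)).
  by rewrite ler_nat ltnW// ltn_expl.
pose j := ex_minn ex; have [hj mj] : `|x| <= (2 ^ j)%N%:R /\ forall i, `|x| <= (2 ^ i)%N%:R -> (j <= i)%N.
  by rewrite /j; case: ex_minnP.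
exists j; split => //; case: j hj mj => [|j] hj mj.
  rewrite expr0 mulr1; apply: le_trans (resolvent_power_le1 x q0) _.
  by rewrite -[leLHS](powRr0 2) ler_powR// ler1n.
have lt : (2 ^ j)%N%:R < `|x| by rewrite ltNge; apply/negP => /mj; rewrite ltnn.
rewrite exprS mulrA -powRD; last by apply/implyP => _; rewrite pnatr_eq0.
rewrite subrr powRr0 mul1r -powR_mulrn ?powR_ge0// -powRrM.
have e0 : 0 < ((2 ^ j)%N%:R : R) by rewrite ltr0n expn_gt0.
have x2 : ((2 ^ j)%N%:R) ^+ 2 <= 1 + x ^+ 2.
  apply: (@le_trans _ _ (x ^+ 2)); last by rewrite lerDr.
  by rewrite -(real_normK (num_real x)) ler_pXn2r ?nnegrE ?ler0n ?normr_ge0//; exact: ltW.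
have x20 : 0 < ((2 ^ j)%N%:R : R) ^+ 2 by rewrite exprn_gt0.
apply: le_trans (powRN_anti (divr_ge0 q0 (ler0n _ 2)) x20 x2) _.
rewrite natrX -exprM -!powR_mulrn// -powRrM natrM le_eqVlt; apply/orP; left; apply/eqP.
by congr powR; field.
Qed.

(** At dyadic level j there are at most d C 2^(q' j) pairs, each of weight at most 2^q 2^(-q j); the
    ratio x = 2^(q' - q) of the resulting geometric series is below 1. *)
Lemma summable_growth (q q' C : R) : 0 <= q' -> q' < q -> 0 <= C ->
  (forall n, (0 < n)%N -> (#|` N n|)%:R <= C * n%:R `^ q') ->
  summable (fun p : G * 'I_d => resolvent_power q (m p.1 p.2)).
Proof.
move=> q'0 q'q C0 hN; have q0 : 0 <= q by apply: le_trans (ltW q'q).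
pose x : R := 2 `^ (q' - q); pose a : R := 2 `^ (- q).
have x0 : 0 <= x by exact: powR_ge0.
have x1 : x < 1.
  rewrite /x -opprB powRN invf_lt1 ?powR_gt0//.
  rewrite -[ltLHS](powRr0 2) /powR pnatr_eq0/= mul0r ltr_expR mulr_gt0 ?subr_gt0//.
  by rewrite ln_gt0// ltr1n.
have a0 : 0 <= a by exact: powR_ge0.
exists (2 `^ q * (d%:R * C) * (1 - x)^-1) => s us.
have /choice[j hj] := fun p : G * 'I_d => dyadic_weight (m p.1 p.2) q0.
pose J := \max_(p <- s) (j p).+1.
apply: (@le_trans _ _ (\sum_(p <- s) \sum_(i < J) 2 `^ q * (a ^+ i * (`|m p.1 p.2| <= (2 ^ i)%N%:R)%R%:R))).
  rewrite big_seq [leRHS]big_seq; apply: ler_sum => p ps.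
  have jJ : (j p < J)%N by exact: (@leq_bigmax_seq _ s xpredT (fun p => (j p).+1) p ps isT).
  rewrite (bigD1 (Ordinal jJ))//= (hj p).1 mulr1.
  by apply: ler_wpDr (hj p).2; apply: sumr_ge0 => i _; rewrite !mulr_ge0 ?powR_ge0 ?exprn_ge0.
rewrite exchange_big/=.
apply: (@le_trans _ _ (\sum_(i < J) 2 `^ q * (d%:R * C) * x ^+ i)).
  apply: ler_sum => i _; rewrite -mulr_sumr -mulrA ler_wpM2l ?powR_ge0// -mulr_sumr.
  apply: le_trans (ler_wpM2l (exprn_ge0 _ a0) (count_ball _ us)) _.
  rewrite natrM mulrCA -mulrA ler_wpM2l//.
  apply: le_trans (ler_wpM2l (exprn_ge0 _ a0) (hN _ _)) _; first by rewrite expn_gt0.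
  rewrite mulrCA ler_wpM2l// /a /x natrX -!powR_mulrn ?powR_ge0// -!powRrM -powRD; last first.
    by apply/implyP => _; rewrite pnatr_eq0.
  by rewrite le_eqVlt; apply/orP; left; apply/eqP; congr powR; ring.
rewrite -mulr_sumr ler_wpM2l ?mulr_ge0 ?powR_ge0// -[leRHS]mul1r ler_pdivlMr ?subr_gt0//.
have -> : (\sum_(i < J) x ^+ i) * (1 - x) = 1 - x ^+ J.
  by rewrite -opprB mulrN mulrC -subrX1 opprB.
by rewrite gerBl exprn_ge0.
Qed.

End Growth.

Section ZetaBounds.
Variables (R : realType) (G : choiceType) (d : nat) (m : G -> 'I_d -> R) (N : nat -> {fset G}).
Hypothesis NP : forall n g, (g \in N n) <-> exists k, `|m g k| <= n%:R.
Variables (lam c : nat -> R).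
Hypotheses (c0 : forall n, 0 <= c n) (d0 : (0 < d)%N).

(** In the application [c n] is ||e_n||^2, so that zero vectors of the eigenbasis contribute
    nothing. *)
Definition product_weight s (p : nat * G * 'I_d) :=
  resolvent_power s (Num.sqrt (lam p.1.1 ^+ 2 + m p.1.2 p.2 ^+ 2)) * c p.1.1.

Lemma product_weight_ge0 s p : 0 <= product_weight s p.
Proof. by rewrite mulr_ge0// ltW// resolvent_power_gt0. Qed.

Lemma product_weight_summable (p q q' C : R) : 0 <= p -> 0 <= q' -> q' < q -> 0 <= C ->
  (forall n, (0 < n)%N -> (#|` N n|)%:R <= C * n%:R `^ q') ->
  summable (fun n => resolvent_power p (lam n) * c n) -> summable (product_weight (p + q)).
Proof.
move=> p0 q'0 q'q C0 hN hp; have q0 : 0 <= q by apply: le_trans (ltW q'q).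
have rge t x : 0 <= resolvent_power t x :> R by rewrite ltW// resolvent_power_gt0.
pose h (x : nat * G * 'I_d) := (x.1.1, (x.1.2, x.2)).
have ih : injective h by move=> [[n g] k] [[n' g'] k'] [-> -> ->].
have := summable_comp ih (summable_prod (fun n => mulr_ge0 (rge p (lam n)) (c0 n))
  (fun x => rge q (m x.1 x.2)) hp (summable_growth NP q'0 q'q C0 hN)).
apply: summable_le ler01 _ => -[[n g] k] /=; rewrite mul1r /product_weight/= mulrAC.
by rewrite ler_wpM2r// weight_split.
Qed.

Variables (s a b : R).
Hypotheses (s0 : 0 <= s) (b0 : 0 < b).
Hypothesis bN : forall n, (0 < n)%N -> b * n%:R `^ a <= (#|` N n|)%:R.
Hypothesis hs : summable (product_weight s).

(** For each n one term is kept per g in the ball of radius f n, with an eigenvalue of modulus at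
    most f n. The radius is left free: it follows lam_n in [factor_summable] and is an arbitrary
    constant in [growth_le_exponent]. *)
Lemma ball_mass : exists M, forall (t : seq nat) (f : nat -> nat) (T : nat -> R), uniq t ->
  (forall n, (0 < f n)%N) -> (forall n, 1 + lam n ^+ 2 + (f n)%:R ^+ 2 <= T n) ->
  \sum_(n <- t) b * (f n)%:R `^ a * T n `^ (- (s / 2)) * c n <= M.
Proof.
have [M hM] := hs; exists M => t f T ut f0 hT.
have /choice[k hk] : forall p : nat * G, exists k : 'I_d, p.2 \in N p.1 -> `|m p.2 k| <= p.1%:R.
  move=> [n g] /=; have [/NP[k mk]|_] := boolP (g \in N n); first by exists k.
  by exists (Ordinal d0).
pose F n g := (n, g, k (f n, g)).
have uF : uniq [seq F n g | n <- t, g <- enum_fset (N (f n))].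
  apply: allpairs_uniq_dep => //.
  by move=> [x y] [x' y'] _ _ /= [-> ->].
apply: le_trans (hM _ uF); rewrite big_allpairs_dep/=; apply: ler_sum => n _.
rewrite big_seq; apply: (@le_trans _ _ (\sum_(g <- enum_fset (N (f n)) | g \in enum_fset (N (f n))) T n `^ (- (s / 2)) * c n)).
  rewrite -big_seq big_const_seq count_predT iter_addr_0 -mulrA -[leRHS]mulr_natl.
  by rewrite ler_wpM2r ?mulr_ge0 ?powR_ge0// bN.
apply: ler_sum => g gN; rewrite /product_weight/= ler_wpM2r//.
rewrite resolvent_power_sqrt powRN_anti ?divr_ge0//.
  by rewrite addrAC -addrA ltr_pwDl ?addr_ge0 ?sqr_ge0.
apply: le_trans (hT n); rewrite lerD2l -(real_normK (num_real (m _ _))).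
by rewrite ler_pXn2r ?nnegrE ?normr_ge0//; exact: (hk (f n, g)).
Qed.

Lemma factor_summable : 0 <= a -> summable (fun n => resolvent_power (s - a) (lam n) * c n).
Proof.
move=> a0; have [M hM] := ball_mass.
(* Since r n >= 1, its integer part satisfies r n / 2 <= f n <= r n. *)
pose r n := Num.sqrt (1 + lam n ^+ 2); pose f n := Num.truncn (r n).
have r1 n : 1 <= r n by rewrite -sqrtr1 ler_wsqrtr// lerDl sqr_ge0.
have r2 n : r n ^+ 2 = 1 + lam n ^+ 2 by rewrite sqr_sqrtr// addr_ge0 ?sqr_ge0.
have f0 n : (0 < f n)%N by rewrite truncn_gt0.
have fr n : (f n)%:R <= r n by rewrite truncn_le// (le_trans ler01).
have rf n : r n <= 2 * (f n)%:R.
  apply: ltW; apply: lt_le_trans (truncnS_gt _) _; rewrite -natrM ler_nat -/(f n).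
  by rewrite mul2n -addnn -addn1 leq_add2l.
(* The ball gives b, replacing f n by r n / 2 gives 2^(-a), and the bound T n = 2 (1 + lam_n^2)
   gives 2^(-s/2). *)
pose K := b * 2 `^ (- a) * 2 `^ (- (s / 2)).
have K0 : 0 < K by rewrite !mulr_gt0 ?powR_gt0.
exists (K^-1 * M) => t ut; rewrite -ler_pdivrMl ?invr_gt0// invrK mulr_sumr.
have hT n : 1 + lam n ^+ 2 + (f n)%:R ^+ 2 <= 2 * (1 + lam n ^+ 2).
  rewrite mulr_natl mulr2n lerD2l -r2 ler_pXn2r ?nnegrE//.
  by rewrite (le_trans ler01).
apply: le_trans (hM t f _ ut f0 hT); apply: ler_sum => n _; rewrite mulrA ler_wpM2r//.
have p0 : 0 < 1 + lam n ^+ 2 by rewrite ltr_pwDl ?sqr_ge0.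
rewrite powRM ?(ltW p0)// /K /resolvent_power.
have -> : - ((s - a) / 2) = a / 2 + - (s / 2) by field.
rewrite powRD; last by apply/implyP => _; rewrite gt_eqF.
have -> : (1 + lam n ^+ 2) `^ (a / 2) = r n `^ a.
  by rewrite -r2 -powR_mulrn ?(le_trans ler01)// -powRrM; congr powR; field.
rewrite -!mulrA ler_wpM2l ?(ltW b0)// !mulrA ler_wpM2r ?powR_ge0//.
rewrite mulrAC ler_wpM2r ?powR_ge0// powRN mulrC ler_pdivrMr ?powR_gt0//.
rewrite -powRM// mulrC ge0_ler_powR// ?nnegrE ?mulr_ge0//.
by rewrite (le_trans ler01).
Qed.

(** A single n with c n > 0 and the balls of all radii j make j^(a - s) bounded in j. This
    guarantees that zeta_D is evaluated at an exponent s - a that is not negative. *)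
Lemma growth_le_exponent : (exists n, 0 < c n) -> a <= s.
Proof.
move=> [n cn]; have [M hM] := ball_mass; rewrite leNgt; apply/negP => sa.
pose K := b * (2 + lam n ^+ 2) `^ (- (s / 2)) * c n.
have L0 : 0 < 2 + lam n ^+ 2 by rewrite ltr_pwDl ?sqr_ge0.
have K0 : 0 < K by rewrite !mulr_gt0 ?powR_gt0.
have key j : (0 < j)%N -> j%:R `^ (a - s) <= K^-1 * M.
  move=> j0; rewrite -ler_pdivrMl ?invr_gt0// invrK.
  have hT i : 1 + lam i ^+ 2 + j%:R ^+ 2 <= (2 + lam i ^+ 2) * j%:R ^+ 2 :> R.
    have j1 : 1 <= j%:R ^+ 2 :> R by rewrite -natrX ler1n expn_gt0 j0.
    have := sqr_ge0 (lam i); nra.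
  apply: le_trans (hM [:: n] (fun=> j) _ erefl (fun=> j0) hT); rewrite big_seq1.
  rewrite powRM ?(ltW L0) ?sqr_ge0// powRD; last by apply/implyP => _; rewrite pnatr_eq0 gt_eqF.
  rewrite -[j%:R ^+ 2]powR_mulrn// -powRrM le_eqVlt; apply/orP; left; apply/eqP.
  have -> : 2 * - (s / 2) = - s by field.
  rewrite /K; ring.
have as0 : 0 < a - s by rewrite subr_gt0.
pose T := Num.max 1 (K^-1 * M + 1).
pose j := (Num.truncn (T `^ (a - s)^-1)).+1.
have T0 : 0 < T by rewrite lt_max ltr01.
have := key j isT; rewrite leNgt => /negP; apply.
apply: (@lt_le_trans _ _ T); first by rewrite /T lt_max orbC ltrDl ltr01.
have -> : T = (T `^ (a - s)^-1) `^ (a - s) by rewrite -powRrM mulVf ?gt_eqF// powRr1// ltW.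
by apply: ge0_ler_powR; rewrite ?nnegrE ?powR_ge0 ?(ltW as0)// ltW// truncnS_gt.
Qed.

End ZetaBounds.

Section GrowthExponent.
Variables (R : realType) (kappa : nat -> nat).
Hypothesis k1 : forall n, (0 < kappa n)%N.
Let ratio n : R := ln (kappa n)%:R / ln n%:R.

Lemma kappa_le n (q : R) : (1 < n)%N -> ratio n <= q -> (kappa n)%:R <= n%:R `^ q.
Proof.
move=> n1; have l0 : 0 < ln n%:R :> R by rewrite ln_gt0// ltr1n.
rewrite /ratio ler_pdivrMr// -ln_powR ler_ln// posrE ?ltr0n// powR_gt0// ltr0n.
exact: ltn_trans n1.
Qed.

Lemma kappa_ge n (q : R) : (1 < n)%N -> q <= ratio n -> n%:R `^ q <= (kappa n)%:R.
Proof.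
move=> n1; have l0 : 0 < ln n%:R :> R by rewrite ln_gt0// ltr1n.
rewrite /ratio ler_pdivlMr// -ln_powR ler_ln// posrE ?ltr0n// powR_gt0// ltr0n.
exact: ltn_trans n1.
Qed.

Lemma ratio_ge0 n : 0 <= ratio n.
Proof.
case: n => [|n]; first by rewrite /ratio [ln 0%:R]ln0// invr0 mulr0.
by rewrite divr_ge0// ln_ge0// ler1n.
Qed.

(** The ratios are non-negative, and kappa n <= C n^k bounds them by |ln C| / ln 2 + k for n >= 2;
    at n = 0 and n = 1 the quotient has the default value 0 of division by zero. *)
Lemma limn_esup_ratio : (exists (C : R) (k : nat), forall n, (0 < n)%N -> (kappa n)%:R <= C * n%:R ^+ k) ->
  exists2 delta : R, 0 <= delta & limn_esup (fun n => (ratio n)%:E) = delta%:E.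
Proof.
move=> [C [k hC]]; set L := limn_esup _.
have L0 : (0%:E <= L)%E.
  apply: le_ereal_inf_tmp => _ [P [j _ jP] <-]; apply: (@le_trans _ _ (ratio j)%:E).
    by rewrite lee_fin ratio_ge0.
  by apply: ereal_sup_ubound; exists j => //; apply: jP => /=.
have C0 : 0 < C by have := hC 1%N isT; rewrite expr1n mulr1; apply: lt_le_trans; rewrite ltr0n.
pose M := `|ln C| / ln 2 + k%:R.
have LM : (L <= M%:E)%E.
  apply: le_trans (ereal_inf_lbound _) _; first by exists [set n | (2 <= n)%N] => //; exists 2%N.
  apply: ge_ereal_sup => _ [n /= n2 <-]; rewrite lee_fin.
  have l20 : 0 < ln 2 :> R by rewrite ln_gt0// ltr1n.
  have n0 : (0 < n)%N by exact: leq_trans n2.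
  have l0 : 0 < ln n%:R :> R by rewrite ln_gt0// ltr1n.
  rewrite /ratio ler_pdivrMr// /M mulrDl.
  have : ln (kappa n)%:R <= ln (C * n%:R ^+ k) :> R.
    by rewrite ler_ln ?posrE ?ltr0n// ?hC// mulr_gt0// exprn_gt0// ltr0n.
  rewrite lnM ?posrE ?exprn_gt0 ?ltr0n// lnXn ?ltr0n// -(mulr_natl (ln n%:R)) => h.
  apply: le_trans h _; rewrite lerD2r; apply: le_trans (ler_norm _) _.
  rewrite -mulrA ler_peMr// mulrC ler_pdivlMr// mul1r ler_ln ?posrE ?ltr0n//.
  by rewrite ler_nat.
have Lf : L \is a fin_num by rewrite ge0_fin_numE// (le_lt_trans LM)// ltry.
by exists (fine L); rewrite ?fineK// -lee_fin fineK.
Qed.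

(** The bound holds with constant 1 from some K on; the finitely many smaller n are absorbed in S. K
    is at least 2, so that ln n > 0. *)
Lemma kappa_upper (delta q : R) : limn_esup (fun n => (ratio n)%:E) = delta%:E -> 0 <= delta -> delta < q ->
  exists2 C : R, 0 <= C & forall n, (0 < n)%N -> (kappa n)%:R <= C * n%:R `^ q.
Proof.
move=> dE delta0 dq; have q0 : 0 <= q by apply: le_trans (ltW dq).
have : (limn_esup (fun n => (ratio n)%:E) < q%:E)%E by rewrite dE lte_fin.
move=> /ereal_inf_lt[_ [P [j _ jP] <-]] supP.
pose K := (maxn j 2); pose S := (\sum_(i < K) kappa i)%N.
exists (1 + S%:R); first by rewrite addr_ge0.
move=> n n0; have n1 : 1 <= n%:R `^ q :> R.
  by rewrite -[leLHS](powRr0 n%:R) ler_powR// ler1n.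
have [nK|Kn] := ltnP n K.
  apply: (@le_trans _ _ (1 + S%:R)); last by rewrite ler_peMr// addr_ge0.
  apply: (@le_trans _ _ S%:R); last by rewrite lerDr.
  by rewrite ler_nat /S (bigD1 (Ordinal nK))//= leq_addr.
apply: (@le_trans _ _ (n%:R `^ q)); last by rewrite ler_peMl ?powR_ge0// lerDl.
apply: kappa_le; first by apply: leq_trans Kn; rewrite leq_maxr.
rewrite -lee_fin; apply/ltW/(le_lt_trans _ supP)/ereal_sup_ubound; exists n => //.
by apply: jP => /=; apply: leq_trans Kn; rewrite leq_maxl.
Qed.

(** Here convergence enters: a limsup bounds kappa from below only along a subsequence. Below K the
    constant K^(-a) does, since kappa n >= 1. The alternative a = 0 covers delta = 0. *)
Lemma kappa_lower (delta a : R) : limn_esup (fun n => (ratio n)%:E) = delta%:E -> cvgn ratio ->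
  0 <= a -> a < delta \/ a = 0 ->
  exists2 b : R, 0 < b & forall n, (0 < n)%N -> b * n%:R `^ a <= (kappa n)%:R.
Proof.
move=> dE cr a0 [ad|->]; last first.
  by exists 1 => // n _; rewrite powRr0 mul1r ler1n.
have /cvg_ex[/= dl rd] := cr.
have rd' : (ratio n)%:E @[n --> \oo] --> dl%:E by apply: cvg_EFin => //; exact: nearW.
have [_ h] := cvg_limn_einf_sup rd'.
have ddl : delta = dl by move: dE; rewrite h => -[].
have adl : a < dl by rewrite -ddl.
have [j _ hj] := cvgr_gt dl rd _ adl.
pose K := maxn j 2; have K0 : (0 < K)%N by rewrite (leq_trans _ (leq_maxr _ _)).
have Kp : 0 < (K%:R : R) `^ a by rewrite powR_gt0// ltr0n.
exists ((K%:R `^ a)^-1); first by rewrite invr_gt0.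
move=> n n0; rewrite ler_pdivrMl//.
have [nK|Kn] := ltnP n K.
  apply: (@le_trans _ _ (K%:R `^ a)); last by rewrite ler_peMr ?powR_ge0// ler1n.
  by rewrite ge0_ler_powR ?nnegrE// ler_nat ltnW.
apply: (@le_trans _ _ (kappa n)%:R).
  apply: kappa_ge; first by apply: leq_trans Kn; rewrite leq_maxr.
  by apply/ltW/hj => /=; apply: leq_trans Kn; rewrite leq_maxl.
rewrite ler_peMl// -[leLHS](powRr0 K%:R) ler_powR// ler1n//.
Qed.

End GrowthExponent.

(** * Comparison of the abscissas *)

Section AbscissaComparison.
Variables (R : realType) (G : groupType) (V H K : hilbertType R) (l : G -> V -> V).
Variables (d : nat) (w : G -> 'I_d -> V) (m : G -> 'I_d -> R) (lam c : nat -> R).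
Variables (D : set (H * H)) (D' : set (K * K)).
Hypotheses (wb : forall g, fonb (w g)) (ll : forall g, linear (l g)) (d0 : (0 < d)%N).
Hypothesis lw : forall g k, l g (w g k) = (m g k)%:C%C *: w g k.
Hypotheses (lp : proper_length l) (lg : polynomial_growth l).
Hypotheses (c0 : forall n, 0 <= c n) (cn : exists n, 0 < c n).
Hypothesis zD : forall t, 0 <= t ->
  ((zeta D t < +oo)%E <-> summable (fun n => resolvent_power t (lam n) * c n)).
Hypothesis zD' : forall t, 0 <= t -> ((zeta D' t < +oo)%E <-> summable (product_weight m lam c t)).

Let N n := fset_set (length_ball l n).

Lemma length_fballP n g : (g \in N n) <-> exists k, `|m g k| <= n%:R.
Proof.
have [fin _] := lg; rewrite /N in_fset_set//; split => [/[!inE]|h]; first exact: (length_ballP _ _ wb ll lw).1.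
by rewrite inE; exact: (length_ballP _ _ wb ll lw).2.
Qed.

Lemma card_ball_gt0 n : (0 < card_ball l n)%N.
Proof.
have k0 := Ordinal d0; rewrite /card_ball cardfs_gt0; apply/fset0Pn; exists 1%g.
apply/length_fballP; exists k0; suff -> : m 1%g k0 = 0 by rewrite normr0 ler0n.
have [h _ _] := lp; have /esym/eqP := lw 1%g k0; rewrite ((h 1%g).2 erefl) scaler_eq0.
move=> /orP[|/eqP/(@fonb_ne0 _ _ _ (w 1%g) k0 (wb 1%g))//].
by rewrite (inj_eq (@complexI R)) => /eqP.
Qed.

Lemma growth_dim_real : exists2 delta : R, 0 <= delta & growth_dim l = delta%:E.
Proof. by apply: limn_esup_ratio card_ball_gt0 _; case: lg. Qed.

Lemma zeta_upper p q : 0 <= p -> (growth_dim l < q%:E)%E -> (zeta D p < +oo)%E -> (zeta D' (p + q) < +oo)%E.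
Proof.
move=> p0; have [delta delta0 dE] := growth_dim_real; rewrite dE lte_fin => dq zp.
pose q' := (delta + q) / 2.
have q'0 : 0 <= q' by rewrite /q'; lra.
have [|C C0 hC] := kappa_upper (q := q') card_ball_gt0 dE delta0; first by rewrite /q'; lra.
apply/zD'; first by lra.
apply: (product_weight_summable length_fballP c0 p0 q'0 _ C0 hC); first by rewrite /q'; lra.
exact/zD.
Qed.

Lemma abs_zeta_upper : finitely_summable D ->
  finitely_summable D' /\ (abs_zeta D' <= abs_zeta D + growth_dim l)%E.
Proof.
move=> [p [p0 zp]]; have [delta delta0 dE] := growth_dim_real; split.
  exists (p + (delta + 1)); split; first lra.
  by apply: zeta_upper => //; rewrite ?dE ?lte_fin ?(ltW p0)//; lra.
rewrite dE -leeBlDr//; apply: le_ereal_inf_tmp => _ [t [t0 zt] <-].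
rewrite leeBlDr//; apply/lee_addgt0Pr => eps e0; apply: ereal_inf_lbound.
exists (t + (delta + eps)); last by rewrite !EFinD addeA.
split; first lra.
by apply: zeta_upper => //; rewrite ?dE ?lte_fin ?(ltW t0)//; lra.
Qed.

Lemma abs_zeta_lower : cvgn (growth_ratio l) -> (abs_zeta D + growth_dim l <= abs_zeta D')%E.
Proof.
move=> cr; have [delta delta0 dE] := growth_dim_real; rewrite dE.
have low a : 0 <= a -> a < delta \/ a = 0 -> exists2 b : R, 0 < b &
    forall n, (0 < n)%N -> b * n%:R `^ a <= (#|` N n|)%:R.
  by move=> a0 h; exact: (kappa_lower card_ball_gt0 dE cr a0 h).
apply: le_ereal_inf_tmp => _ [s [s0 zs] <-].
have hs := (zD' (ltW s0)).1 zs.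
rewrite -leeBrDr//; apply/lee_addgt0Pr => eps e0.
(* a approximates delta from below; the maximum with 0 keeps it non-negative when eps > delta. *)
pose a := Num.max 0 (delta - eps).
have a0 : 0 <= a by rewrite le_max lexx.
have ad : a < delta \/ a = 0.
  by rewrite /a; case: (lerP (delta - eps) 0) => h; [right|left; lra].
(* [growth_le_exponent] gives only a weak inequality, so it is applied to the midpoint of a and
   delta. If delta = 0, then a = 0 < s. *)
have as_ : a < s.
  have [dp|] := ltP 0 delta; last by move=> h; case: ad => // ?; lra.
  have a'd : (a + delta) / 2 < delta /\ a < (a + delta) / 2 by case: ad => h; lra.
  have [||b b0 hb] := low ((a + delta) / 2); [lra|by left; lra|].
  by have := growth_le_exponent length_fballP c0 d0 (ltW s0) b0 hb hs cn; lra.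
have [b b0 hb] := low a a0 ad.
have := factor_summable length_fballP c0 d0 (ltW s0) b0 hb hs a0.
move=> /(zD (_ : 0 <= s - a))-/(_ _) zt.
apply: (@le_trans _ _ (s - a)%:E).
  apply: ereal_inf_lbound; exists (s - a) => //; split; first by rewrite subr_gt0.
  by apply: zt; rewrite subr_ge0 ltW.
by rewrite -EFinB -EFinD lee_fin; have : delta - eps <= a; [rewrite le_max lexx orbT|lra].
Qed.

End AbscissaComparison.

Section ZetaSummable.
Variables (R : realType) (G : groupType) (H V K : hilbertType R).
Variables (e : H -> G -> V -> K) (d : nat) (ev : nat -> H) (lam : nat -> R).
Variables (w : G -> 'I_d -> V) (m : G -> 'I_d -> R).
Hypotheses (he : tensor3 e) (eo : osys ev) (ce : complete_sys ev) (wb : forall g, fonb (w g)).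
Hypothesis cI : countable [set: nat * G * 'I_d].

Let c n := nr (ev n) ^+ 2.

Lemma zeta_base t : 0 <= t ->
  ((zeta (diag_rel ev lam) t < +oo)%E <-> summable (fun n => resolvent_power t (lam n) * c n)).
Proof.
move=> t0; rewrite (zeta_diag eo ce t0 eo (complete_total eo ce) (m := lam)).
  by apply: esum_summable => n; rewrite mulr_ge0 ?sqr_ge0// ltW// resolvent_power_gt0.
(* Each [ev n] is an eigenvector by itself; the partner for [- lam n] is the zero vector. *)
move=> n; exists (ev n), 0, 1, 0; split.
- by rewrite scale1r scaler0 addr0.
- exact: diag_rel_e.
- by move=> k; rewrite scaler0/= inner0l mulr0.
Qed.

Lemma zeta_even_summable S g t :
  square_core S (eigenfamily e ev w) g (dirac_modulus lam m) -> 0 <= t ->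
  ((zeta (closure S) t < +oo)%E <-> summable (product_weight m lam c t)).
Proof.
move=> sc t0; rewrite (core_zeta sc cI t0) -esum_summable; last first.
  by apply: product_weight_ge0 => n; exact: sqr_ge0.
under eq_esum do rewrite (eigenfamily_nr he ev wb).
by [].
Qed.

(** The boolean index of the two summands doubles every term, which does not affect summability. *)
Lemma zeta_odd_summable S g t :
  square_core S (odd_family e ev w) g (fun p => dirac_modulus lam m p.1) -> 0 <= t ->
  ((zeta (closure S) t < +oo)%E <-> summable (product_weight m lam c t)).
Proof.
move=> sc t0; have cIb : countable [set: nat * G * 'I_d * bool].
  by rewrite -setXTT; apply: countableX => //; exact: finite_set_countable.
rewrite (core_zeta sc cIb t0) esum_summable; last first.
  by move=> p; rewrite mulr_ge0 ?sqr_ge0// ltW// resolvent_power_gt0.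
have fE p : resolvent_power t (dirac_modulus lam m p.1) * nr (odd_family e ev w p) ^+ 2 =
    product_weight m lam c t p.1 * 1.
  by rewrite (odd_family_nr he ev wb) mulr1.
have pw0 := product_weight_ge0 m lam (fun n => sqr_ge0 (nr (ev n))) t.
split=> h.
- have ih : injective (fun p : nat * G * 'I_d => (p, true)) by move=> p q [].
  have := summable_comp ih h; apply: summable_le ler01 _ => p.
  by rewrite mul1r [leRHS](fE (p, true)) mulr1.
- have s1 : summable (fun _ : bool => 1 : R).
    exists (\sum_(b <- [:: true; false]) 1) => s us.
    by apply: sum_subseq => // -[].
  have := summable_prod pw0 (fun _ => ler01) h s1.
  by apply: summable_le ler01 _ => p /=; rewrite fE !mulr1 mul1r.
Qed.

End ZetaSummable.

Theorem theorem3p7 (R : realType) (A : cstarType R) (G : groupType)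
    (rho : G -> A -> A) (sigma : G -> G -> A)
    (H : hilbertType R) (A0 : set A) (pi : A -> H -> H) (D : set (H * H))
    (V : hilbertType R) (l : G -> V -> V)
    (* L = l^2(G), W = H (x) L, K = W (x) V *)
    (L W K : hilbertType R) (delta : G -> L)
    (t : H -> L -> W) (t' : W -> V -> K)
    (* B is the reduced twisted crossed product, u a x is a delta_x *)
    (B : cstarType R) (j : B -> W -> W) (u : A -> G -> B) :
  twisting_pair rho sigma ->
  spectral_triple A0 pi D ->
  faithful pi ->
  smooth A0 rho sigma ->
  (forall a, A0 a -> forall y, exists M : R, forall x, exists C : H -> H,
     commutator_extension D (pi (rho x a ** sigma x y)) C /\ opnorm C <= M) ->
  finite_dimensional V -> (exists v : V, v <> 0) ->
  (forall g, self_adjoint_operator (l g)) ->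
  proper_length l ->
  translation_bounded l ->
  ell2 delta -> hilbert_tensor t -> hilbert_tensor t' ->
  reduced_crossed_product rho sigma pi delta t j u ->
  let e := fun xi g v => t' (t xi (delta g)) v in
  exists Pi : B -> K -> K,
    [/\ representation Pi,
        forall a x xi y v,
          Pi (u a x) (e xi y v) = e (induced_entry rho sigma pi x y a xi) (x * y)%g v,
        (* odd to even *)
        even_spectral_triple (Cc u A0) (fun b => dsum_diag (Pi b))
          (odd_to_even e l D) (@standard_grading R K) /\
        (nondegenerate A0 pi D ->
         nondegenerate (Cc u A0) (fun b => dsum_diag (Pi b))
           (odd_to_even e l D)),
        (* even to odd *)
        forall chi, even_spectral_triple A0 pi D chi ->
          spectral_triple (Cc u A0) Pi (even_to_odd e l D chi) /\
          (nondegenerate A0 pi D ->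
           nondegenerate (Cc u A0) Pi (even_to_odd e l D chi)) &
        (* finite summability *)
        finitely_summable D -> polynomial_growth l ->
          [/\ finitely_summable (odd_to_even e l D),
              (abs_zeta (odd_to_even e l D) <= abs_zeta D + growth_dim l)%E &
              cvgn (growth_ratio l) ->
              abs_zeta (odd_to_even e l D) = (abs_zeta D + growth_dim l)%E] /\
          forall chi, even_spectral_triple A0 pi D chi ->
            [/\ finitely_summable (even_to_odd e l D chi),
                (abs_zeta (even_to_odd e l D chi)
                   <= abs_zeta D + growth_dim l)%E &
                cvgn (growth_ratio l) ->
                abs_zeta (even_to_odd e l D chi)
                  = (abs_zeta D + growth_dim l)%E]].
Proof.
move=> tp st fp sm hC fV nV lsa lp ltb hd ht ht' cp e.
have rp := triple_representation st; have SA := triple_self_adjoint st.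
have he : tensor3 e := tensor3_of_tensors hd ht ht'.
have [d [v0 vb]] := finite_onb fV.
(* An orthonormal basis indexed by the empty type would force V = 0. *)
have d0 : (0 < d)%N.
  rewrite lt0n; apply/eqP => dz; have [v] := nV; apply; apply: vb.2 => i.
  by have := ltn_ord i; rewrite [X in (_ < X)%N]dz.
have [rj jn jE udense] := cp.
have [Pi [rPi PiT]] := amplify_representation ht' vb rj.
have PiE a x xi y v : Pi (u a x) (e xi y v) = e (induced_entry rho sigma pi x y a xi) (x * y)%g v.
  by rewrite /e PiT jE.
have Pib := amplification_bound ht' nV rj jn PiT.
have /choice[w /choice[m wm]] : forall g, exists w m, fonb (w : 'I_d -> V) /\
    forall k, l g (w k) = (m k)%:C%C *: w k.
  by move=> g; exact: self_adjoint_eigenbasis vb (lsa g).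
have wb g : fonb (w g) by case: (wm g).
have lw g k : l g (w g k) = (m g k)%:C%C *: w g k by case: (wm g).
have ll := l_linear lsa.
have [T [[_ [E [mu [SR qT]]]] cT]] := triple_compact st.
have [ev [lam [eo ce De fin]]] := compact_eigenbasis SA SR cT qT (triple_separable_space st).
have sB : separable_space B.
  apply: (crossed_separable tp rp he vb rPi PiE Pib udense (triple_separable_algebra st)).
  exact: (proper_countable wb ll lw lp d0).
have dB : dense (Cc u A0).
  exact: (Cc_dense tp rp he vb rPi PiE Pib udense (triple_subalgebra st) (triple_dense st)).
have c0 n : 0 <= nr (ev n) ^+ 2 by exact: sqr_ge0.
(* If all [ev n] vanished, then H would be 0 and the faithful pi would identify 1 with 0 in A. *)
have cn : exists n, 0 < nr (ev n) ^+ 2.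
  apply: contrapT => h; have h0 xi : xi = 0 :> H.
    apply: ce => n; suff -> : ev n = 0 by rewrite inner0r.
    apply: nr_eq0; apply/eqP/negP => /negP e0; apply: h; exists n.
    by rewrite exprn_gt0// lt_neqAle eq_sym e0 nr_ge0.
  have /eqP := cone_neq0 (s := A); apply; apply: fp; apply/funext => xi.
  by rewrite [LHS]h0 [RHS]h0.
have cI : countable [set: nat * G * 'I_d] := eigenfamily_countable lsa lp d0 wb lw.
have zD s : 0 <= s -> (zeta D s < +oo)%E <->
    summable (fun n => resolvent_power s (lam n) * nr (ev n) ^+ 2).
  by rewrite De; exact: zeta_base.
(* Both operators D~ have the same summability criterion, so the comparison with D is made once for
   both. *)
have abs (K' : hilbertType R) (D' : set (K' * K')) :
    (forall s, 0 <= s -> (zeta D' s < +oo)%E <-> summable (product_weight m lam (fun n => nr (ev n) ^+ 2) s)) ->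
    finitely_summable D -> polynomial_growth l ->
    [/\ finitely_summable D', (abs_zeta D' <= abs_zeta D + growth_dim l)%E &
        cvgn (growth_ratio l) -> abs_zeta D' = (abs_zeta D + growth_dim l)%E].
  move=> zD' fs pg; have [fs' le] := abs_zeta_upper wb ll d0 lw lp pg c0 zD zD' fs.
  split => // cr; apply/eqP; rewrite eq_le le/=.
  exact: (abs_zeta_lower wb ll d0 lw lp pg c0 cn zD zD' cr).
exists Pi; split => //.
- split; first exact: (odd_triple tp st sm hC lsa ltb he vb rPi PiE Pib lp d0 eo ce De fin wb lw sB dB).
  exact: (odd_nondegenerate tp st sm lsa he rPi PiE Pib lp d0 eo ce De wb lw).
- move=> chi [_ gr]; split.
    exact: (even_triple tp st sm hC lsa ltb he vb rPi PiE Pib lp d0 eo ce De fin wb lw gr sB dB).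
  exact: (even_nondegenerate tp st sm lsa he rPi PiE Pib lp d0 eo ce De wb lw gr).
- move=> fs pg; split.
    apply: abs => // s s0; rewrite (odd_to_evenE D l he).
    exact: (zeta_odd_summable he wb cI (odd_core st lsa he eo ce De wb lw) s0).
  move=> chi [_ gr]; apply: abs => // s s0; rewrite (even_to_oddE l st he gr).
  exact: (zeta_even_summable he wb cI (even_core st lsa he eo ce De wb lw gr) s0).
Qed.
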